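(* Let $f>0$, $\kappa>0$, and let $\|\cdot\|$ be the Euclidean norm on $\mathbb{R}^2$. When the inbound cost is negligible, the optimal service region shape is the regular hexagon: there exists a design all of whose service regions are congruent regular hexagons and whose cost is less than or equal to the cost of every other design (design and cost as defined in the context).
   Context: Customers are uniformly distributed on $\mathbb{R}^2$ and are served from facilities. A design (with the inbound truck ignored) consists of: (i) a locally finite infinite set $X\subset\mathbb{R}^2$ of facility locations; (ii) service regions $\mathcal{A}(p)$, $p\in X$, which are measurable sets of finite positive area, cover $\mathbb{R}^2$, overlap pairwise only in null sets, and satisfy $\|x-p\|\le\|x-q\|$ for all $x\in\mathcal{A}(p)$ and $q\in X$ (each customer goes to a nearest facility, ties broken arbitrarily; so the regions form a Voronoi diagram); (iii) for each $N\ge 1$ a subset $X_N\subset X$ with $N$ elements such that the regions $U_N=\bigcup_{p\in X_N}\mathcal{A}(p)$ exhaust the plane, i.e. there are radii $\rho_N\to\infty$ such that, for all large $N$, the disc $B(0,\rho_N)$ is contained in $U_N$ up to a null set, and $|U_N\setminus B(0,\rho_N)|/|U_N|\to 0$ as $N\to\infty$. The cost of a design (facility set-up plus outbound delivery cost per unit area-time) is $$\liminf_{N\to\infty}\ \frac{f}{\sum_{p\in X_N}|\mathcal{A}(p)|}\sum_{p\in X_N}\Bigl(1+\kappa\int_{\mathcal{A}(p)}\|x-p\|\,dx\Bigr).$$ *)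

(* Defs.v *)
From HB Require Import structures.
From mathcomp Require Import all_boot all_order all_algebra.
From mathcomp Require Import all_classical all_reals all_analysis.

Set Implicit Arguments.
Unset Strict Implicit.
Unset Printing Implicit Defensive.

Import Order.TTheory GRing.Theory Num.Theory.
Import numFieldNormedType.Exports.

Local Open Scope classical_set_scope.
Local Open Scope ring_scope.

(* The library norm on [R * R] is the sup norm. *)
Definition enorm {R : realType} (x : R * R) : R :=
  Num.sqrt (x.1 ^+ 2 + x.2 ^+ 2).

Definition disc {R : realType} (r : R) : set (R * R) := [set x | enorm x < r].

Definition borel_lebesgue2 (R : realType) :
    {measure set (measurableTypeR R * measurableTypeR R) -> \bar R} :=
  (@lebesgue_measure R \x @lebesgue_measure R)%E.

(* [R * R] with the Lebesgue sigma-algebra; the canonical product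
   sigma-algebra on [R * R] is only the Borel one. *)
Notation lebesgue_plane R := (caratheodory_type (borel_lebesgue2 R)^*%mu).

Definition lebesgue2 {R : realType} : set (lebesgue_plane R) -> \bar R :=
  @completed_measure_extension _ _ _ (borel_lebesgue2 R).
HB.instance Definition _ (R : realType) := Measure.on (@lebesgue2 R).

Definition lebesgue_measurable {R : realType} (S : set (R * R)) : Prop :=
  measurable (S : set (lebesgue_plane R)).

Definition area {R : realType} (S : set (R * R)) : \bar R := lebesgue2 S.

(* [region p] is irrelevant for [p] outside [facilities], and [batch 0] is
   unconstrained. *)
Record design (R : realType) := Design {
  facilities : set (R * R);
  region : R * R -> set (R * R);
  batch : nat -> set (R * R);
  facilities_locally_finite :
    forall r : R, finite_set (facilities `&` disc r);
  facilities_infinite : infinite_set facilities;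
  region_measurable :
    forall p, facilities p -> lebesgue_measurable (region p);
  region_area_gt0 : forall p, facilities p -> (0 < area (region p))%E;
  region_area_lty : forall p, facilities p -> (area (region p) < +oo)%E;
  region_cover : \bigcup_(p in facilities) region p = setT;
  region_overlap : forall p q, facilities p -> facilities q -> p <> q ->
    area (region p `&` region q) = 0%E;
  region_nearest : forall p q x, facilities p -> facilities q ->
    region p x -> enorm (x - p) <= enorm (x - q);
  batch_sub : forall N, (0 < N)%N -> batch N `<=` facilities;
  batch_card : forall N, (0 < N)%N -> (batch N #= `I_N)%card;
  batch_exhaust : exists rho : nat -> R,
    [/\ rho @ \oo --> +oo,
        \forall N \near \oo,
          area (disc (rho N) `\` \bigcup_(p in batch N) region p) = 0%E &
        (fun N => fine (area (\bigcup_(p in batch N) region p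
                                `\` disc (rho N)))
                  / fine (area (\bigcup_(p in batch N) region p)))
          @ \oo --> 0] }.

Definition cost {R : realType} (f kappa : R) (D : design R) : \bar R :=
  limn_einf (fun N =>
    (f / \sum_(p \in batch D N) fine (area (region D p)))%:E *
    \sum_(p \in batch D N)
      (1 + kappa%:E *
           \int[lebesgue2]_(x in region D p) (enorm (x - p))%:E))%E.

Definition hexagon_vertex {R : realType} (c : R * R) (s t : R) (i : 'I_6) :
    R * R :=
  (c.1 + s * cos (t + i%:R * (pi / 3)), c.2 + s * sin (t + i%:R * (pi / 3))).

Definition convex_hull_of {R : realType} n (v : 'I_n -> R * R) :
    set (R * R) :=
  [set x | exists w : 'I_n -> R,
     [/\ forall i, 0 <= w i, \sum_i w i = 1,
         x.1 = \sum_i w i * (v i).1 & x.2 = \sum_i w i * (v i).2]].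

Definition regular_hexagon {R : realType} (S : set (R * R)) : Prop :=
  exists c s t, 0 < s /\ S = convex_hull_of (hexagon_vertex c s t).

Definition congruent {R : realType} (S T : set (R * R)) : Prop :=
  exists g : R * R -> R * R,
    (forall x y, enorm (g x - g y) = enorm (x - y)) /\ g @` S = T.

(* Main.v *)
Require Import Defs.
From HB Require Import structures.
From mathcomp Require Import all_boot all_order all_algebra.
From mathcomp Require Import finmap.
From mathcomp Require Import all_classical all_reals all_analysis.
From mathcomp Require Import measurable_realfun.
From mathcomp Require Import zify ring lra.

(** The optimal cell is found by a calibration. Normalize the hexagon by the choice of
its inradius h, so that kappa times the integral of |x| over it is 2 ([hexagon_enorm]);
then each cell of the honeycomb costs 3 f, that is, f kappa m per unit area, where
kappa m |hexagon| = 3 ([hexagon_area]). It has to be shown that no design costs less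
than f kappa m ([cost_ge]).

Let r be the circumradius, and let the weight of a point x be kappa (|x| - m) if
|x| <= r and 0 otherwise. As m < r, the delivery cost kappa |x| is at least kappa m
plus the weight. So it suffices that for n sites the number n plus the sum over the
sites of the weight of their Voronoi cells, each seen from its own site, is
nonnegative ([finite_voronoi]); truncating to a large disc introduces only errors of the
order of the perimeter ([partial_cost]).

The weight of a cell is the weight of the plane minus that of the complement. The
complement is cut into pieces, one for each neighbouring site: a piece is the part of a
cone that lies beyond a bisector. By [cone_cap_le] no such piece weighs more than
the half-plane beyond a side of the hexagon ([capmass]), whatever the cone and the
distance of the bisector. All the cells together have at most 6 n neighbours
([adjacent_bound]), and 1 plus the weight of the plane equals 6 [capmass]
([weight_balance]): this is the same computation for the hexagon, whose six caps do not
overlap where the weight is nonzero. The two facts give the inequality.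

The bound on one piece has two steps. Along each ray the primitive t^3/3 - m t^2/2
decides whether the ray should belong to the cone, and the best choice leaves out only
a small disc ([cone_cap_le_ring]); along each vertical chord the weight integrates to
something nonpositive before the abscissa h and nonnegative after it ([slice_ring],
[slice_cap]), so that the line should be at distance h ([ring_le_cap]).

The number of neighbours is bounded without planar topology. A line sweeps over
the plane; each cell is met during an interval of time, and adjacent cells are
consecutive on the line at some moment. Charging every pair to the first such
moment shows that n intervals have at most 3 n consecutive pairs ([bar_visibility]).

The honeycomb attains the bound: the Voronoi cells of the lattice [sites] are
translates of the hexagon ([site_regionE]), all with the same area and cost
([honeycomb_cost_le]). *)

Set Implicit Arguments.
Unset Strict Implicit.
Unset Printing Implicit Defensive.

Import Order.TTheory GRing.Theory Num.Theory.
Import numFieldNormedType.Exports.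

Local Open Scope classical_set_scope.
Local Open Scope ring_scope.

(** * Area-preserving maps of the plane *)

Section affine_line.
Context {R : realType}.
Notation leb := (@lebesgue_measure R).

Lemma measurable_affine (c d : R) :
  measurable_fun [set: measurableTypeR R]
    ((fun x => c * x + d) : measurableTypeR R -> measurableTypeR R).
Proof.
apply: measurable_funD => //; exact: measurable_funM.
Qed.

(** By uniqueness of the Lebesgue measure it is enough to compare both sides on
bounded half-open intervals. *)
Lemma lebesgue_measure_affine (c d : R) (A : set (measurableTypeR R)) :
  0 < c -> measurable A ->
  (c%:E * leb ((fun x => c * x + d)%R @^-1` A) = leb A)%E.
Proof.
move=> c0 mA.
pose phi := (fun x => c * x + d) : measurableTypeR R -> measurableTypeR R.
have mphi : measurable_fun setT phi by exact: measurable_affine.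
pose m0 : {measure set (measurableTypeR R) -> \bar R} :=
  measure_function_pushforward__canonical__measure_function_Measure leb mphi.
pose m : {measure set (measurableTypeR R) -> \bar R} := mscale (NngNum (ltW c0)) m0.
rewrite -[LHS]/(m A); apply/esym/lebesgue_measure_unique => //= _ [[a b]] _ <-.
rewrite /mscale /= /pushforward /=.
have -> : phi @^-1` `]a, b]%classic = `](a - d) / c, (b - d) / c]%classic.
  apply/seteqP; split => x; rewrite /phi /= !in_itv /= ltr_pdivrMr// ler_pdivlMr//.
    by rewrite ltrBlDr lerBrDr mulrC.
  by rewrite ltrBlDr lerBrDr mulrC.
rewrite !lebesgue_measure_itv/= !lte_fin ltr_pM2r ?invr_gt0// ltrD2r.
case: ifPn => ab; last by rewrite mule0.
rewrite -!EFinB -EFinM; congr EFin; field; lra.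
Qed.

Lemma ge0_integral_affine (c d : R) (f : measurableTypeR R -> \bar R) :
  0 < c -> measurable_fun setT f -> (forall x, 0 <= f x)%E ->
  (\int[leb]_x f x = c%:E * \int[leb]_x f (c * x + d)%R)%E.
Proof.
move=> c0 mf f0.
pose phi := (fun x => c * x + d) : measurableTypeR R -> measurableTypeR R.
have mphi : measurable_fun setT phi by exact: measurable_affine.
pose m0 : {measure set (measurableTypeR R) -> \bar R} :=
  measure_function_pushforward__canonical__measure_function_Measure leb mphi.
pose m : {measure set (measurableTypeR R) -> \bar R} := mscale (NngNum (ltW c0)) m0.
transitivity (\int[m]_x f x)%E.
  apply: eq_measure_integral => A mA _.
  by apply/esym; exact: lebesgue_measure_affine.
rewrite /m ge0_integral_mscale//=; congr (_ * _)%E.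
by rewrite ge0_integral_pushforward.
Qed.

End affine_line.

Section plane_maps.
Context {R : realType}.
Notation leb := (@lebesgue_measure R).
Notation pl := (measurableTypeR R * measurableTypeR R)%type.
Notation mu := (borel_lebesgue2 R).

Lemma area_xsection (A : set pl) : mu A = (\int[leb]_x leb (xsection A x))%E.
Proof. by []. Qed.

Lemma area_ysection (A : set pl) : measurable A ->
  mu A = (\int[leb]_y leb (ysection A y))%E.
Proof.
move=> mA.
rewrite -[RHS]/((leb \x^ leb)%E A).
apply: (@product_measure_unique _ _ _ _ R leb leb (leb \x^ leb)%E) => // B C mB mC.
exact: product_measure2E.
Qed.

Definition preserves_area (T : pl -> pl) :=
  measurable_fun setT T /\ forall A, measurable A -> mu (T @^-1` A) = mu A.

Lemma measurable_preimageT d d' (X : measurableType d) (Y : measurableType d') (f : X -> Y)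
  (A : set Y) : measurable_fun setT f -> measurable A -> measurable (f @^-1` A).
Proof. by move=> mf mA; rewrite -[X in measurable X]setTI; exact: mf. Qed.

Lemma preserves_area_comp S T : preserves_area S -> preserves_area T ->
  preserves_area (S \o T).
Proof.
move=> [mS pS] [mT pT]; split; first exact: measurableT_comp.
move=> A mA; rewrite comp_preimage pT ?pS//; exact: measurable_preimageT.
Qed.

Lemma preserves_area_id : preserves_area id.
Proof. by split. Qed.

Definition shear_up (a b : R) (x : pl) : pl := (x.1, x.2 + (a * x.1 + b)).
Definition shear_right (a b : R) (x : pl) : pl := (x.1 + (a * x.2 + b), x.2).

Lemma measurable_lin (a b c : R) :
  measurable_fun setT (fun x : pl => a * x.1 + b * x.2 + c).
Proof.
by apply: measurable_funD => //; apply: measurable_funD; apply: measurable_funM.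
Qed.

Lemma measurable_pair_lin (a b c a' b' c' : R) :
  measurable_fun setT (fun x : pl => (a * x.1 + b * x.2 + c, a' * x.1 + b' * x.2 + c') : pl).
Proof. by apply/measurable_fun_pairP; split; apply: measurable_lin. Qed.

(** A shear translates every vertical section, so Fubini reduces the claim to the
translation invariance of the measure of the line. *)
Lemma preserves_area_shear_up a b : preserves_area (shear_up a b).
Proof.
have mS : measurable_fun setT (shear_up a b).
  have := measurable_pair_lin 1 0 0 a 1 b; congr measurable_fun.
  by apply/funext => x; rewrite /shear_up; congr pair; ring.
split=> // A mA; rewrite !area_xsection; apply: eq_integral => x _.
rewrite -[RHS](@lebesgue_measure_affine _ 1 (a * x + b))//; last exact: measurable_xsection.
rewrite mul1e; congr (leb _); apply/seteqP; split => y; rewrite /xsection /shear_up /= !inE /=.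
  by rewrite mul1r.
by rewrite mul1r.
Qed.

Lemma preserves_area_shear_right a b : preserves_area (shear_right a b).
Proof.
have mS : measurable_fun setT (shear_right a b).
  have := measurable_pair_lin 1 a b 0 1 0; congr measurable_fun.
  by apply/funext => x; rewrite /shear_right; congr pair; ring.
split=> // A mA; rewrite !area_ysection//; last exact: measurable_preimageT.
apply: eq_integral => x _.
rewrite -[RHS](@lebesgue_measure_affine _ 1 (a * x + b))//; last exact: measurable_ysection.
rewrite mul1e; congr (leb _); apply/seteqP; split => y; rewrite /ysection /shear_right /= !inE /=.
  by rewrite mul1r.
by rewrite mul1r.
Qed.

Lemma preserves_area_translation (p : pl) :
  preserves_area (fun x => (x.1 + p.1, x.2 + p.2)).
Proof.
have := preserves_area_comp (preserves_area_shear_up 0 p.2) (preserves_area_shear_right 0 p.1).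
congr preserves_area; apply/funext => x; rewrite /shear_up /shear_right /=; congr pair; ring.
Qed.

Definition rot (c s : R) (x : pl) : pl := (c * x.1 - s * x.2, s * x.1 + c * x.2).

(** A rotation with [s != 0] is a product of three shears; the half-turn is the
square of a quarter-turn. *)
Lemma preserves_area_rot c s : c ^+ 2 + s ^+ 2 = 1 -> preserves_area (rot c s).
Proof.
have nz (c0 s0 : R) : c0 ^+ 2 + s0 ^+ 2 = 1 -> s0 != 0 -> preserves_area (rot c0 s0).
  move=> cs s0n.
  pose a := (c0 - 1) / s0.
  have := preserves_area_comp (preserves_area_shear_right a 0)
    (preserves_area_comp (preserves_area_shear_up s0 0) (preserves_area_shear_right a 0)).
  congr preserves_area; apply/funext => x; rewrite /rot /shear_up /shear_right /a /=.
  have c2 : c0 * c0 = 1 - s0 * s0 by rewrite -!expr2 -cs; ring.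
  have as1 : (c0 - 1) / s0 * s0 = c0 - 1 by field.
  have ac : (c0 - 1) / s0 * (c0 + 1) = - s0.
    by rewrite mulrAC mulrDr mulrBl c2; field.
  congr pair; last first.
    transitivity (s0 * x.1 + (1 + (c0 - 1) / s0 * s0) * x.2); first by ring.
    by rewrite as1; ring.
  transitivity ((1 + (c0 - 1) / s0 * s0) * x.1
     + (c0 - 1) / s0 * (1 + (1 + (c0 - 1) / s0 * s0)) * x.2); first by ring.
  by rewrite as1 [1 + (c0 - 1)](_ : _ = c0) ?[1 + c0]addrC ?ac; ring.
move=> cs; have [s0|] := eqVneq s 0; last exact: nz.
have c2 : c * c = 1 by move: cs; rewrite s0 expr0n addr0 -expr2.
have q : preserves_area (rot 0 1) by apply: nz; rewrite ?oner_neq0//; ring.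
have [->|cn] := eqVneq c 1.
  have := preserves_area_id; congr preserves_area; apply/funext => x.
  by rewrite /rot s0 !mul1r !mul0r subr0 add0r; case: x.
have -> : c = -1.
  by have /eqP := c2; rewrite -expr2 sqrf_eq1 (negbTE cn)/= => /eqP.
have := preserves_area_comp q q; congr preserves_area; apply/funext => x.
by rewrite /rot s0 /=; congr pair; ring.
Qed.

Lemma area_scale (s : R) (A : set pl) : 0 < s -> measurable A ->
  ((s ^+ 2)%:E * mu ((fun x : pl => (s * x.1, s * x.2)%R) @^-1` A) = mu A)%E.
Proof.
move=> s0 mA.
pose S1 := fun x : pl => (s * x.1, x.2) : pl.
pose S2 := fun x : pl => (x.1, s * x.2) : pl.
have m1 : measurable_fun setT S1.
  have := measurable_pair_lin s 0 0 0 1 0; congr measurable_fun.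
  by apply/funext => x; rewrite /S1; congr pair; ring.
have m2 : measurable_fun setT S2.
  have := measurable_pair_lin 1 0 0 0 s 0; congr measurable_fun.
  by apply/funext => x; rewrite /S2; congr pair; ring.
have e2 B : measurable B -> (s%:E * mu (S2 @^-1` B) = mu B)%E.
  move=> mB; rewrite !area_xsection -ge0_integralZl//=; last 2 first.
  - by apply: measurable_fun_xsection; exact: measurable_preimageT.
  - by rewrite lee_fin ltW.
  apply: eq_integral => x _.
  rewrite -[RHS](@lebesgue_measure_affine _ s 0)//; last exact: measurable_xsection.
  by congr (_ * leb _)%E; apply/seteqP; split => y; rewrite /xsection /S2 /= !inE /= addr0.
have e1 B : measurable B -> (s%:E * mu (S1 @^-1` B) = mu B)%E.
  move=> mB; rewrite !area_ysection//; last exact: measurable_preimageT.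
  rewrite -ge0_integralZl//=; last 2 first.
  - by apply: measurable_fun_ysection; exact: measurable_preimageT.
  - by rewrite lee_fin ltW.
  apply: eq_integral => x _.
  rewrite -[RHS](@lebesgue_measure_affine _ s 0)//; last exact: measurable_ysection.
  by congr (_ * leb _)%E; apply/seteqP; split => y; rewrite /ysection /S1 /= !inE /= addr0.
rewrite -[RHS]e1// -[in RHS]e2//; last exact: measurable_preimageT.
by rewrite muleA -EFinM expr2.
Qed.

Lemma line_null (a b c : R) : (a != 0) || (b != 0) ->
  mu [set x : pl | a * x.1 + b * x.2 = c] = 0%E.
Proof.
move=> ab.
have mL : measurable [set x : pl | a * x.1 + b * x.2 = c].
  rewrite -[X in measurable X]setTI.
  have := @measurable_fun_eqr _ _ R setT (fun x : pl => a * x.1 + b * x.2 + 0) (cst c).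
  move=> /(_ (measurable_lin _ _ _) (measurable_cst _)) /(_ measurableT [set true]).
  move=> /(_ ltac:(by [])); congr measurable; congr setI.
  by apply/seteqP; split => x /=; rewrite addr0 => /eqP.
have [b0|bn] := eqVneq b 0.
  have an : a != 0 by move: ab; rewrite b0 eqxx orbF.
  rewrite area_ysection// integral0_eq// => y _.
  rewrite -(lebesgue_measure_set1 (c / a)); congr (leb _).
  apply/seteqP; split => x; rewrite /ysection /= inE/= b0 mul0r addr0.
    by move=> <-; field.
  by move=> ->; field.
rewrite area_xsection integral0_eq// => x _.
rewrite -(lebesgue_measure_set1 ((c - a * x) / b)); congr (leb _).
apply/seteqP; split => y; rewrite /xsection /= inE/=.
  by move=> <-; field.
by move=> ->; field.
Qed.

Lemma preserves_ge0_integral T (f : pl -> \bar R) : preserves_area T ->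
  measurable_fun setT f -> (forall x, 0 <= f x)%E ->
  (\int[mu]_x f (T x) = \int[mu]_x f x)%E.
Proof.
move=> [mT pT] mf f0.
transitivity (\int[measure_function_pushforward__canonical__measure_function_Measure mu mT]_x f x)%E.
  by rewrite ge0_integral_pushforward.
by apply: eq_measure_integral => A mA _; rewrite -pT.
Qed.

End plane_maps.

(** * The Borel plane and its completion *)

Section completion.
Context {R : realType}.
Notation pl := (measurableTypeR R * measurableTypeR R)%type.
Notation mu := (borel_lebesgue2 R).
Notation enorm := (@enorm R).

Lemma borel_lebesgue_measurable (A : set pl) : measurable A -> lebesgue_measurable A.
Proof. exact: caratheodory_measurable_mu_ext. Qed.

Lemma area_borel (A : set pl) : measurable A -> area A = mu A.
Proof.
by move=> mA; rewrite /area /lebesgue2 /completed_measure_extension measurable_mu_extE.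
Qed.

Lemma measurable_completion : measurable_fun setT (id : lebesgue_plane R -> pl).
Proof. by move=> _ A mA; rewrite setTI; exact: borel_lebesgue_measurable. Qed.

(** The identity from the completed plane to the Borel plane is measurable and
pushes the completed measure forward to the Borel one. *)
Lemma ge0_integral_completion (A : set pl) (f : pl -> \bar R) : measurable A ->
  measurable_fun setT f -> (forall x, 0 <= f x)%E ->
  (\int[lebesgue2]_(x in A) f x = \int[mu]_(x in A) f x)%E.
Proof.
move=> mA mf f0.
transitivity (\int[measure_function_pushforward__canonical__measure_function_Measure
  (@lebesgue2 R) measurable_completion]_(x in A) f x)%E.
  rewrite (ge0_integral_pushforward measurable_completion lebesgue2 mA) //.
  exact: measurable_funTS.
apply: eq_measure_integral => B mB _.
exact: area_borel.
Qed.

Lemma measurable_enorm : measurable_fun setT (enorm : pl -> R).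
Proof.
rewrite /Defs.enorm; apply: (@measurableT_comp _ _ _ _ _ _ (@Num.sqrt R)).
  by apply: continuous_measurable_fun; exact: sqrt_continuous.
apply: measurable_funD; first by apply: measurable_funX; exact: measurable_fst.
by apply: measurable_funX; exact: measurable_snd.
Qed.

End completion.

Section plane_integrals.
Context {R : realType}.
Notation leb := (@lebesgue_measure R).
Notation pl := (measurableTypeR R * measurableTypeR R)%type.
Notation mu := (borel_lebesgue2 R).
Notation enorm := (@enorm R).
Implicit Types (A B : set pl) (g : pl -> R).

Lemma integrableT (f : pl -> \bar R) A : mu.-integrable setT f -> measurable A ->
  mu.-integrable A f.
Proof. by move=> fi mA; apply: integrableS fi. Qed.

Lemma integral_splitI g A B : mu.-integrable setT (EFin \o g) ->
  measurable A -> measurable B ->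
  \int[mu]_(x in A) g x = \int[mu]_(x in A `&` B) g x + \int[mu]_(x in A `\` B) g x.
Proof.
move=> ig mA mB.
have mI : measurable (A `&` B) by exact: measurableI.
have mD : measurable (A `\` B) by exact: measurableD.
rewrite -[in LHS](setUIDK A B) Rintegral_setU//.
- by apply: integrableT => //; exact: measurableU.
- by apply/disj_setPS => x [[_ +] [_]].
Qed.

Lemma integral_null g A : mu.-integrable setT (EFin \o g) -> measurable A ->
  mu A = 0%E -> \int[mu]_(x in A) g x = 0.
Proof.
move=> ig mA A0; rewrite /Rintegral null_set_integral//.
have /integrableP[+ _] := integrableT ig mA; exact.
Qed.

Lemma integral_ae g A B : mu.-integrable setT (EFin \o g) ->
  measurable A -> measurable B -> mu (A `\` B) = 0%E -> mu (B `\` A) = 0%E ->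
  \int[mu]_(x in A) g x = \int[mu]_(x in B) g x.
Proof.
move=> ig mA mB AB BA.
rewrite (integral_splitI ig mA mB) (integral_splitI ig mB mA) setIC.
by rewrite (integral_null ig (measurableD mA mB) AB) (integral_null ig (measurableD mB mA) BA).
Qed.

Lemma preserves_integrable g T : preserves_area T ->
  mu.-integrable setT (EFin \o g) -> mu.-integrable setT (EFin \o (g \o T)).
Proof.
move=> pT /integrableP[mg fg]; have [mT _] := pT; apply/integrableP; split.
  exact: measurableT_comp mg mT.
rewrite (_ : (fun _ => _) = (fun x => (abse \o (EFin \o g)) (T x)))//.
rewrite (preserves_ge0_integral pT)//; [exact: measurableT_comp|by move=> x; exact: abse_ge0].
Qed.

Lemma preserves_Rintegral g T A : preserves_area T ->
  mu.-integrable setT (EFin \o g) -> measurable A ->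
  \int[mu]_(x in T @^-1` A) g (T x) = \int[mu]_(x in A) g x.
Proof.
move=> pT ig mA; have [mT eT] := pT; have /integrableP[mg _] := ig.
congr fine.
transitivity (\int[measure_function_pushforward__canonical__measure_function_Measure mu mT]_(x in A) (EFin \o g) x)%E.
  rewrite integral_pushforward//.
  exact: integrableT (preserves_integrable pT ig) (measurable_preimageT mT mA).
by apply: eq_measure_integral => B mB _; rewrite -eT.
Qed.

Lemma Fubini_ge0 g : mu.-integrable setT (EFin \o g) ->
  (forall x, 0 <= \int[leb]_y (g (x, y))%:E)%E -> 0 <= \int[mu]_x g x.
Proof.
move=> ig h; apply: fine_ge0.
rewrite -(integral12_prod_meas1 ig); apply: integral_ge0 => x _; exact: h.
Qed.

Lemma measurable_le_fun (f g : pl -> R) : measurable_fun setT f -> measurable_fun setT g ->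
  measurable [set x | f x <= g x].
Proof.
move=> mf mg; rewrite -[X in measurable X]setTI.
have := measurable_fun_ler mf mg measurableT (Y := [set true]) ltac:(by []).
by congr measurable; congr setI; apply/seteqP; split.
Qed.

Lemma measurable_disc (r : R) : measurable (disc r : set pl).
Proof.
rewrite -[X in measurable X]setTI.
have := @measurable_fun_ltr _ _ R setT (enorm : pl -> R) (cst r) measurable_enorm
  (measurable_cst _) measurableT [set true] ltac:(by []).
by congr measurable; congr setI; apply/seteqP; split.
Qed.

Lemma normr_fst_enorm (x : R * R) : `|x.1| <= enorm x.
Proof.
rewrite /Defs.enorm -[leLHS]sqrtr_sqr; apply: ler_wsqrtr.
by rewrite lerDl sqr_ge0.
Qed.

Lemma normr_snd_enorm (x : R * R) : `|x.2| <= enorm x.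
Proof.
rewrite /Defs.enorm -[leLHS]sqrtr_sqr; apply: ler_wsqrtr.
by rewrite lerDr sqr_ge0.
Qed.

Lemma area_disc_lty (r : R) : (mu (disc r) < +oo)%E.
Proof.
have mI : measurable (`[- r, r]%classic : set (measurableTypeR R)) by [].
apply: (@le_lt_trans _ _ (mu (`[- r, r]%classic `*` `[- r, r]%classic))).
  apply: le_measure; rewrite ?inE//; [exact: measurable_disc|exact: measurableX|].
  move=> x /= xr; split => /=; rewrite in_itv /= -ler_norml; apply/ltW.
    exact: le_lt_trans (normr_fst_enorm x) xr.
  exact: le_lt_trans (normr_snd_enorm x) xr.
rewrite [ltLHS](@product_measure1E _ _ _ _ R (@lebesgue_measure R) (@lebesgue_measure R))//=.
rewrite lebesgue_measure_itv/=.
by case: ifPn => _; rewrite ?mule0 ?ltry// -!EFinD -EFinM ltry.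
Qed.

Lemma bounded_integrable (A : set pl) (f : pl -> R) (c M : R) : measurable A ->
  (forall x, A x -> enorm x <= c) -> measurable_fun setT f ->
  (forall x, A x -> `|f x| <= M) -> mu.-integrable setT (EFin \o (f \_ A)).
Proof.
move=> mA Ac mf fM; rewrite -restrict_EFin; apply/(integrable_mkcond _ mA).
apply: measurable_bounded_integrable => //.
- apply: le_lt_trans (area_disc_lty (c + 1)); apply: le_measure; rewrite ?inE//.
    exact: measurable_disc.
  by move=> x /Ac xc; rewrite /disc /= (le_lt_trans xc)// ltrDl.
- exact: measurable_funTS.
- exists M; split; first by rewrite num_real.
  by move=> N MN x /= Ax; apply/ltW; apply: le_lt_trans MN; exact: fM.
Qed.

End plane_integrals.

(** * Integrals on the line *)

Section line_integrals.
Context {R : realType}.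
Notation leb := (@lebesgue_measure R).
Implicit Types (a b x y : R).

Lemma integral_derivative (F f : R -> R) a b : a <= b ->
  (forall x, is_derive x 1 F (f x)) -> continuous f ->
  \int[leb]_(x in `[a, b]) f x = F b - F a.
Proof.
move=> ab dF cf; have [->|abn] := eqVneq a b.
  by rewrite set_itv1 Rintegral_set1 subrr.
have {abn}ab : a < b by rewrite lt_neqAle abn.
have dFx x : derivable F x 1 by have [] := dF x.
have cF x : {for x, continuous F} by apply/differentiable_continuous/derivable1_diffP.
rewrite /Rintegral (@continuous_FTC2 _ f F)//=.
- exact: continuous_subspaceT.
- split=> //.
  + exact: (cvg_at_right_filter (cF a)).
  + exact: (cvg_at_left_filter (cF b)).
- by move=> x _; rewrite derive1E; have [_] := dF x.
Qed.

Lemma integrable_continuous_itv (f : R -> R) a b : continuous f ->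
  leb.-integrable `[a, b] (EFin \o f).
Proof.
move=> cf; apply: continuous_compact_integrable; first exact: segment_compact.
exact: continuous_subspaceT.
Qed.

Lemma integral_poly (p : {poly R}) a b : a <= b ->
  \int[leb]_(x in `[a, b]) (p^`()).[x] = p.[b] - p.[a].
Proof.
move=> ab; apply: integral_derivative => //; exact: continuous_horner.
Qed.

Lemma integral_quadratic (c d : R) a b : a <= b ->
  \int[leb]_(x in `[a, b]) (c * x ^+ 2 + d * x) =
  c * (b ^+ 3 - a ^+ 3) / 3 + d * (b ^+ 2 - a ^+ 2) / 2.
Proof.
move=> ab.
pose p : {poly R} := (c / 3) *: 'X^3 + (d / 2) *: 'X^2.
transitivity (\int[leb]_(x in `[a, b]) (p^`()).[x]).
  apply: eq_Rintegral => x _; rewrite /p derivD !derivZ !derivXn !hornerE /=.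
  by field.
by rewrite integral_poly// /p !hornerE /=; field.
Qed.

Lemma continuous_hypot (c d : R) : continuous (fun y : R => Num.sqrt (c + d * y ^+ 2)).
Proof.
move=> y; apply: continuous_comp; last exact: sqrt_continuous.
apply: cvgD; first exact: cvg_cst.
by apply: cvgM; [exact: cvg_cst|exact: exprn_continuous].
Qed.

Lemma integral_scale_sym (f : R -> R) (Y : R) : 0 < Y -> continuous f ->
  (forall y, 0 <= f y) ->
  \int[leb]_(y in `[- Y, Y]) f y = Y * \int[leb]_(s in `[-1, 1]) f (Y * s).
Proof.
move=> Y0 cf f0.
have mf : measurable_fun setT f by exact: continuous_measurable_fun.
have cfY : continuous (fun s => f (Y * s)).
  move=> s; apply: continuous_comp; last exact: cf.
  by apply: cvgM; [exact: cvg_cst|exact: cvg_id].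
rewrite /Rintegral -[X in X * fine _]/(fine Y%:E) -fineM//; last first.
  by apply: integrable_fin_num => //; exact: integrable_continuous_itv.
congr fine; rewrite integral_mkcond (@ge0_integral_affine _ Y 0)//; last 2 first.
- apply/(measurable_restrictT _ _).1 => //; apply: measurable_funTS.
  exact/measurable_EFinP.
- by move=> y; rewrite patchE; case: ifPn => // _; rewrite lee_fin.
congr (_ * _)%E; rewrite [in RHS]integral_mkcond.
apply: eq_integral => y _; rewrite !patchE addr0; congr (if _ then _ else _).
have e : (Y * y \in `[- Y, Y]) = (y \in `[-1, 1]).
  by rewrite !in_itv /= -{1}[Y]mulr1 -mulrN ler_pM2l// -{2}[Y]mulr1 ler_pM2l.
by apply/idP/idP => /set_mem /= H; apply/mem_set; rewrite /= ?e// -e.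
Qed.

(** The integral of the distance to the origin over the chord at abscissa [x] of the
sector |x.2| <= x.1 / sqrt 3 is [x ^+ 2 * hexconst / Num.sqrt 3]. Its closed form
contains a logarithm; the bounds 2 and 19/9 are what enters the estimates. *)
Definition hexconst : R := \int[leb]_(s in `[-1, 1]) Num.sqrt (1 + s ^+ 2 / 3).

Lemma integral_cst_sym (c : R) : \int[leb]_(s in `[-1, 1]) c = 2 * c.
Proof.
rewrite Rintegral_cst//= lebesgue_measure_itv/= lte_fin gtrN// -EFinD /=.
by rewrite opprK mulrC; congr (_ * _); ring.
Qed.

Lemma continuous_hexconst : continuous (fun s : R => Num.sqrt (1 + s ^+ 2 / 3)).
Proof.
rewrite (_ : (fun s => _) = (fun s => Num.sqrt (1 + 3^-1 * s ^+ 2))).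
  exact: continuous_hypot.
by apply/funext => s; rewrite mulrC.
Qed.

Lemma hexconst_ge2 : 2 <= hexconst.
Proof.
rewrite -[leLHS]mulr1 -integral_cst_sym; apply: le_Rintegral => //.
- by apply: integrable_continuous_itv; exact: cst_continuous.
- by apply: integrable_continuous_itv; exact: continuous_hexconst.
- move=> s _; rewrite -[leLHS]sqrtr1; apply: ler_wsqrtr.
  by rewrite lerDl divr_ge0// sqr_ge0.
Qed.

(** Because sqrt (1 + t) <= 1 + t / 2. *)
Lemma hexconst_le : hexconst <= 2 + 1 / 9.
Proof.
pose p : {poly R} := 'X + 18^-1 *: 'X^3.
have dp s : p^`().[s] = 1 + s ^+ 2 / 6.
  by rewrite /p derivD derivZ derivXn derivX !hornerE /=; field.
have -> : 2 + 1 / 9 = \int[leb]_(s in `[-1, 1]) (p^`()).[s].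
  by rewrite integral_poly ?lerN1r// /p !hornerE /=; field.
apply: le_Rintegral => //.
- by apply: integrable_continuous_itv; exact: continuous_hexconst.
- by apply: integrable_continuous_itv; exact: continuous_horner.
- move=> s _; rewrite dp; have s2 := sqr_ge0 s.
  rewrite -[leRHS]ger0_norm ?addr_ge0 ?divr_ge0// -sqrtr_sqr; apply: ler_wsqrtr.
  by nra.
Qed.

End line_integrals.

(** * Slope coordinates *)

Section slopes.
Context {R : realType}.
Notation leb := (@lebesgue_measure R).
Notation pl := (measurableTypeR R * measurableTypeR R)%type.
Notation mu := (borel_lebesgue2 R).

Let slope (f : pl -> \bar R) (z : pl) : \bar R := (z.1%:E * f (z.1, z.1 * z.2)%R)%E.

Let slope_ge0 f : (forall x, 0 <= f x)%E -> (forall x : pl, x.1 <= 0 -> f x = 0%E) ->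
  forall z, (0 <= slope f z)%E.
Proof.
move=> f0 fz z; have [z0|z0] := leP z.1 0; first by rewrite /slope fz ?mule0.
by rewrite /slope mule_ge0// lee_fin ltW.
Qed.

Let measurable_slope f : measurable_fun setT f -> measurable_fun setT (slope f).
Proof.
move=> mf; apply: emeasurable_funM.
  by apply/measurable_EFinP; exact: measurable_fst.
apply: measurableT_comp => //; apply/measurable_fun_pairP; split => /=.
  exact: measurable_fst.
by apply: measurable_funM; [exact: measurable_fst|exact: measurable_snd].
Qed.

(** The map (s, t) |-> (s, s t) turns the rays of the right half-plane into lines of
constant slope [t]. Its Jacobian is [s]: at a fixed abscissa it is a scaling of the
ordinate, so Fubini and scaling on the line suffice. *)
Lemma ge0_integral_slope (f : pl -> \bar R) : measurable_fun setT f ->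
  (forall x, 0 <= f x)%E -> (forall x : pl, x.1 <= 0 -> f x = 0%E) ->
  (\int[mu]_x f x = \int[leb]_t \int[leb]_s (s%:E * f (s, s * t)%R))%E.
Proof.
move=> mf f0 fz.
rewrite fubini_tonelli1//.
rewrite -[RHS](fubini_tonelli _ (measurable_slope mf) (slope_ge0 f0 fz)).
apply: eq_integral => x _; rewrite /fubini_F /slope /=.
have mfx : measurable_fun setT (fun y => f (x, y)) by exact: measurableT_comp.
have [x0|x0] := leP x 0.
  rewrite !integral0_eq// => y _; last by rewrite fz.
  by rewrite fz// mule0.
rewrite (@ge0_integral_affine _ x 0)//=; under eq_integral do rewrite addr0.
rewrite ge0_integralZl//=; last by rewrite lee_fin ltW.
by apply: measurableT_comp => //; apply/measurable_fun_pairP; split => /=; [exact: measurable_cst|exact: measurable_funM].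
Qed.

(** A sign that holds on every ray holds for the plane integral. The positive and the
negative part are transformed separately, since the formula for nonnegative
functions says nothing about the convergence of a signed iterated integral. *)
Lemma integral_slope_ge0 (g : pl -> R) : mu.-integrable setT (EFin \o g) ->
  (forall x : pl, x.1 <= 0 -> g x = 0) ->
  (forall t, 0 <= \int[leb]_s (s * g (s, s * t)%R)%:E)%E ->
  0 <= \int[mu]_x g x.
Proof.
move=> ig gz h.
have /integrableP[mg _] := ig.
rewrite fine_ge0// integralE.
have mp := measurable_funepos mg; have mn := measurable_funeneg mg.
have z (x : pl) : x.1 <= 0 -> ((EFin \o g)^\+ x = 0 /\ (EFin \o g)^\- x = 0)%E.
  by move=> x0; rewrite funeposE funenegE /= gz// oppr0 maxxx.
have pz (x : pl) : x.1 <= 0 -> (EFin \o g)^\+%E x = 0%E by move/z => [].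
have nz (x : pl) : x.1 <= 0 -> (EFin \o g)^\-%E x = 0%E by move/z => [].
rewrite sube_ge0; last by rewrite (integrable_pos_fin_num measurableT ig) orbT.
rewrite !ge0_integral_slope//.
apply: ge0_le_integral => //.
- move=> t _; apply: integral_ge0 => s _.
  by apply: (slope_ge0 _ nz (s, t)) => y; exact: funeneg_ge0.
- have := @measurable_fun_fubini_tonelli_G _ _ _ _ R leb _ (measurable_slope mn).
  by apply; apply: slope_ge0 => // y; exact: funeneg_ge0.
- have := @measurable_fun_fubini_tonelli_G _ _ _ _ R leb _ (measurable_slope mp).
  by apply; apply: slope_ge0 => // y; exact: funepos_ge0.
move=> t _; have := h t; rewrite integralE.
have -> : (\int[leb]_s ((fun s => (s * g (s, s * t)%R)%:E)^\+ s) =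
  \int[leb]_s (s%:E * (EFin \o g)^\+ (s, s * t)%R))%E.
  apply: eq_integral => s _; have [s0|s0] := leP s 0.
    by rewrite pz// mule0 funeposE gz// mulr0 maxxx.
  by rewrite !funeposE /= maxeMr ?lee_fin ?ltW// mule0 EFinM.
have -> : (\int[leb]_s ((fun s => (s * g (s, s * t)%R)%:E)^\- s) =
  \int[leb]_s (s%:E * (EFin \o g)^\- (s, s * t)%R))%E.
  apply: eq_integral => s _; have [s0|s0] := leP s 0.
    by rewrite nz// mule0 funenegE gz// mulr0 oppe0 maxxx.
  by rewrite !funenegE /= maxeMr ?lee_fin ?ltW// mule0 -EFinM mulrN.
have sub (A B : \bar R) : (0 <= A - B -> B <= A)%E.
  by case: A B => [a| |] [b| |] //=; rewrite ?leey ?leNye// !lee_fin subr_ge0.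
exact: sub.
Qed.

End slopes.

(** * The constants of the optimal hexagon *)

(** Lengths attached to the optimal hexagon: [inrad] and [circ] are its inradius and
circumradius; [mid] is the distance at which the delivery cost equals the price
[kappa * mid] that the optimal hexagon pays per unit area, in units of [f]; and [inner] is the
radius below [circ] where t^3/3 - mid t^2/2 takes the value that it has at [circ].
The size is fixed by [calibrated]: with it the delivery cost of one hexagon is
twice the set-up cost (see [hexagon_enorm]), which is the stationarity condition
in the size. *)
Record calibration (R : realType) (kappa : R) := Calibration {
  inrad : R;
  mid : R;
  circ : R;
  inner : R;
  kappa_gt0 : 0 < kappa;
  inrad_gt0 : 0 < inrad;
  circ_gt0 : 0 < circ;
  circ_sqr : circ ^+ 2 = 4 / 3 * inrad ^+ 2;
  mid_hexconst : 2 * mid = inrad * hexconst;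
  inner_gt0 : 0 < inner;
  inner_le : inner <= inrad;
  inner_balance : circ ^+ 3 / 3 - mid * circ ^+ 2 / 2 =
                  inner ^+ 3 / 3 - mid * inner ^+ 2 / 2;
  calibrated : kappa * hexconst * inrad ^+ 3 = Num.sqrt 3 }.

(** The inradius is a cube root. Dividing the balance equation by [circ - inner]
leaves a quadratic, whose positive root is the inner radius. That this root does not
exceed the inradius is a numerical fact, checked with rational bounds on sqrt 3 and
[hexconst]. *)
Lemma exists_calibration (R : realType) (kappa : R) : 0 < kappa ->
  inhabited (calibration kappa).
Proof.
move=> k0.
have c2 := @hexconst_ge2 R; have c3 := @hexconst_le R.
set k := @hexconst R in c2 c3 *.
set w := Num.sqrt 3 : R.
have w0 : 0 < w by rewrite sqrtr_gt0.
have w2 : w ^+ 2 = 3 by rewrite sqr_sqrtr.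
have kk0 : 0 < kappa * k by rewrite mulr_gt0//; lra.
pose h := (w / (kappa * k)) `^ (3^-1).
have h0 : 0 < h by rewrite powR_gt0// divr_gt0.
have h3 : kappa * k * h ^+ 3 = w.
  rewrite -powR_mulrn ?powR_ge0// -powRrM mulVf ?pnatr_eq0// powRr1 ?divr_ge0 ?ltW//.
  by rewrite mulrCA divff ?mulr1// gt_eqF.
pose m := h * k / 2; pose r := 2 * h / w.
have r0 : 0 < r by rewrite divr_gt0// mulr_gt0.
have r2 : r ^+ 2 = 4 / 3 * h ^+ 2.
  by rewrite /r expr_div_n w2 exprMn; field.
have wlo : 1731 / 1000 < w by move: w0 w2; clear; nra.
have whi : w < 1733 / 1000 by move: w0 w2; clear; nra.
have rw : r = 2 * h * w / 3.
  by rewrite /r -w2; field; rewrite gt_eqF.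
have rlo : 1154 / 1000 * h < r by rewrite rw; move: h0 wlo; clear; nra.
have rhi : r < 1156 / 1000 * h by rewrite rw; move: h0 whi; clear; nra.
have hm : h <= m.
  have c2' : 0 <= k - 2 by rewrite subr_ge0.
  by have := mulr_ge0 (ltW h0) c2'; rewrite /m; lra.
have mhi : m <= h * (1 + 1 / 18).
  have c3' : 0 <= 2 + 1 / 9 - k by rewrite subr_ge0.
  by have := mulr_ge0 (ltW h0) c3'; rewrite /m; lra.
pose b := r - 3 / 2 * m.
have b0 : b < 0 by rewrite /b; move: h0 rhi hm; clear; lra.
have bh : - (4294 / 10000 * h) < b by rewrite /b; move: h0 rlo mhi; clear; lra.
have rb0 : r * b < 0 by rewrite pmulr_rlt0.
have D0 : 0 <= b ^+ 2 - 4 * r * b.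
  by move: rb0 (sqr_ge0 b); clear; rewrite -mulrA; lra.
pose s := Num.sqrt (b ^+ 2 - 4 * r * b).
have s2 : s ^+ 2 = b ^+ 2 - 4 * r * b by rewrite sqr_sqrtr.
have s0 : 0 <= s by exact: sqrtr_ge0.
pose ri := (s - b) / 2.
have ri0 : 0 < ri by rewrite divr_gt0// subr_gt0 (lt_le_trans b0).
have q0 : ri ^+ 2 + b * ri + r * b = 0.
  have -> : ri ^+ 2 + b * ri + r * b = (s ^+ 2 - b ^+ 2) / 4 + r * b by rewrite /ri; field.
  by rewrite s2; field.
have qh : 0 < h ^+ 2 + b * h + r * b.
  by move: bh rhi h0 r0 b0; clear; nra.
(* the quadratic vanishes at [ri], is positive at [h] and increases in between *)
have rih : ri <= h.
  rewrite leNgt; apply/negP => hri.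
  have : 0 < (ri - h) * (ri + h + b).
    by rewrite mulr_gt0 ?subr_gt0//; move: h0 ri0 bh; clear; lra.
  have -> : (ri - h) * (ri + h + b) = ri ^+ 2 + b * ri + r * b - (h ^+ 2 + b * h + r * b).
    by ring.
  by rewrite q0; move: qh; clear; lra.
have bal : r ^+ 3 / 3 - m * r ^+ 2 / 2 = ri ^+ 3 / 3 - m * ri ^+ 2 / 2.
  apply/eqP; rewrite -subr_eq0; apply/eqP.
  have -> : r ^+ 3 / 3 - m * r ^+ 2 / 2 - (ri ^+ 3 / 3 - m * ri ^+ 2 / 2) =
    (r - ri) / 3 * (ri ^+ 2 + b * ri + r * b) by rewrite /b; field.
  by rewrite q0 mulr0.
have mk : 2 * m = h * hexconst by rewrite /m -/k; field.
exact: (inhabits (Calibration k0 h0 r0 r2 mk ri0 rih bal h3)).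
Qed.

(** * The weight along rays *)

Section weight.
Context {R : realType} (kappa : R) (C : calibration kappa).
Notation leb := (@lebesgue_measure R).
Notation pl := (measurableTypeR R * measurableTypeR R)%type.
Notation mu := (borel_lebesgue2 R).
Notation enorm := (@enorm R).
Let h := inrad C.
Let m := mid C.
Let r := circ C.
Let ri := inner C.
Let k0 : 0 < kappa := kappa_gt0 C.
Let h0 : 0 < h := inrad_gt0 C.
Let r0 : 0 < r := circ_gt0 C.
Let r2 : r ^+ 2 = 4 / 3 * h ^+ 2 := circ_sqr C.
Let mk : 2 * m = h * hexconst := mid_hexconst C.
Let ri0 : 0 < ri := inner_gt0 C.
Let rih : ri <= h := inner_le C.
Let bal : r ^+ 3 / 3 - m * r ^+ 2 / 2 = ri ^+ 3 / 3 - m * ri ^+ 2 / 2 := inner_balance C.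

Lemma inrad_le_mid : h <= m.
Proof. by move: (@hexconst_ge2 R) h0 mk; move: hexconst => k; nra. Qed.

Lemma inrad_lt_circ : h < r.
Proof. by move: h0 r0 r2; nra. Qed.

Lemma mid_lt_circ : m < r.
Proof.
have m_le : m <= h * (1 + 1 / 18).
  by move: (@hexconst_le R) h0 mk; move: hexconst => k; nra.
by move: m_le h0 r0 r2; nra.
Qed.

Let hm := inrad_le_mid.
Let hr := inrad_lt_circ.

(** The delivery cost minus the price [kappa * mid] of area, cut off at the
circumradius. The cut-off can only lower the value, as [mid < circ], and makes the
weight integrable over the plane. *)
Definition weight (x : R * R) : R :=
  if enorm x <= r then kappa * (enorm x - m) else 0.

Lemma measurable_cdisc (t : R) : measurable [set x : pl | enorm x <= t].
Proof. exact: measurable_le_fun measurable_enorm (measurable_cst t). Qed.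

Lemma weight_integrable : mu.-integrable setT (EFin \o (weight : pl -> R)).
Proof.
have -> : (weight : pl -> R) =
    (fun x : pl => kappa * (enorm x - m)) \_ [set x : pl | enorm x <= r].
  apply/funext => x; rewrite patchE /weight /=; case: ifPn => xr.
    by rewrite mem_set.
  by rewrite memNset//; exact/negP.
apply: (@bounded_integrable _ _ _ r (kappa * (r + m))) => //.
- exact: measurable_cdisc.
- apply: measurable_funM; first exact: measurable_cst.
  by apply: measurable_funB; [exact: measurable_enorm|exact: measurable_cst].
- move=> x /= xr; rewrite normrM gtr0_norm//; apply: ler_wpM2l; first exact: ltW.
  rewrite ler_norml.
  have := sqrtr_ge0 (x.1 ^+ 2 + x.2 ^+ 2); rewrite -/(enorm x) => e0.
  by move: e0 xr hm h0 r0; lra.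
Qed.

(** The primitive t^3/3 - mid t^2/2 takes the same value at [inner] and [circ] and is
smaller in between: the difference has the factor (circ - a) (a - inner). *)
Lemma ray_pos (a : R) : ri <= a -> a <= r ->
  a ^+ 3 / 3 - m * a ^+ 2 / 2 <= r ^+ 3 / 3 - m * r ^+ 2 / 2.
Proof.
move=> ria ar.
have q : 2 * (r ^+ 2 + r * ri + ri ^+ 2) = 3 * m * (r + ri).
  have [e|ne] := eqVneq r ri; first by move: hr rih; rewrite e; lra.
  have rn : r - ri != 0 by rewrite subr_eq0.
  apply: (mulIf rn); apply/eqP; rewrite -subr_eq0; apply/eqP.
  rewrite (_ : _ - _ = 6 * (r ^+ 3 / 3 - m * r ^+ 2 / 2 - (ri ^+ 3 / 3 - m * ri ^+ 2 / 2))); last by field.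
  by rewrite bal; ring.
have rr : 0 < r + ri by rewrite addr_gt0.
have a0 : 0 < a by exact: lt_le_trans ri0 ria.
rewrite -subr_ge0 -(pmulr_rge0 _ rr).
have -> : (r + ri) * (r ^+ 3 / 3 - m * r ^+ 2 / 2 - (a ^+ 3 / 3 - m * a ^+ 2 / 2)) =
  (r - a) * (a - ri) * ((r + ri) * a + r * ri) / 3 + (r ^+ 2 - a ^+ 2) / 6 *
   (2 * (r ^+ 2 + r * ri + ri ^+ 2) - 3 * m * (r + ri)) by field.
rewrite q subrr mulr0 addr0 divr_ge0// mulr_ge0//; last first.
  by rewrite addr_ge0// mulr_ge0// ltW.
by rewrite mulr_ge0// subr_ge0.
Qed.

Lemma restrict_integrable (g : pl -> R) (A : set pl) : measurable A ->
  mu.-integrable setT (EFin \o g) -> mu.-integrable setT (EFin \o (g \_ A)).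
Proof.
move=> mA ig; rewrite -restrict_EFin; apply/(integrable_mkcond _ mA).
exact: integrableT.
Qed.

Lemma enorm_scale (c : R) (x : R * R) : 0 <= c -> enorm (c * x.1, c * x.2) = c * enorm x.
Proof.
move=> c0; rewrite /Defs.enorm /= !exprMn -mulrDr sqrtrM ?sqr_ge0//.
by rewrite sqrtr_sqr ger0_norm.
Qed.

Definition cone (K : set pl) := forall c x, 0 < c -> K x -> K (c * x.1, c * x.2).

Lemma halfplane_measurable (t : R) : measurable [set x : pl | t <= x.1].
Proof. exact: measurable_le_fun (measurable_cst t) measurable_fst. Qed.

Lemma ring_measurable (t : R) : measurable [set x : pl | t <= enorm x].
Proof. exact: measurable_le_fun (measurable_cst t) measurable_enorm. Qed.

(** Compare along rays. On a ray inside [K] the right side omits only points closer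
than [inner], where the weight is negative. On a ray outside [K] it adds the
integral from some radius at least [inner] up to [circ], nonnegative by [ray_pos]. *)
Lemma cone_cap_le_ring (K : set pl) (t : R) : measurable K -> cone K -> 0 < t ->
  \int[mu]_(x in K `&` [set x | t <= x.1]) weight x <=
  \int[mu]_(x in [set x | t <= x.1] `&` [set x | ri <= enorm x]) weight x.
Proof.
move=> mK cK t0.
set S1 := K `&` _; set S2 := _ `&` _.
have mS1 : measurable S1 by apply: measurableI => //; exact: halfplane_measurable.
have mS2 : measurable S2.
  by apply: measurableI; [exact: halfplane_measurable|exact: ring_measurable].
have iw := weight_integrable.
rewrite -subr_ge0 Rintegral_mkcond [X in _ - X]Rintegral_mkcond.
rewrite -RintegralB//; [|exact: restrict_integrable..].
apply: integral_slope_ge0.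
- have := integrableB measurableT (restrict_integrable mS2 iw) (restrict_integrable mS1 iw).
  by apply: eq_integrable.
- move=> x x0.
  have nS (P : set pl) : (P `<=` [set x | t <= x.1]) -> (weight \_ P) x = 0.
    move=> PS; rewrite patchE memNset// => /PS /=.
    by rewrite leNgt (le_lt_trans x0).
  by rewrite !nS ?subr0// => y [].
move=> u; set w := enorm (1, u).
have w1 : 1 <= w.
  by rewrite /w /Defs.enorm /= -[leLHS]sqrtr1 ler_wsqrtr// expr1n lerDl sqr_ge0.
have w0 : 0 < w by exact: lt_le_trans w1.
have ew s : 0 < s -> enorm (s, s * u) = s * w.
  by move=> s0; rewrite /w -enorm_scale ?ltW//= mulr1.
have [Ku|Ku] := pselect (K (1, u)).
  apply: integral_ge0 => s _; rewrite lee_fin.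
  have [s0|s0] := ltP s t.
    have nS (P : set pl) : (P `<=` [set x | t <= x.1]) -> (weight \_ P) (s, s * u) = 0.
      by move=> PS; rewrite patchE memNset// => /PS /=; rewrite leNgt s0.
    by rewrite !nS ?subr0 ?mulr0// => y [].
  have sp : 0 < s by exact: lt_le_trans s0.
  apply: mulr_ge0; first exact: ltW.
  rewrite [X in _ - X]patchE mem_set; last first.
    by split=> //; have := cK s (1, u) sp Ku; rewrite /= mulr1.
  rewrite patchE; case: ifPn => [_|/negP nS]; first by rewrite subrr.
  rewrite sub0r oppr_ge0 /weight; case: ifP => // _.
  rewrite pmulr_rle0// subr_le0; apply: le_trans (le_trans rih hm).
  rewrite leNgt; apply/negP => rin; apply: nS; apply/mem_set; split => //=.
  exact: ltW.
pose a := Num.max t (ri / w); pose b := r / w.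
have -> : (\int[leb]_s (s * ((weight \_ S2) (s, s * u) - (weight \_ S1) (s, s * u)))%:E =
  \int[leb]_(s in `[a, b]) (kappa * w * s ^+ 2 + (- (kappa * m)) * s)%:E)%E.
  rewrite [RHS]integral_mkcond; apply: eq_integral => s _; rewrite [RHS]patchE.
  have -> : (weight \_ S1) (s, s * u) = 0.
    rewrite patchE memNset// => -[/= Ks ts]; apply: Ku.
    have sp : 0 < s by exact: lt_le_trans ts.
    have := cK s^-1 _ _ Ks; rewrite invr_gt0 sp /= => /(_ isT).
    by rewrite mulrA mulVf ?gt_eqF// mul1r.
  rewrite subr0 patchE; case: ifPn => [/set_mem [/= ts ris]|nS].
    have sp : 0 < s by exact: lt_le_trans ts.
    rewrite /weight !ew//; rewrite ew// in ris.
    case: ifPn => sr.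
      rewrite mem_set; first by congr EFin; ring.
      by rewrite /= in_itv /= /a /b ge_max ts ler_pdivlMr// sr ler_pdivrMr// ris.
    rewrite memNset ?mulr0// /= in_itv /= /b ler_pdivlMr// => /andP[_ sr'].
    by rewrite sr' in sr.
  rewrite mulr0 memNset// /= in_itv /= /a ge_max ler_pdivrMr// => /andP[/andP[ts ris] _].
  have sp : 0 < s by exact: lt_le_trans ts.
  by move/negP: nS; apply; apply/mem_set; split => //=; rewrite ew.
have [ab|ba] := leP a b; last first.
  by rewrite set_itv_ge ?integral_set0// -leNgt bnd_simp.
rewrite -[X in (0 <= X)%E]fineK; last first.
  apply: integrable_fin_num => //.
  apply: (@integrable_continuous_itv R (fun s => kappa * w * s ^+ 2 + - (kappa * m) * s)).
  move=> s; apply: cvgD; apply: cvgM; [exact: cvg_cst|exact: exprn_continuous|exact: cvg_cst|exact: cvg_id].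
rewrite lee_fin -[X in 0 <= X]/(Rintegral leb `[a, b] _) integral_quadratic//.
have aw : ri <= a * w by rewrite -ler_pdivrMr// /a le_max lexx orbT.
have bw : a * w <= r by rewrite -ler_pdivlMr.
have := ray_pos aw bw.
have -> : r = b * w by rewrite /b divfK ?gt_eqF.
move=> H.
have -> : kappa * w * (b ^+ 3 - a ^+ 3) / 3 + - (kappa * m) * (b ^+ 2 - a ^+ 2) / 2
 = kappa / w ^+ 2 * ((b * w) ^+ 3 / 3 - m * (b * w) ^+ 2 / 2 - ((a * w) ^+ 3 / 3 - m * (a * w) ^+ 2 / 2)).
  by field; rewrite gt_eqF.
by rewrite mulr_ge0 ?subr_ge0// divr_ge0 ?ltW// exprn_gt0.
Qed.

End weight.

(** * The weight along vertical chords *)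

Section chords.
Context {R : realType} (kappa : R) (C : calibration kappa).
Notation leb := (@lebesgue_measure R).
Notation pl := (measurableTypeR R * measurableTypeR R)%type.
Notation mu := (borel_lebesgue2 R).
Notation enorm := (@enorm R).
Notation weight := (@weight R kappa C).
Let h := inrad C.
Let m := mid C.
Let r := circ C.
Let ri := inner C.
Let k0 : 0 < kappa := kappa_gt0 C.
Let h0 : 0 < h := inrad_gt0 C.
Let r0 : 0 < r := circ_gt0 C.
Let r2 : r ^+ 2 = 4 / 3 * h ^+ 2 := circ_sqr C.
Let mk : 2 * m = h * hexconst := mid_hexconst C.
Let ri0 : 0 < ri := inner_gt0 C.
Let rih : ri <= h := inner_le C.
Let bal : r ^+ 3 / 3 - m * r ^+ 2 / 2 = ri ^+ 3 / 3 - m * ri ^+ 2 / 2 := inner_balance C.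
Let hm := inrad_le_mid C.
Let hr := inrad_lt_circ C.
Let mr := mid_lt_circ C.

Definition chord (x Y : R) : R := \int[leb]_(s in `[-1, 1]) Num.sqrt (x ^+ 2 + Y ^+ 2 * s ^+ 2).

Lemma chord_scale (x Y : R) : 0 < Y ->
  \int[leb]_(y in `[- Y, Y]) Num.sqrt (x ^+ 2 + y ^+ 2) = Y * chord x Y.
Proof.
move=> Y0; rewrite (@integral_scale_sym R (fun y => Num.sqrt (x ^+ 2 + y ^+ 2)))//.
  by congr (_ * _); apply: eq_Rintegral => s _; rewrite exprMn.
rewrite (_ : (fun _ => _) = (fun y => Num.sqrt (x ^+ 2 + 1 * y ^+ 2))).
  exact: continuous_hypot.
by apply/funext => y; rewrite mul1r.
Qed.

Lemma integrable_hypot (x Y a b : R) :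
  leb.-integrable `[a, b] (EFin \o (fun s => Num.sqrt (x ^+ 2 + Y ^+ 2 * s ^+ 2))).
Proof. by apply: integrable_continuous_itv; exact: continuous_hypot. Qed.

(** Among the chords of a fixed circle the mean distance to the centre is smallest for
the chords near the centre: with x^2 + Y^2 constant, x^2 + Y^2 s^2 increases with
x^2 because s^2 <= 1. *)
Lemma chord_mono (x Y x' Y' : R) : x ^+ 2 + Y ^+ 2 = x' ^+ 2 + Y' ^+ 2 -> x ^+ 2 <= x' ^+ 2 ->
  chord x Y <= chord x' Y'.
Proof.
move=> e xx'; apply: le_Rintegral => //; [exact: integrable_hypot..|].
move=> s /=; rewrite in_itv /= => /andP[s1 s1']; apply: ler_wsqrtr.
have -> : Y ^+ 2 = x' ^+ 2 + Y' ^+ 2 - x ^+ 2 by rewrite -e; ring.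
have s2 : 0 <= 1 - s ^+ 2 by nra.
by nra.
Qed.

(** This is what singles out [mid]: the weight integrates to 0 over the chord of the
circumcircle that is a side of the hexagon. *)
Lemma chord_inrad (Y : R) : h ^+ 2 + Y ^+ 2 = r ^+ 2 -> chord h Y = 2 * m.
Proof.
move=> e; have -> : 2 * m = h * hexconst by [].
rewrite /hexconst -RintegralZl//; last first.
  by apply: integrable_continuous_itv; exact: continuous_hexconst.
have Y2 : Y ^+ 2 = h ^+ 2 / 3 by rewrite (_ : Y ^+ 2 = r ^+ 2 - h ^+ 2); [rewrite r2; field|rewrite -e; ring].
apply: eq_Rintegral => s _; transitivity (Num.sqrt (h ^+ 2 * (1 + s ^+ 2 / 3))).
  by congr Num.sqrt; rewrite Y2; field.
by rewrite sqrtrM ?sqr_ge0// sqrtr_sqr gtr0_norm.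
Qed.

Lemma slice_chord (x Y : R) : 0 < Y -> x ^+ 2 + Y ^+ 2 = r ^+ 2 ->
  (\int[leb]_y (weight (x, y))%:E = (kappa * Y * (chord x Y - 2 * m))%:E)%E.
Proof.
move=> Y0 e.
have -> : (\int[leb]_y (weight (x, y))%:E =
  \int[leb]_(y in `[(- Y)%R, Y]) (kappa * (Num.sqrt (x ^+ 2 + y ^+ 2) - m))%:E)%E.
  rewrite [RHS]integral_mkcond; apply: eq_integral => y _; rewrite patchE /weight /Defs.enorm /=.
  have -> : (Num.sqrt (x ^+ 2 + y ^+ 2) <= circ C) = (y \in `[- Y, Y]).
    rewrite -/r -(@ler_sqr R) ?nnegrE ?sqrtr_ge0 ?(ltW r0)// sqr_sqrtr; last by rewrite addr_ge0 ?sqr_ge0.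
    by rewrite -e lerD2l in_itv /= -ler_norml -[RHS](@ler_sqr R) ?nnegrE ?(ltW Y0)// real_normK ?num_real.
  case: ifPn => yY; first by rewrite mem_set.
  by rewrite memNset//; exact/negP.
have ih : leb.-integrable `[- Y, Y] (EFin \o (fun y => Num.sqrt (x ^+ 2 + y ^+ 2))).
  have := integrable_hypot x 1 (- Y) Y; apply: eq_integrable => // y _ /=.
  by rewrite expr1n mul1r.
have ic (c : R) : leb.-integrable `[- Y, Y] (EFin \o (fun=> c)).
  by apply: integrable_continuous_itv; exact: cst_continuous.
have ihm : leb.-integrable `[- Y, Y] (EFin \o (fun y => Num.sqrt (x ^+ 2 + y ^+ 2) - m)).
  have := integrableB _ ih (ic m); move/(_ (measurable_itv _)).
  by apply: eq_integrable.
rewrite -[LHS]fineK; last first.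
  apply: integrable_fin_num => //.
  have := integrableZl _ kappa ihm; move/(_ (measurable_itv _)).
  by apply: eq_integrable.
congr EFin; rewrite -[LHS]/(Rintegral leb `[- Y, Y] (fun y => kappa * (Num.sqrt (x ^+ 2 + y ^+ 2) - m))).
rewrite RintegralZl// RintegralB// chord_scale// Rintegral_cst//= lebesgue_measure_itv/= lte_fin gtrN//.
by rewrite -EFinD /=; ring.
Qed.

Lemma Fubini_le0 (g : pl -> R) : mu.-integrable setT (EFin \o g) ->
  (forall x, \int[leb]_y (g (x, y))%:E <= 0)%E -> \int[mu]_x g x <= 0.
Proof.
move=> ig g0; apply: fine_le0; rewrite -(integral12_prod_meas1 ig).
rewrite -[leRHS](integral0 leb [set: measurableTypeR R]).
apply: le_integral => //; first exact: integrable_fubini_F.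
  exact: integrable0.
by move=> x _; exact: g0.
Qed.

Lemma is_derive_hypot (x y : R) : x != 0 ->
  is_derive y (1 : R) (fun y => Num.sqrt (x ^+ 2 + y ^+ 2)) (y / Num.sqrt (x ^+ 2 + y ^+ 2)).
Proof.
move=> x0; have q0 : 0 < x ^+ 2 + y ^+ 2.
  by rewrite ltr_pwDl ?sqr_ge0// lt_neqAle sqr_ge0 eq_sym sqrf_eq0 x0.
have dq : is_derive y (1 : R) (fun y : R => x ^+ 2 + y ^+ 2) (2 * y).
  pose p : {poly R} := (x ^+ 2)%:P + 'X^2.
  rewrite (_ : (fun y : R => _) = horner p); last by apply/funext => z; rewrite /p !hornerE.
  apply: is_derive_eq; rewrite /p derivD derivC derivXn !hornerE /=; ring.
have H := @is_derive1_comp R (@Num.sqrt R) (fun y : R => x ^+ 2 + y ^+ 2) y _ _ (is_derive1_sqrt q0) dq.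
apply: (is_derive_eq H); have := sqrtr_gt0 (x ^+ 2 + y ^+ 2); rewrite q0 => s0.
by field; rewrite gt_eqF.
Qed.

(** The integrand is the derivative of kappa (t^3/3 - mid t^2/2) at
t = sqrt (x^2 + y^2). *)
Lemma integral_radial (x a b : R) : x != 0 -> a <= b ->
  \int[leb]_(y in `[a, b]) (y * (kappa * (Num.sqrt (x ^+ 2 + y ^+ 2) - m))) =
  kappa * ((Num.sqrt (x ^+ 2 + b ^+ 2)) ^+ 3 / 3 - m * (Num.sqrt (x ^+ 2 + b ^+ 2)) ^+ 2 / 2)
  - kappa * ((Num.sqrt (x ^+ 2 + a ^+ 2)) ^+ 3 / 3 - m * (Num.sqrt (x ^+ 2 + a ^+ 2)) ^+ 2 / 2).
Proof.
move=> x0 ab.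
pose p : {poly R} := kappa *: (3^-1 *: 'X^3 - (m / 2) *: 'X^2).
have pE t : p.[t] = kappa * (t ^+ 3 / 3 - m * t ^+ 2 / 2).
  by rewrite /p !hornerE /=; field.
rewrite -!pE; apply: (@integral_derivative R (fun y => p.[Num.sqrt (x ^+ 2 + y ^+ 2)])) => //.
- move=> y; have H := @is_derive1_comp R (horner p) (fun y => Num.sqrt (x ^+ 2 + y ^+ 2)) y _ _
    (is_derive_poly p (Num.sqrt (x ^+ 2 + y ^+ 2))) (is_derive_hypot y x0).
  apply: (is_derive_eq H); rewrite /p derivZ derivB !derivZ !derivXn !hornerE /=.
  have q0 : 0 < x ^+ 2 + y ^+ 2.
    by rewrite ltr_pwDl ?sqr_ge0// lt_neqAle sqr_ge0 eq_sym sqrf_eq0 x0.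
  have := sqrtr_gt0 (x ^+ 2 + y ^+ 2); rewrite q0 => s0.
  by field; rewrite gt_eqF.
- move=> y; apply: cvgM; first exact: cvg_id.
  apply: cvgM; first exact: cvg_cst.
  apply: cvgB; last exact: cvg_cst.
  have := @continuous_hypot R (x ^+ 2) 1 y.
  by under eq_fun do rewrite mul1r.
Qed.

Let W (x y : R) := kappa * (Num.sqrt (x ^+ 2 + y ^+ 2) - m).

Let continuous_W x : continuous (W x).
Proof.
move=> y; apply: cvgM; first exact: cvg_cst.
apply: cvgB; last exact: cvg_cst.
have := @continuous_hypot R (x ^+ 2) 1 y.
by under eq_fun do rewrite mul1r.
Qed.

Let hypot_le (x y t T : R) : 0 <= T -> x ^+ 2 + t ^+ 2 = T ^+ 2 -> 0 <= t ->
  (Num.sqrt (x ^+ 2 + y ^+ 2) <= T) = (`|y| <= t).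
Proof.
move=> T0 e t0; rewrite -[LHS](@ler_sqr R) ?nnegrE ?sqrtr_ge0//.
rewrite sqr_sqrtr; last by rewrite addr_ge0 ?sqr_ge0.
by rewrite -e lerD2l -[RHS](@ler_sqr R) ?nnegrE// real_normK ?num_real.
Qed.

Let hypot_ge (x y t T : R) : 0 <= T -> x ^+ 2 + t ^+ 2 = T ^+ 2 -> 0 <= t ->
  (T <= Num.sqrt (x ^+ 2 + y ^+ 2)) = (t <= `|y|).
Proof.
move=> T0 e t0; rewrite -[LHS](@ler_sqr R) ?nnegrE ?sqrtr_ge0//.
rewrite sqr_sqrtr; last by rewrite addr_ge0 ?sqr_ge0.
by rewrite -e lerD2l -[RHS](@ler_sqr R) ?nnegrE// real_normK ?num_real.
Qed.

(** [W x] changes sign at |y| = [ym], so exchanging the factors [ym] and |y| raises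
the product on both sides of this point. *)
Let W_mid x y ym : x ^+ 2 + ym ^+ 2 = m ^+ 2 -> 0 <= ym -> ym * W x y <= `|y| * W x y.
Proof.
move=> e ym0; have m0 : 0 <= m by rewrite (le_trans _ hm)// ltW.
rewrite -subr_ge0 -mulrBl /W mulrCA; apply: mulr_ge0; first exact: ltW.
have [yym|yym] := leP ym `|y|.
  by rewrite mulr_ge0 ?subr_ge0// (hypot_ge _ m0 e ym0).
by rewrite mulr_le0 ?subr_le0 ?(ltW yym)// (hypot_le _ m0 e ym0) ltW.
Qed.

(** The part of such a chord in the ring consists of two segments. On each of them
[W_mid] replaces the constant factor [ym] by |y|; the integral then has the primitive
of [integral_radial] and vanishes by [inner_balance]. *)
Lemma slice_ring_small (x : R) : 0 < x -> x < ri ->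
  (\int[leb]_y ((weight \_ [set z | ri <= enorm z]) (x, y))%:E <= 0)%E.
Proof.
move=> x0 xri.
have m0 : 0 < m by exact: lt_le_trans hm.
have xm : x < m by exact: lt_le_trans xri (le_trans rih hm).
have xr : x < r by exact: lt_trans mr.
have ex T : x < T -> exists t, [/\ 0 < t & x ^+ 2 + t ^+ 2 = T ^+ 2].
  move=> xT; exists (Num.sqrt (T ^+ 2 - x ^+ 2)).
  have xT2 : x ^+ 2 < T ^+ 2 by rewrite ltr_pXn2r// nnegrE ltW// (lt_trans x0).
  by split; [rewrite sqrtr_gt0 subr_gt0|rewrite sqr_sqrtr ?subr_ge0 ?ltW//; ring].
have [y1 [y10 e1]] := ex _ xri; have [ym [ym0 em]] := ex _ xm; have [Y [Y0 eY]] := ex _ xr.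
have y1Y : y1 <= Y.
  rewrite -(@ler_sqr R) ?nnegrE ?(ltW y10) ?(ltW Y0)// -(lerD2l (x ^+ 2)) e1 eY.
  rewrite ler_sqr ?nnegrE ?(ltW ri0) ?(ltW r0)//.
  exact: le_trans (le_trans rih hm) (ltW mr).
have iW a b : leb.-integrable `[a, b] (EFin \o W x).
  by apply: integrable_continuous_itv; exact: continuous_W.
pose A := `[y1, Y]%classic `|` `[- Y, - y1]%classic : set R.
have mA : measurable (A : set (measurableTypeR R)) by apply: measurableU.
have -> : (\int[leb]_y ((weight \_ [set z | ri <= enorm z]) (x, y))%:E =
   \int[leb]_(y in A) (W x y)%:E)%E.
  rewrite [RHS]integral_mkcond; apply: eq_integral => y _; rewrite !patchE /weight /Defs.enorm /=.
  rewrite (hypot_le y (ltW r0) eY (ltW Y0)).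
  have -> : ((x, y) \in [set z | ri <= Num.sqrt (z.1 ^+ 2 + z.2 ^+ 2)]) = (y1 <= `|y|).
    by rewrite -(hypot_ge y (ltW ri0) e1 (ltW y10)); apply/idP/idP => [/set_mem//|H]; exact/mem_set.
  have -> : (y \in A) = (y1 <= `|y|) && (`|y| <= Y).
    apply/idP/idP => [/set_mem [] /=|].
    - rewrite in_itv /= => /andP[ya yb]; rewrite ger0_norm ?ya//.
      exact: le_trans (ltW y10) ya.
    - rewrite in_itv /= => /andP[ya yb].
      rewrite ler0_norm; first by rewrite lerNr yb lerNl ya.
      by rewrite (le_trans yb)// oppr_le0 ltW.
    - move=> /andP[ya yb]; apply/mem_set; have [y0|y0] := leP 0 y.
        by left; rewrite /= in_itv /=; rewrite ger0_norm// in ya yb; rewrite ya yb.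
      right; rewrite /= in_itv /=; rewrite ltr0_norm// in ya yb.
      by rewrite lerNl yb lerNr ya.
  by case: (y1 <= `|y|) => //=; case: (`|y| <= Y).
have iA : leb.-integrable A (EFin \o W x).
  apply: (integrableS _ mA _ (iW (- Y) Y)) => //.
  move=> y [] /=; rewrite !in_itv /= => /andP[ya yb].
    by rewrite yb andbT; move: ya y10 Y0; lra.
  by rewrite ya; move: yb y10 Y0; lra.
rewrite -[X in (X <= 0)%E]fineK; last exact: integrable_fin_num.
rewrite lee_fin -[X in X <= 0]/(Rintegral leb A (W x)) Rintegral_setU//; last first.
  apply/disj_setPS => y [/=]; rewrite !in_itv /= => /andP[ya _] /andP[_ yb].
  by have := le_trans ya yb; rewrite leNgt (lt_trans _ y10)// oppr_lt0.
have eQ (T t : R) : 0 <= T -> x ^+ 2 + t ^+ 2 = T ^+ 2 -> Num.sqrt (x ^+ 2 + t ^+ 2) = T.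
  by move=> T0 ->; rewrite sqrtr_sqr ger0_norm.
have xn : x != 0 by rewrite gt_eqF.
have iyW a b : leb.-integrable `[a, b] (EFin \o (fun y => y * W x y)).
  apply: integrable_continuous_itv => y; apply: cvgM; first exact: cvg_id.
  exact: continuous_W.
have imW a b : leb.-integrable `[a, b] (EFin \o (fun y => ym * W x y)).
  apply: integrable_continuous_itv => y; apply: cvgM; first exact: cvg_cst.
  exact: continuous_W.
have iNW a b : leb.-integrable `[a, b] (EFin \o (fun y => (- 1) * (y * W x y))).
  apply: integrable_continuous_itv => y; apply: cvgM; first exact: cvg_cst.
  by apply: cvgM; [exact: cvg_id|exact: continuous_W].
have half_le0 a b : \int[leb]_(y in `[a, b]) (ym * W x y) <= 0 -> \int[leb]_(y in `[a, b]) W x y <= 0.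
  by rewrite RintegralZl// pmulr_rle0.
rewrite -[leRHS]addr0; apply: lerD; apply: half_le0.
- apply: (@le_trans _ _ (\int[leb]_(y in `[y1, Y]) (y * W x y))).
    apply: le_Rintegral => // y /=; rewrite in_itv /= => /andP[ya _].
    rewrite -[X in _ <= X * _]ger0_norm; first exact: W_mid em (ltW ym0).
    exact: le_trans (ltW y10) ya.
  rewrite integral_radial// (eQ _ _ (ltW r0) eY) (eQ _ _ (ltW ri0) e1) bal.
  by rewrite subrr.
- apply: (@le_trans _ _ (\int[leb]_(y in `[- Y, - y1]) ((- 1) * (y * W x y)))).
    apply: le_Rintegral => // y /=; rewrite in_itv /= => /andP[_ yb].
    rewrite mulN1r -mulNr -[X in _ <= X * _]ler0_norm; first exact: W_mid em (ltW ym0).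
    by rewrite (le_trans yb)// oppr_le0 ltW.
  rewrite RintegralZl// integral_radial ?lerN2// !sqrrN.
  rewrite (eQ _ _ (ltW r0) eY) (eQ _ _ (ltW ri0) e1) bal.
  by rewrite subrr mulr0.
Qed.

(** From [inner] to [inrad] the whole chord lies in the ring, and its mean distance is
at most that of the chord at [inrad], where the integral vanishes. *)
Lemma slice_ring (x : R) : 0 < x -> x <= h ->
  (\int[leb]_y ((weight \_ [set z | ri <= enorm z]) (x, y))%:E <= 0)%E.
Proof.
move=> x0 xh; have [xri|rix] := ltP x ri; first exact: slice_ring_small.
have xr2 : 0 < r ^+ 2 - x ^+ 2.
  by rewrite subr_gt0 ltr_pXn2r// ?nnegrE ?ltW// (le_lt_trans xh).
pose Y := Num.sqrt (r ^+ 2 - x ^+ 2).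
have Y0 : 0 < Y by rewrite sqrtr_gt0.
have eY : x ^+ 2 + Y ^+ 2 = r ^+ 2 by rewrite sqr_sqrtr ?ltW//; ring.
rewrite (_ : (\int[leb]_y _)%E = (\int[leb]_y (weight (x, y))%:E)%E); last first.
  apply: eq_integral => y _; rewrite patchE mem_set//=.
  apply: le_trans rix _; rewrite -[leLHS](gtr0_norm x0); exact: (normr_fst_enorm (x, y)).
rewrite (slice_chord Y0 eY) lee_fin; apply: mulr_ge0_le0; first by rewrite mulr_ge0// ltW.
have hr2 : 0 < r ^+ 2 - h ^+ 2 by rewrite r2; move: h0; nra.
pose Z := Num.sqrt (r ^+ 2 - h ^+ 2).
have eZ : h ^+ 2 + Z ^+ 2 = r ^+ 2 by rewrite sqr_sqrtr ?ltW//; ring.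
rewrite subr_le0 -(chord_inrad eZ); apply: chord_mono; first by rewrite eY eZ.
by rewrite ler_sqr ?nnegrE ?(ltW x0) ?(ltW h0).
Qed.

(** Beyond the inradius the comparison of chords goes the other way. *)
Lemma slice_cap (x : R) : h <= x -> (0 <= \int[leb]_y (weight (x, y))%:E)%E.
Proof.
move=> hx; have x0 : 0 < x by exact: lt_le_trans hx.
have [xr|rx] := ltP x r; last first.
  apply: integral_ge0 => y _; rewrite lee_fin /weight; case: ifP => // xr.
  rewrite mulr_ge0 ?subr_ge0//; first exact: ltW.
  apply: le_trans (ltW mr) (le_trans rx _).
  rewrite -[leLHS](gtr0_norm x0); exact: (normr_fst_enorm (x, y)).
have xr2 : 0 < r ^+ 2 - x ^+ 2 by rewrite subr_gt0 ltr_pXn2r// ?nnegrE ?ltW.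
pose Y := Num.sqrt (r ^+ 2 - x ^+ 2).
have Y0 : 0 < Y by rewrite sqrtr_gt0.
have eY : x ^+ 2 + Y ^+ 2 = r ^+ 2 by rewrite sqr_sqrtr ?ltW//; ring.
rewrite (slice_chord Y0 eY) lee_fin; apply: mulr_ge0; first by rewrite mulr_ge0// ltW.
have hr2 : 0 < r ^+ 2 - h ^+ 2 by rewrite r2; move: h0; nra.
pose Z := Num.sqrt (r ^+ 2 - h ^+ 2).
have eZ : h ^+ 2 + Z ^+ 2 = r ^+ 2 by rewrite sqr_sqrtr ?ltW//; ring.
rewrite subr_ge0 -(chord_inrad eZ); apply: chord_mono; first by rewrite eY eZ.
by rewrite ler_sqr ?nnegrE ?(ltW x0) ?(ltW h0).
Qed.

Definition capmass : R := \int[mu]_(x in [set x : pl | h <= x.1]) weight x.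

(** Moving the line x.1 = t to x.1 = inrad removes slices of nonpositive weight if
[t <= inrad], and adds slices of nonnegative weight otherwise. *)
Lemma ring_le_cap (t : R) : 0 < t ->
  \int[mu]_(x in [set x : pl | t <= x.1] `&` [set x | ri <= enorm x]) weight x <= capmass.
Proof.
move=> t0; have iw := weight_integrable C.
have mH a := @halfplane_measurable R a; have mI := ring_measurable ri.
have H_ring a : ri <= a -> [set x : pl | a <= x.1] `<=` [set x | ri <= enorm x].
  move=> ra x /= ax; apply: le_trans ra (le_trans ax _).
  exact: le_trans (ler_norm _) (normr_fst_enorm x).
have [th|ht] := leP t h.
  rewrite (integral_splitI iw (measurableI _ _ (mH t) mI) (mH h)).
  rewrite (_ : _ `&` _ `&` _ = [set x : pl | h <= x.1]); last first.
    apply/seteqP; split => [x []//|x /= hx]; split => //; split => /=.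
      exact: le_trans th hx.
    exact: H_ring rih _ hx.
  rewrite -/capmass gerDl Rintegral_mkcond; apply: Fubini_le0.
    apply: restrict_integrable => //; apply: measurableD => //; exact: measurableI.
  move=> x; have [xin|xout] := pselect (t <= x < h).
    have /andP[tx xh] := xin.
    have := slice_ring (lt_le_trans t0 tx) (ltW xh); apply: le_trans.
    rewrite le_eqVlt; apply/orP; left; apply/eqP; apply: eq_integral => y _.
    rewrite !patchE; congr (EFin (if _ then _ else _)).
    apply/idP/idP => /set_mem /=; first by move=> [[_ ?] _]; exact/mem_set.
    by move=> H; apply/mem_set; split => //=; apply/negP; rewrite -ltNge.
  rewrite integral0_eq// => y _; rewrite patchE memNset// => -[[/= tx _]] /negP.
  by rewrite -ltNge => xh; apply: xout; rewrite tx.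
rewrite setIidl; last by apply: H_ring; exact: le_trans rih (ltW ht).
rewrite /capmass (integral_splitI iw (mH h) (mH t)).
rewrite (_ : _ `&` _ = [set x : pl | t <= x.1]); last first.
  apply/seteqP; split => [x []//|x /= tx]; split => //=.
  exact: le_trans (ltW ht) tx.
rewrite lerDl Rintegral_mkcond; apply: Fubini_ge0.
  by apply: restrict_integrable => //; apply: measurableD.
move=> x; have [xin|xout] := pselect (h <= x < t).
  have /andP[hx xt] := xin.
  rewrite (_ : (\int[leb]_y _)%E = (\int[leb]_y (weight (x, y))%:E)%E); first exact: slice_cap.
  apply: eq_integral => y _; rewrite patchE mem_set//=; split => //=.
  by apply/negP; rewrite -ltNge.
rewrite integral0_eq// => y _; rewrite patchE memNset// => -[/= hx] /negP.
by rewrite -ltNge => xt; apply: xout; rewrite hx.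
Qed.

(** The extremal property of a side of the hexagon: whatever the directions kept and
the distance of the line, the part beyond a line weighs at most as much as the full
half-plane at distance [inrad]. *)
Lemma cone_cap_le (K : set pl) (t : R) : measurable K -> cone K -> 0 < t ->
  \int[mu]_(x in K `&` [set x | t <= x.1]) weight x <= capmass.
Proof.
move=> mK cK t0; exact: le_trans (cone_cap_le_ring C mK cK t0) (ring_le_cap t0).
Qed.

End chords.

(** * Rotations and sextants *)

Section rotations.
Context {R : realType} (kappa : R) (C : calibration kappa).
Notation pl := (measurableTypeR R * measurableTypeR R)%type.
Notation mu := (borel_lebesgue2 R).
Notation enorm := (@enorm R).
Notation weight := (@weight R kappa C).

Lemma enorm_rot (c s : R) (x : pl) : c ^+ 2 + s ^+ 2 = 1 -> enorm (rot c s x) = enorm x.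
Proof.
move=> cs; rewrite /Defs.enorm /rot /=; congr Num.sqrt.
transitivity ((c ^+ 2 + s ^+ 2) * (x.1 ^+ 2 + x.2 ^+ 2)); first by ring.
by rewrite cs mul1r.
Qed.

Lemma rotK (c s : R) : c ^+ 2 + s ^+ 2 = 1 -> cancel (rot c s) (rot c (- s)).
Proof.
move=> cs [x y]; rewrite /rot /=; congr pair.
  transitivity ((c ^+ 2 + s ^+ 2) * x); first by ring.
  by rewrite cs mul1r.
transitivity ((c ^+ 2 + s ^+ 2) * y); first by ring.
by rewrite cs mul1r.
Qed.

(** Here the half-plane is bounded by the bisector of the origin and [d]; a rotation
takes [d] to the first axis. *)
Lemma cone_halfplane_le (K : set pl) (d : pl) : measurable K -> cone K -> 0 < enorm d ->
  \int[mu]_(x in K `&` [set v | enorm d ^+ 2 <= 2 * (v.1 * d.1 + v.2 * d.2)]) weight x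
  <= capmass C.
Proof.
move=> mK cK d0; pose c := d.1 / enorm d; pose s := d.2 / enorm d.
have d2 : enorm d ^+ 2 = d.1 ^+ 2 + d.2 ^+ 2 by rewrite sqr_sqrtr ?addr_ge0 ?sqr_ge0.
have dn : enorm d != 0 by rewrite gt_eqF.
have cs : c ^+ 2 + s ^+ 2 = 1.
  by rewrite /c /s !expr_div_n -mulrDl -d2 divff ?sqrf_eq0.
have csN : c ^+ 2 + (- s) ^+ 2 = 1 by rewrite sqrrN.
have pT := preserves_area_rot csN; have pS := preserves_area_rot cs.
have mK' : measurable (rot c s @^-1` K) by apply: measurable_preimageT => //; case: pS.
have cK' : cone (rot c s @^-1` K).
  move=> a x a0 /= /(cK a _ a0) /=; congr K; rewrite /rot /=; congr pair; ring.
have -> : K `&` [set v | enorm d ^+ 2 <= 2 * (v.1 * d.1 + v.2 * d.2)] =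
    rot c (- s) @^-1` ((rot c s @^-1` K) `&` [set x | enorm d / 2 <= x.1]).
  rewrite preimage_setI -comp_preimage (_ : rot c s \o rot c (- s) = id); last first.
    by apply/funext => x /=; have := rotK csN x; rewrite opprK.
  congr (_ `&` _); apply/seteqP; split => v; rewrite /rot /c /s /= -[2 * _]mulrC.
    by rewrite ler_pdivrMr// => H; rewrite -(ler_pM2l d0) -expr2; apply: le_trans H _;
       rewrite le_eqVlt; apply/orP; left; apply/eqP; field.
  rewrite ler_pdivrMr// -(ler_pM2l d0) -expr2 => H; apply: le_trans H _.
  by rewrite le_eqVlt; apply/orP; left; apply/eqP; field.
rewrite (_ : \int[mu]_(x in _) weight x = \int[mu]_(x in rot c (- s) @^-1` ((rot c s @^-1` K) `&` [set x | enorm d / 2 <= x.1]))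
   weight (rot c (- s) x)); last first.
  by apply: eq_Rintegral => x _; rewrite /weight enorm_rot.
rewrite preserves_Rintegral//.
- by apply: cone_cap_le => //; rewrite divr_gt0.
- exact: weight_integrable.
- by apply: measurableI => //; exact: halfplane_measurable.
Qed.

Lemma capmass_ge0 : 0 <= capmass C.
Proof.
have := @cone_cap_le R kappa C set0 1 measurable0.
by rewrite set0I Rintegral_set0; apply.
Qed.

Definition sixth : pl -> pl := rot (1 / 2) (Num.sqrt 3 / 2).
(** Half-open, so that its six rotated copies are disjoint and cover all but the
origin. *)
Definition sextant : set pl := [set x | - x.1 <= Num.sqrt 3 * x.2 < x.1].

Lemma sixth_unit : (1 / 2) ^+ 2 + (Num.sqrt 3 / 2) ^+ 2 = 1 :> R.
Proof. by rewrite !expr_div_n sqr_sqrtr//; field. Qed.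

Lemma measurable_halfplane (a b c : R) : measurable [set x : pl | a * x.1 + b * x.2 <= c].
Proof.
have := measurable_le_fun (measurable_lin a b 0) (measurable_cst c).
by congr measurable; apply/seteqP; split => x /=; rewrite addr0.
Qed.

Lemma measurable_line (a b c : R) : measurable [set x : pl | a * x.1 + b * x.2 = c].
Proof.
rewrite (_ : [set x : pl | _] = [set x : pl | a * x.1 + b * x.2 <= c] `&` [set x : pl | (- a) * x.1 + (- b) * x.2 <= - c]).
  by apply: measurableI; exact: measurable_halfplane.
by apply/seteqP; split => x /=; [move=> <-; split; lra|move=> [? ?]; lra].
Qed.

Lemma measurable_sextant : measurable sextant.
Proof.
have -> : sextant = [set x : pl | (- 1) * x.1 + (- Num.sqrt 3) * x.2 <= 0] `&`
   ~` [set x : pl | 1 * x.1 + (- Num.sqrt 3) * x.2 <= 0].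
  apply/seteqP; split => x; rewrite /sextant /=.
    move=> /andP[xa xb]; split; first lra.
    by apply/negP; rewrite -ltNge; lra.
  by move=> [xa /negP]; rewrite -ltNge => xb; apply/andP; split; lra.
apply: measurableI; first exact: measurable_halfplane.
by apply: measurableC; exact: measurable_halfplane.
Qed.

(** The six sectors in the coordinates a = x.1, b = sqrt 3 x.2, in which the rotation
by pi/3 has rational coefficients. *)
Lemma sextants_partition (a b v : R) : (a = 0 -> b = 0 -> v = 0) ->
  (if (- a <= b) && (b < a) then v else 0) + ((if (0 <= a) && (b < - a) then v else 0) +
  ((if (a < 0) && (b <= a) then v else 0) + ((if (a < b) && (b <= - a) then v else 0) +
  ((if (a <= 0) && (- a < b) then v else 0) + (if (0 < a) && (a <= b) then v else 0))))) = v.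
Proof.
move=> v0.
have [a0|a0|a0] := ltgtP a 0; have [ba|ba|ba] := ltgtP b a; have [bNa|bNa|bNa] := ltgtP b (- a);
  rewrite ?(add0r, addr0)//; lra.
Qed.

Lemma sum_sextants (g : pl -> R) (x : pl) : (forall x, g (sixth x) = g x) -> g (0, 0) = 0 ->
  g x = \sum_(k < 6) (g \_ sextant) (iter k sixth x).
Proof.
move=> gs g0.
have gk k y : g (iter k sixth y) = g y by elim: k => //= k IH; rewrite gs.
set w : R := Num.sqrt 3.
have w2 : w * w = 3 by rewrite -expr2 sqr_sqrtr.
pose a := x.1; pose b := w * x.2.
pose q (z : R * R) := (- z.1 <= z.2 < z.1).
pose ab (y : pl) := (y.1, w * y.2).
(* the rotation by pi/3 in the coordinates (x.1, sqrt 3 x.2) *)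
pose nx (z : R * R) := ((z.1 - z.2) / 2, (3 * z.1 + z.2) / 2).
have abn y : ab (sixth y) = nx (ab y).
  rewrite /ab /sixth /nx /rot -/w /=; congr pair; first by field.
  by rewrite mulrDr !mulrA w2; field.
have abk k : ab (iter k sixth x) = iter k nx (a, b).
  by elim: k => //= k IH; rewrite abn IH.
have pk k : (g \_ sextant) (iter k sixth x) = if q (iter k nx (a, b)) then g x else 0.
  rewrite patchE gk -abk; congr (if _ then _ else _).
  by rewrite /q; apply/idP/idP => [/set_mem//|H]; exact/mem_set.
pose F k := if q (iter k nx (a, b)) then g x else 0.
transitivity (\sum_(k < 6) F k); last by apply: eq_bigr => k _; rewrite pk.
have -> : \sum_(k < 6) F k = F 0 + (F 1 + (F 2 + (F 3 + (F 4 + F 5)))).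
  by rewrite !big_ord_recl big_ord0 addr0.
have nxE (u v : R) : nx (u, v) = ((u - v) / 2, (3 * u + v) / 2) by [].
have n2 u v : iter 2 nx (u, v) = (- (u + v) / 2, (3 * u - v) / 2).
  by rewrite -[iter 2 nx _]/(nx (nx (u, v))) !nxE; congr pair; field.
have n3 u v : iter 3 nx (u, v) = (- u, - v) by rewrite iterS n2 nxE; congr pair; field.
have n4 u v : iter 4 nx (u, v) = ((v - u) / 2, - (3 * u + v) / 2).
  by rewrite iterS n3 nxE; congr pair; field.
have n5 u v : iter 5 nx (u, v) = ((u + v) / 2, (v - 3 * u) / 2).
  by rewrite iterS n4 nxE; congr pair; field.
have q1 : q (iter 1 nx (a, b)) = (0 <= a) && (b < - a).
  by rewrite /q /nx /=; apply/andP/andP => -[]; split; lra.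
have q2 : q (iter 2 nx (a, b)) = (a < 0) && (b <= a).
  by rewrite n2 /q /=; apply/andP/andP => -[]; split; lra.
have q3 : q (iter 3 nx (a, b)) = (a < b) && (b <= - a).
  by rewrite n3 /q /=; apply/andP/andP => -[]; split; lra.
have q4 : q (iter 4 nx (a, b)) = (a <= 0) && (- a < b).
  by rewrite n4 /q /=; apply/andP/andP => -[]; split; lra.
have q5 : q (iter 5 nx (a, b)) = (0 < a) && (a <= b).
  by rewrite n5 /q /=; apply/andP/andP => -[]; split; lra.
have q0 : q (iter 0 nx (a, b)) = (- a <= b) && (b < a) by [].
rewrite /F q0 q1 q2 q3 q4 q5 sextants_partition// => a0 b0.
have wn : w != 0 by rewrite sqrtr_eq0 -ltNge.
have -> : x = (0, 0).
  rewrite (surjective_pairing x) -[x.1]/a a0; congr pair.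
  by apply: (mulfI wn); rewrite mulr0 -[LHS]/b b0.
exact: g0.
Qed.

Lemma integral_orbit (u : pl -> R) (n : nat) (T : pl -> pl) : preserves_area T ->
  mu.-integrable setT (EFin \o u) ->
  mu.-integrable setT (EFin \o (fun x => \sum_(k < n) u (iter k T x))) /\
  \int[mu]_x (\sum_(k < n) u (iter k T x)) = n%:R * \int[mu]_x u x.
Proof.
move=> pT iu.
have pk k : preserves_area (iter k T).
  by elim: k => [|k IH]; [exact: preserves_area_id|exact: preserves_area_comp].
have iuk k : mu.-integrable setT (EFin \o (fun x => u (iter k T x))).
  exact: preserves_integrable.
have euk k : \int[mu]_x u (iter k T x) = \int[mu]_x u x.
  exact: (preserves_Rintegral (pk k) iu measurableT).
elim: n => [|n [in_ en]].
  split; first by under eq_fun do rewrite big_ord0; exact: integrable0.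
  by under eq_Rintegral do rewrite big_ord0; rewrite Rintegral_cst// !mul0r.
have E : (fun x => \sum_(k < n.+1) u (iter k T x)) =
  (fun x => \sum_(k < n) u (iter k T x) + u (iter n T x)).
  by apply/funext => x; rewrite big_ord_recr.
rewrite E; split.
  have := integrableD measurableT in_ (iuk n).
  by apply: eq_integrable.
by rewrite RintegralD// en euk -natr1 mulrDl mul1r.
Qed.

Lemma preserves_area_sixth : preserves_area sixth.
Proof. exact: preserves_area_rot sixth_unit. Qed.

Lemma integral_sextants (g : pl -> R) : (forall x, g (sixth x) = g x) ->
  mu.-integrable setT (EFin \o g) ->
  \int[mu]_x g x = 6 * \int[mu]_(x in sextant) g x.
Proof.
move=> gs ig.
have m0 : measurable [set (0, 0) : pl].
  rewrite -[X in measurable X]/([set (0, 0)]) (_ : [set (0, 0)] = [set (0 : R)] `*` [set (0 : R)]).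
    by apply: measurableX; exact: measurable_set1.
  by apply/seteqP; split => -[a b] /= [-> ->].
have mN : measurable (~` [set (0, 0) : pl]) by exact: measurableC.
have z0 : mu [set (0, 0)] = 0%E.
  apply/eqP; rewrite eq_le measure_ge0 andbT -(@line_null R 1 0 0) ?oner_eq0//.
  apply: le_measure; rewrite ?inE//.
    rewrite (_ : [set x : pl | _] = [set x : pl | 1 * x.1 + 0 * x.2 <= 0] `&` [set x : pl | (-1) * x.1 + 0 * x.2 <= 0]).
      by apply: measurableI; exact: measurable_halfplane.
    by apply/seteqP; split => x /=; [move=> xe; split; lra|move=> [? ?]; lra].
  by move=> x /= ->; rewrite mulr0 mul0r addr0.
(* the origin lies in no sextant, so the function is first set to 0 there *)
pose g' := g \_ ~` [set (0, 0)].
have g's x : g' (sixth x) = g' x.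
  rewrite /g' !patchE gs; congr (if _ then _ else _).
  suff e : (sixth x == (0, 0)) = (x == (0, 0)).
    have memC (y : pl) : (y \in ~` [set (0, 0)]) = (y != (0, 0)).
      by apply/idP/idP => [/set_mem /= /eqP//|/eqP H]; exact/mem_set.
    by rewrite !memC e.
  have z : sixth (0, 0) = (0, 0) by rewrite /sixth /rot /= !mulr0 subr0 addr0.
  apply/eqP/eqP => [H|->//]; apply: (can_inj (rotK sixth_unit)).
  by rewrite -/sixth z.
transitivity (\int[mu]_x g' x).
  rewrite -Rintegral_mkcond; apply: (integral_ae ig) => //.
    by rewrite setTD setCK.
  by rewrite setDT measure0.
have ig' : mu.-integrable setT (EFin \o g') by exact: restrict_integrable.
transitivity (\int[mu]_x (\sum_(k < 6) (g' \_ sextant) (iter k sixth x))).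
  apply: eq_Rintegral => x _; apply: sum_sextants => //.
  by rewrite /g' patchE memNset//= => /(_ erefl).
have [_ ->] := integral_orbit 6 preserves_area_sixth (restrict_integrable measurable_sextant ig').
congr (_ * _); rewrite -Rintegral_mkcond; apply: eq_Rintegral => x /set_mem sx.
rewrite /g' patchE mem_set//= => x0; move: sx; rewrite /sextant x0 /= mulr0 oppr0 ltxx andbF //.
Qed.

End rotations.

(** * Integrals over one triangle of the hexagon *)

Lemma opp_lt_gt0 (R : realType) (t : R) : - t < t -> 0 < t.
Proof. lra. Qed.

Lemma sqr_lt_abs (R : realType) (a b : R) : 0 < a -> b < - a \/ a < b -> a ^+ 2 < b ^+ 2.
Proof. by move=> a0 [] H; nra. Qed.

Section hexagon_values.
Context {R : realType} (kappa : R) (C : calibration kappa).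
Notation leb := (@lebesgue_measure R).
Notation pl := (measurableTypeR R * measurableTypeR R)%type.
Notation mu := (borel_lebesgue2 R).
Notation enorm := (@enorm R).
Notation weight := (@weight R kappa C).
Let h := inrad C.
Let m := mid C.
Let r := circ C.
Let w : R := Num.sqrt 3.
Let k0 : 0 < kappa := kappa_gt0 C.
Let h0 : 0 < h := inrad_gt0 C.
Let r0 : 0 < r := circ_gt0 C.
Let r2 : r ^+ 2 = 4 / 3 * h ^+ 2 := circ_sqr C.
Let mk : 2 * m = h * hexconst := mid_hexconst C.
Let w0 : 0 < w. Proof. by rewrite sqrtr_gt0. Qed.
Let w2 : w * w = 3. Proof. by rewrite -expr2 sqr_sqrtr. Qed.

Definition triangle : set pl := sextant `&` [set x | x.1 <= h].

Lemma measurable_fst_le (c : R) : measurable [set x : pl | x.1 <= c].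
Proof. exact: measurable_le_fun measurable_fst (measurable_cst c). Qed.

Lemma measurable_triangle : measurable triangle.
Proof. by apply: measurableI; [exact: measurable_sextant|exact: measurable_fst_le]. Qed.

(** The slice of the triangle at abscissa [x] has half-length x / sqrt 3. *)
Lemma integral_triangle (f : pl -> R) (c d : R) : measurable_fun setT f ->
  mu.-integrable setT (EFin \o (f \_ triangle)) ->
  (forall x, 0 < x -> (\int[leb]_(y in `[(- (x / w))%R, (x / w)%R]) (f (x, y))%:E =
     (c * x ^+ 2 + d * x)%:E)%E) ->
  \int[mu]_(x in triangle) f x = c * h ^+ 3 / 3 + d * h ^+ 2 / 2.
Proof.
move=> mf ifT fx.
rewrite Rintegral_mkcond [LHS]/Rintegral -(integral12_prod_meas1 ifT).
transitivity (\int[leb]_(x in `[0, h]) (c * x ^+ 2 + d * x)); last first.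
  by rewrite integral_quadratic ?ltW// !expr0n !subr0.
congr fine; rewrite [RHS]integral_mkcond; apply: eq_integral => x _.
rewrite patchE /fubini_F; case: ifPn => [/set_mem /=|xn].
  rewrite in_itv /= => /andP[x0 xh].
  have [->|xn0] := eqVneq x 0.
    rewrite expr0n /= !mulr0 addr0 integral0_eq// => y _; rewrite patchE memNset//.
    by rewrite /triangle /sextant /= oppr0 => -[/andP[A B] _]; move: A; rewrite leNgt B.
  have xp : 0 < x by rewrite lt_neqAle eq_sym xn0.
  rewrite -fx// -[RHS]integral_itv_bndo_bndc; last first.
    by apply: measurable_funTS; apply/measurable_EFinP; exact: measurableT_comp.
  rewrite [RHS]integral_mkcond; apply: eq_integral => y _; rewrite !patchE /=.
  have -> : ((x, y) \in triangle) = (y \in `[(- (x / w)), (x / w)[).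
    rewrite in_itv /= -mulNr ler_pdivrMr// ltr_pdivlMr// mulrC.
    apply/idP/idP => [/set_mem [] //|H]; exact/mem_set.
  by case: ifPn => yi; [rewrite mem_set|rewrite memNset//; exact/negP].
rewrite integral0_eq// => y _; rewrite /= patchE memNset// => -[/= /andP[A B] xh].
move/negP: xn; apply; apply/mem_set; rewrite /= in_itv /= xh andbT.
have H : - (x : R) < (x : R) := le_lt_trans A B.
exact/ltW/opp_lt_gt0.
Qed.

Lemma triangle_bounded (x : pl) : triangle x -> enorm x <= r.
Proof.
move=> [/= /andP[A B] xh]; rewrite -(@ler_sqr R) ?nnegrE ?sqrtr_ge0 ?(ltW r0)//.
rewrite sqr_sqrtr ?addr_ge0 ?sqr_ge0// r2.
have : (w * x.2) ^+ 2 <= x.1 ^+ 2 by move: A B; rewrite -/w; nra.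
have x1 : 0 < x.1 by exact: opp_lt_gt0 (le_lt_trans A B).
rewrite exprMn expr2 w2 => H; have : x.1 ^+ 2 <= h ^+ 2 by nra.
lra.
Qed.

Let wn : w != 0. Proof. by rewrite gt_eqF. Qed.

Lemma chord_sixth (x : R) : 0 < x -> chord x (x / w) = x * hexconst.
Proof.
move=> x0; rewrite /hexconst -RintegralZl//; last first.
  by apply: integrable_continuous_itv; exact: continuous_hexconst.
apply: eq_Rintegral => s _; transitivity (Num.sqrt (x ^+ 2 * (1 + s ^+ 2 / 3))).
  by congr Num.sqrt; rewrite -w2; field.
by rewrite sqrtrM ?sqr_ge0// sqrtr_sqr gtr0_norm.
Qed.

Lemma triangle_enorm : kappa * \int[mu]_(x in triangle) enorm x = 1 / 3.
Proof.
rewrite (@integral_triangle _ (hexconst / w) 0).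
- rewrite !mul0r addr0; have := calibrated C; rewrite -/h -/w => e.
  transitivity (kappa * hexconst * h ^+ 3 / w / 3); first by field.
  by rewrite e divff.
- exact: measurable_enorm.
- apply: (@bounded_integrable _ _ _ r r measurable_triangle triangle_bounded measurable_enorm).
  by move=> x /triangle_bounded xr; rewrite ger0_norm ?sqrtr_ge0.
- move=> x x0.
  have ic : leb.-integrable `[(- (x / w)), (x / w)] (EFin \o (fun y => Num.sqrt (x ^+ 2 + y ^+ 2))).
    have := integrable_hypot x 1 (- (x / w)) (x / w); apply: eq_integrable => // y _ /=.
    by rewrite expr1n mul1r.
  rewrite -[LHS]fineK; last exact: integrable_fin_num.
  congr EFin; rewrite -[LHS]/(Rintegral leb `[(- (x / w)), (x / w)] (fun y => Num.sqrt (x ^+ 2 + y ^+ 2))).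
  by rewrite chord_scale ?divr_gt0// chord_sixth//; field.
Qed.

Lemma triangle_area : kappa * m * \int[mu]_(x in triangle) 1 = 1 / 2.
Proof.
rewrite (@integral_triangle (cst 1) 0 (2 / w)).
- rewrite !mul0r add0r; have := calibrated C; rewrite -/h -/w => e.
  have -> : m = h * hexconst / 2 by rewrite -mk; field.
  transitivity (kappa * hexconst * h ^+ 3 / w / 2); first by field.
  by rewrite e divff.
- exact: measurable_cst.
- apply: (@bounded_integrable _ _ _ r 1 measurable_triangle triangle_bounded) => //.
  by move=> x _; rewrite normr1.
- move=> x x0; transitivity (1%:E * leb `[(- (x / w))%R, (x / w)%R])%E.
    exact: (@integral_cst _ _ R leb _ (measurable_itv `[(- (x / w))%R, (x / w)%R]) 1%:E).
  rewrite mul1e lebesgue_measure_itv /= lte_fin gtrN ?divr_gt0//.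
  by rewrite -EFinD; congr EFin; field.
Qed.

Lemma triangle_weight :
  \int[mu]_(x in triangle) weight x = kappa * \int[mu]_(x in triangle) enorm x
    - kappa * m * \int[mu]_(x in triangle) 1.
Proof.
have iT (f : pl -> R) (M : R) : measurable_fun setT f -> (forall x, triangle x -> `|f x| <= M) ->
    mu.-integrable triangle (EFin \o f).
  move=> mf fM; have := bounded_integrable measurable_triangle triangle_bounded mf fM.
  by rewrite -restrict_EFin => /(integrable_mkcond _ measurable_triangle).
have ie : mu.-integrable triangle (EFin \o (enorm : pl -> R)).
  apply: (iT _ r) => [|x /triangle_bounded xr]; first exact: measurable_enorm.
  by rewrite ger0_norm ?sqrtr_ge0.
have i1 : mu.-integrable triangle (EFin \o (cst 1 : pl -> R)).
  by apply: (iT _ 1) => // x _; rewrite normr1.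
have ik : mu.-integrable triangle (EFin \o (fun x : pl => kappa * enorm x)).
  by have := integrableZl measurable_triangle kappa ie; apply: eq_integrable => //; exact: measurable_triangle.
have im : mu.-integrable triangle (EFin \o (fun x : pl => kappa * m * 1)).
  by have := integrableZl measurable_triangle (kappa * m) i1; apply: eq_integrable => //; exact: measurable_triangle.
rewrite -RintegralZl//; last exact: measurable_triangle.
rewrite -(RintegralZl _ measurable_triangle i1) -RintegralB//; last exact: measurable_triangle.
apply: eq_Rintegral => x /set_mem /triangle_bounded xr.
by rewrite /weight -/r -/m xr /= mulr1 mulrBr.
Qed.

Lemma weight_sixth (x : pl) : weight (sixth x) = weight x.
Proof. by rewrite /weight /sixth enorm_rot// sixth_unit. Qed.

(** The six triangles of the hexagon have total weight 2 - 3 = -1. Outside the hexagon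
the weight lives in the circumcircle, where the six caps beyond the sides are
disjoint, each inside its own sextant. *)
Lemma weight_balance : 1 + \int[mu]_x weight x = 6 * capmass C.
Proof.
have iw := weight_integrable C.
rewrite (integral_sextants weight_sixth iw).
have mH := @halfplane_measurable R h.
rewrite (integral_splitI iw measurable_sextant (measurable_fst_le h)) -/triangle.
rewrite triangle_weight triangle_enorm triangle_area.
suff -> : \int[mu]_(x in sextant `\` [set x | x.1 <= h]) weight x = capmass C by field.
have mS := measurable_sextant; have mF := measurable_fst_le h.
have mSD : measurable (sextant `\` [set x : pl | x.1 <= h]) by exact: measurableD.
rewrite /capmass -/h (integral_splitI iw mH mSD).
rewrite (_ : _ `&` _ = sextant `\` [set x | x.1 <= h]); last first.
  apply/seteqP; split => [x []//|x H]; split => //; case: H => _ /= /negP.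
  by rewrite -ltNge => /ltW.
(* apart from the lines bounding them, the cap and the sextant beyond the side differ
   only outside the circumcircle *)
pose N1 := [set x : pl | 1 * x.1 + 0 * x.2 = h]; pose N2 := [set x : pl | 1 * x.1 + (- w) * x.2 = 0].
have mN : measurable (N1 `|` N2) by apply: measurableU; exact: measurable_line.
have N0 : mu (N1 `|` N2) = 0%E.
  rewrite [LHS]measureU0//; first by apply: line_null; rewrite oner_neq0.
  - exact: measurable_line.
  - exact: measurable_line.
  - by apply: line_null; rewrite oner_neq0.
set E := _ `\` (_ `\` _).
have mE : measurable E by exact: measurableD.
rewrite (integral_splitI iw mE mN) (integral_null iw (measurableI _ _ mE mN)); last first.
  by apply/eqP; rewrite -measure_le0 -N0; apply: le_measure; rewrite ?inE//; exact: measurableI.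
rewrite (_ : \int[mu]_(x in E `\` _) _ = 0) ?addr0//.
rewrite -[RHS](mul0r (fine (mu (E `\` (N1 `|` N2))))) -Rintegral_cst; last exact: measurableD.
apply: eq_Rintegral => x /set_mem [[/= hx nS] nN]; rewrite /weight -/r.
case: ifPn => // xr; exfalso.
have x1 : h < x.1.
  by rewrite lt_neqAle hx andbT; apply/eqP => e; apply: nN; left; rewrite /N1 /= e; ring.
have x2 : x.1 <> w * x.2 by move=> e; apply: nN; right; rewrite /N2 /= e; ring.
have : ~ (- x.1 <= w * x.2 < x.1).
  move=> H; apply: nS; split => //=; apply/negP; rewrite -ltNge; exact: x1.
have {}xr : x.1 ^+ 2 + x.2 ^+ 2 <= r ^+ 2.
  rewrite -[leLHS]sqr_sqrtr ?addr_ge0 ?sqr_ge0//.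
  by rewrite ler_sqr ?nnegrE ?sqrtr_ge0 ?(ltW r0).
apply; apply/negPn/negP; rewrite negb_and -ltNge -leNgt => /orP H.
have {}H : (w * x.2) ^+ 2 > x.1 ^+ 2.
  apply: sqr_lt_abs; first exact: lt_trans h0 x1.
  by case: H => H; [left|right; rewrite lt_neqAle H andbT; apply/eqP].
move: H; rewrite exprMn [w ^+ 2]expr2 w2 => H.
have : h ^+ 2 < x.1 ^+ 2 by rewrite ltr_pXn2r// nnegrE ltW// (lt_trans h0).
by move: xr H; rewrite r2; lra.
Qed.

End hexagon_values.

(** * Visibility between bars *)

Section bar_visibility.
Context {R : realType} (I : finType) (a : I -> R) (act : I -> R -> Prop).
Hypothesis a_inj : injective a.
Hypothesis act_convex : forall i s t u, act i s -> act i u -> s <= t -> t <= u -> act i t.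

(** The bar [i] lies at height [a i] and occupies the times at which [act i] holds, an
interval by [act_convex]. Two bars are neighbours at a time when they see each
other vertically. *)
Definition neighbours (e : I * I) (t : R) :=
  [/\ a e.1 < a e.2, act e.1 t, act e.2 t &
   forall l, a e.1 < a l -> a l < a e.2 -> ~ act l t].

Lemma neighbours_inj_l e e' t : neighbours e t -> neighbours e' t -> e.1 = e'.1 -> e = e'.
Proof.
move=> [ae a1 a2 h] [ae' a1' a2' h'] e1.
suff e2 : e.2 = e'.2 by rewrite (surjective_pairing e) e1 e2 -surjective_pairing.
apply: a_inj; apply/eqP; rewrite eq_le !leNgt; apply/andP; split; apply/negP => H.
  by apply: (h e'.2) => //; rewrite e1.
by apply: (h' e.2) => //; rewrite -e1.
Qed.

Lemma neighbours_inj_r e e' t : neighbours e t -> neighbours e' t -> e.2 = e'.2 -> e = e'.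
Proof.
move=> [ae a1 a2 h] [ae' a1' a2' h'] e2.
suff e1 : e.1 = e'.1 by rewrite (surjective_pairing e) e1 e2 -surjective_pairing.
apply: a_inj; apply/eqP; rewrite eq_le !leNgt; apply/andP; split; apply/negP => H.
  by apply: (h' e.1) => //; rewrite -e2.
by apply: (h e'.1) => //; rewrite e2.
Qed.

Lemma neighbours_inj_m e e' t l : neighbours e t -> neighbours e' t ->
  a e.1 < a l < a e.2 -> a e'.1 < a l < a e'.2 -> e = e'.
Proof.
move=> n n' /andP[l1 l2] /andP[l1' l2']; apply: (neighbours_inj_l n n').
have [ae a1 a2 h] := n; have [ae' a1' a2' h'] := n'.
apply: a_inj; apply/eqP; rewrite eq_le !leNgt; apply/andP; split; apply/negP => H.
  by apply: (h' e.1) => //; exact: lt_trans l1 l2'.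
by apply: (h e'.1) => //; exact: lt_trans l1' l2.
Qed.

Variables (E : {set I * I}) (tau : I * I -> R).
Hypothesis E_neighbours : forall e, e \in E -> neighbours e (tau e).

Let T t := exists2 e, e \in E & tau e = t.

Let first e t := [/\ T t, neighbours e t & forall s, T s -> s < t -> ~ neighbours e s].

Let exists_first e : e \in E -> exists t, first e t.
Proof.
move=> eE; pose P f := (f \in E) && `[< neighbours e (tau f) >].
have Pe : P e by rewrite /P eE; exact/asboolP/E_neighbours.
case: (Order.TotalTheory.arg_minP tau Pe) => f /andP[fE /asboolP nf] fmin.
exists (tau f); split => // [|_ [g gE <-] gf ng]; first by exists f.
have Pg : P g by rewrite /P gE; exact/asboolP.
by have := fmin g Pg; rewrite leNgt gf.
Qed.

Let exists_prev t s : T s -> s < t ->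
  exists u, [/\ T u, u < t & forall v, T v -> v < t -> v <= u].
Proof.
move=> [e eE <-] et; pose P f := (f \in E) && (tau f < t).
have Pe : P e by rewrite /P eE.
case: (Order.TotalTheory.arg_maxP tau Pe) => f /andP[fE ft] fmax.
exists (tau f); split => // [|_ [g gE <-] gt]; first by exists f.
by apply: fmax; rewrite /P gE.
Qed.

(** An edge is charged, at the first sampled time when its two bars see each other, to
the event that made this possible: the lower bar has just begun (label 0), the
upper bar has just begun (label 1), or a bar between them has just ended (label 2). *)
Let charge e t (c : 'I_3 * I) :=
  [\/ [/\ c.1 = 0 :> nat, c.2 = e.1 & forall s, T s -> s < t -> ~ act e.1 s],
      [/\ c.1 = 1 :> nat, c.2 = e.2 & forall s, T s -> s < t -> ~ act e.2 s] |
      [/\ c.1 = 2 :> nat, a e.1 < a c.2 < a e.2 &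
       exists u, [/\ u < t, act c.2 u & forall v, T v -> v < t -> v <= u]]].

Let charged e c := exists2 t, first e t & charge e t c.

Let charged_ex e : e \in E -> exists c, charged e c.
Proof.
move=> eE; have [t ft] := exists_first eE; have [Tt [ae a1 a2 hb] hmin] := ft.
have [n1|/existsNP[s1 /not_implyP[Ts1 /not_implyP[s1t /contrapT as1]]]] :=
    pselect (forall s, T s -> s < t -> ~ act e.1 s).
  by exists (ord0, e.1); exists t => //; apply: Or31.
have [n2|/existsNP[s2 /not_implyP[Ts2 /not_implyP[s2t /contrapT as2]]]] :=
    pselect (forall s, T s -> s < t -> ~ act e.2 s).
  by exists (inord 1, e.2); exists t => //; apply: Or32; rewrite /= inordK.
have [u [Tu ut umax]] := exists_prev Ts1 s1t.
have u1 : act e.1 u := act_convex as1 a1 (umax _ Ts1 s1t) (ltW ut).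
have u2 : act e.2 u := act_convex as2 a2 (umax _ Ts2 s2t) (ltW ut).
have [l [l1 l2 lu]] : exists l, [/\ a e.1 < a l, a l < a e.2 & act l u].
  apply: contrapT => nl; apply: (hmin u Tu ut); split => // l l1 l2 lu.
  by apply: nl; exists l.
exists (inord 2, l); exists t => //; apply: Or33; rewrite /= inordK//; split => //.
  by rewrite l1.
by exists u.
Qed.

(** A bar begins once and ends once, so equal charges occur at the same time; at a
given time a bar has one neighbour above, one below, and a height lies between the
heights of only one pair of neighbours. *)
Let charged_inj e e' c : charged e c -> charged e' c -> e = e'.
Proof.
have half f f' t t' : first f t -> first f' t' -> charge f t c -> charge f' t' c -> t <= t'.
  move=> [Tt [_ a1 a2 hb] _] [Tt' [_ a1' a2' hb'] _].
  case=> [[c0 ce hs]|[c0 ce hs]|[c0 /andP[l1 l2] [u [ut lu umax]]]];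
    case=> [[c0' ce' hs']|[c0' ce' hs']|[c0' /andP[l1' l2'] [u' [ut' lu' umax']]]];
    try by move: c0'; rewrite c0.
  - rewrite leNgt; apply/negP => tt'; apply: (hs _ Tt' tt').
    by rewrite -ce ce'.
  - rewrite leNgt; apply/negP => tt'; apply: (hs _ Tt' tt').
    by rewrite -ce ce'.
  - rewrite leNgt; apply/negP => tt'.
    apply: (hb' c.2 l1' l2'); apply: (act_convex lu' lu); first exact: ltW.
    exact: umax.
move=> [t ft ct] [t' ft' ct'].
have tt' : t = t'.
  by apply/eqP; rewrite eq_le (half _ _ _ _ ft ft' ct ct') (half _ _ _ _ ft' ft ct' ct).
move: ft' ct'; rewrite -tt' => ft' ct' {tt' t' half}.
have [_ n _] := ft; have [_ n' _] := ft'.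
case: ct => [[c0 ce hs]|[c0 ce hs]|[c0 l _]];
  case: ct' => [[c0' ce' hs']|[c0' ce' hs']|[c0' l' _]]; try by move: c0'; rewrite c0.
- by apply: (neighbours_inj_l n n'); rewrite -ce.
- by apply: (neighbours_inj_r n n'); rewrite -ce.
- exact: neighbours_inj_m n n' l l'.
Qed.

(** Up to an additive constant this is the edge bound of planar graphs, obtained here by
counting events instead of faces. *)
Lemma bar_visibility : (#|E| <= 3 * #|I|)%N.
Proof.
have [->|[e0 e0E]] := set_0Vmem E; first by rewrite cards0.
pose f e := if pselect (exists c, charged e c) is left ex then projT1 (cid ex) else (ord0, e.1).
have fP e : e \in E -> charged e (f e).
  move=> eE; rewrite /f; case: pselect => [ex|]; first exact: projT2 (cid ex).
  by move=> []; exact: charged_ex.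
have fi : {in E &, injective f}.
  move=> e e' eE eE' ff; apply: (@charged_inj _ _ (f e)); first exact: fP.
  by rewrite ff; exact: fP.
rewrite -(card_in_imset fi); apply: leq_trans (max_card _) _.
by rewrite card_prod card_ord.
Qed.

End bar_visibility.

(** * Edges of the Delaunay graph *)

Section delaunay.
Context {R : realType} (I : finType) (p : I -> R * R).
Hypothesis p_inj : injective p.

Definition sqd (x y : R * R) : R := (x.1 - y.1) ^+ 2 + (x.2 - y.2) ^+ 2.

(** An edge needs a circle through both sites with all the others strictly outside;
cells that touch only at a vertex are not adjacent. *)
Definition adjacent (i j : I) := i != j /\ exists x, sqd x (p i) = sqd x (p j) /\
  forall l, l != i -> l != j -> sqd x (p i) < sqd x (p l).

Definition height (c s : R) (x : R * R) := c * x.1 + s * x.2.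

(** The positions [t] at which the sweep line, parallel to (c, s), meets the closed cell
of [i]; the cell is convex, so they form an interval. *)
Let act (c s : R) (i : I) (t : R) := exists x : R * R,
  c * x.2 - s * x.1 = t /\ forall j, sqd x (p i) <= sqd x (p j).

Let act_convex (c s : R) i t1 t t2 : act c s i t1 -> act c s i t2 -> t1 <= t -> t <= t2 ->
  act c s i t.
Proof.
move=> [x [xt xi]] [y [yt yi]] t1t tt2.
have [e|ne] := eqVneq t1 t2.
  by exists x; split => //; apply/eqP; rewrite xt eq_le t1t e.
have t12 : t1 < t2 by rewrite lt_neqAle ne (le_trans t1t).
pose w := (t2 - t) / (t2 - t1).
have d0 : 0 < t2 - t1 by rewrite subr_gt0.
have w0 : 0 <= w by rewrite divr_ge0 ?subr_ge0// ltW.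
have w1 : 0 <= 1 - w.
  by rewrite subr_ge0 ler_pdivrMr// mul1r lerD2l lerN2.
exists (w * x.1 + (1 - w) * y.1, w * x.2 + (1 - w) * y.2); split.
  transitivity (w * (c * x.2 - s * x.1) + (1 - w) * (c * y.2 - s * y.1)); first by rewrite /=; ring.
  by rewrite xt yt /w; field; rewrite gt_eqF.
move=> j; rewrite -subr_ge0.
have -> : sqd (w * x.1 + (1 - w) * y.1, w * x.2 + (1 - w) * y.2) (p j) -
  sqd (w * x.1 + (1 - w) * y.1, w * x.2 + (1 - w) * y.2) (p i) =
  w * (sqd x (p j) - sqd x (p i)) + (1 - w) * (sqd y (p j) - sqd y (p i)).
  by rewrite /sqd /=; ring.
by rewrite addr_ge0// mulr_ge0// subr_ge0.
Qed.

(** Along a line of direction (c, s) the cells are met in the order of the heights of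
their sites. At the centre of a circle witnessing adjacency no third cell is
present, so the two bars see each other at that position of the sweep line. *)
Let half_adjacent_bound (c s : R) (E : {set I * I}) : 0 < c ^+ 2 + s ^+ 2 ->
  injective (height c s \o p) ->
  (forall e, e \in E -> adjacent e.1 e.2) ->
  (forall e, e \in E -> height c s (p e.1) < height c s (p e.2)) -> (#|E| <= 3 * #|I|)%N.
Proof.
move=> n0 inj adj lt.
have adjx e : e \in E -> exists x, sqd x (p e.1) = sqd x (p e.2) /\
  forall l, l != e.1 -> l != e.2 -> sqd x (p e.1) < sqd x (p l).
  by move/adj => [_].
pose wit e : R * R := if pselect (e \in E) is left eE then projT1 (cid (adjx e eE)) else (0, 0).
have witP e : e \in E -> sqd (wit e) (p e.1) = sqd (wit e) (p e.2) /\
  forall l, l != e.1 -> l != e.2 -> sqd (wit e) (p e.1) < sqd (wit e) (p l).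
  by move=> eE; rewrite /wit; case: pselect => // eE'; exact: projT2 (cid (adjx e eE')).
apply: (@bar_visibility R I (height c s \o p) (act c s) inj _ E
  (fun e => c * (wit e).2 - s * (wit e).1)); first exact: act_convex.
move=> e eE; have [we wl] := witP e eE; set x := wit e in we wl *.
have wle l : sqd x (p e.1) <= sqd x (p l).
  have [->|l1] := eqVneq l e.1; first by [].
  have [->|l2] := eqVneq l e.2; first by rewrite we.
  exact/ltW/wl.
split; first exact: lt.
- by exists x.
- by exists x; split => // l; rewrite -we.
move=> l /= l1 l2 [y [yx yl]].
have ln1 : l != e.1 by apply: contraTneq l1 => ->; rewrite ltxx.
have ln2 : l != e.2 by apply: contraTneq l2 => ->; rewrite ltxx.
have xl := wl l ln1 ln2; have xl2 : sqd x (p e.2) < sqd x (p l) by rewrite -we.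
pose g := (c * (y.1 - x.1) + s * (y.2 - x.2)) / (c ^+ 2 + s ^+ 2).
have nn : c ^+ 2 + s ^+ 2 != 0 by rewrite gt_eqF.
have gn : g * (c ^+ 2 + s ^+ 2) = c * (y.1 - x.1) + s * (y.2 - x.2) by rewrite /g divfK.
have H0 : c * (y.2 - x.2) - s * (y.1 - x.1) = 0.
  transitivity (c * y.2 - s * y.1 - (c * x.2 - s * x.1)); first by ring.
  by rewrite yx subrr.
have y1 : y.1 = x.1 + g * c.
  apply: (mulIf nn); transitivity (x.1 * (c ^+ 2 + s ^+ 2) + g * (c ^+ 2 + s ^+ 2) * c
     - s * (c * (y.2 - x.2) - s * (y.1 - x.1))); last by rewrite H0; ring.
  by rewrite gn; ring.
have y2 : y.2 = x.2 + g * s.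
  apply: (mulIf nn); transitivity (x.2 * (c ^+ 2 + s ^+ 2) + g * (c ^+ 2 + s ^+ 2) * s
     + c * (c * (y.2 - x.2) - s * (y.1 - x.1))); last by rewrite H0; ring.
  by rewrite gn; ring.
(* moving by [g] in the direction (c, s) changes the comparison of two sites by a
   multiple of their difference of heights, so a third site of intermediate height
   cannot become nearest *)
have diff k : sqd y (p l) - sqd y (p k) = sqd x (p l) - sqd x (p k) -
    2 * g * (height c s (p l) - height c s (p k)).
  by rewrite /sqd /height y1 y2; ring.
have := yl e.1; rewrite -subr_le0 diff => D1.
have := yl e.2; rewrite -subr_le0 diff => D2.
move: l1 l2; rewrite -subr_gt0 => l1; rewrite -subr_lt0 => l2.
have g1 : 0 < g by rewrite ltNge; apply/negP => g0; move: D1 xl l1; nra.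
by move: D2 xl2 l2; nra.
Qed.

(** The slope only has to avoid the directions orthogonal to differences of sites, and
a large one does. *)
Lemma exists_generic : exists s : R, injective (height 1 s \o p).
Proof.
pose q (e : I * I) := `|(p e.1).1 - (p e.2).1| / `|(p e.1).2 - (p e.2).2|.
pose S := \sum_e q e.
have q0 e : 0 <= q e by rewrite divr_ge0.
have qS e : q e <= S by rewrite /S (bigD1 e)//= lerDl sumr_ge0.
exists (S + 1) => i j /= ij; apply: p_inj.
have S0 : 0 <= S by rewrite sumr_ge0.
have D : (p i).1 - (p j).1 = - ((S + 1) * ((p i).2 - (p j).2)).
  by apply/eqP; rewrite -subr_eq0 opprK; apply/eqP; move: ij; rewrite /height; lra.
have [e2|ne2] := eqVneq ((p i).2 - (p j).2) 0.
  rewrite e2 mulr0 oppr0 in D.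
  by rewrite (surjective_pairing (p i)) (surjective_pairing (p j)) (subr0_eq e2) (subr0_eq D).
have := qS (i, j); rewrite /q /= D normrN normrM mulfK ?normr_eq0//.
by rewrite ger0_norm ?addr_ge0// -lerBrDl subrr ler10.
Qed.

(** The edges are ordered pairs; with respect to a generic direction those pointing up
and those pointing down number at most [3 * #|I|] each. *)
Lemma adjacent_bound (E : {set I * I}) : (forall e, e \in E -> adjacent e.1 e.2) ->
  (#|E| <= 6 * #|I|)%N.
Proof.
move=> adj; have [s inj] := exists_generic.
pose up : {set I * I} := [set e in E | height 1 s (p e.1) < height 1 s (p e.2)]%SET.
pose dn : {set I * I} := [set e in E | height 1 s (p e.2) < height 1 s (p e.1)]%SET.
have EU : E \subset up :|: dn.
  apply/fintype.subsetP => e eE; rewrite !inE eE /=; apply: contraT; rewrite negb_or -!leNgt.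
  rewrite -eq_le => /eqP /esym /inj e12; have [] := adj e eE.
  by rewrite e12 eqxx.
apply: leq_trans (subset_leq_card EU) _; apply: leq_trans (leq_card_setU _ _) _.
rewrite (_ : 6 = 3 + 3)%N // mulnDl; apply: leq_add.
  apply: (@half_adjacent_bound 1 s) => //.
  - by rewrite expr1n ltr_pwDl ?sqr_ge0.
  - by move=> e; rewrite inE => /andP[/adj].
  - by move=> e; rewrite inE => /andP[].
apply: (@half_adjacent_bound (- 1) (- s)) => //.
- by rewrite !sqrrN expr1n ltr_pwDl ?sqr_ge0.
- by move=> i j /= ij; apply: inj; move: ij; rewrite /= /height; lra.
- by move=> e; rewrite inE => /andP[/adj].
- by move=> e; rewrite inE => /andP[_]; rewrite /height; lra.
Qed.

End delaunay.

(** * Weights of the cells of finitely many sites *)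

Section finite_voronoi.
Context {R : realType} (kappa : R) (C : calibration kappa).
Notation pl := (measurableTypeR R * measurableTypeR R)%type.
Notation mu := (borel_lebesgue2 R).
Notation enorm := (@enorm R).
Notation weight := (@weight R kappa C).

Lemma measurable_halfplane_lt (a b c : R) : measurable [set x : pl | a * x.1 + b * x.2 < c].
Proof.
have -> : [set x : pl | a * x.1 + b * x.2 < c] = ~` [set x : pl | (- a) * x.1 + (- b) * x.2 <= - c].
  apply/seteqP; split => x /=; first by move=> H /=; lra.
  by move/negP; rewrite -ltNge; lra.
by apply: measurableC; exact: measurable_halfplane.
Qed.

Lemma measurable_forall (J : finType) (A : J -> set pl) : (forall j, measurable (A j)) ->
  measurable [set x | forall j, A j x].
Proof.
move=> mA; have -> : [set x | forall j, A j x] = \bigcap_(j in [set: J]) A j.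
  by apply/seteqP; split => [x H j _|x H j]; exact: H.
by apply: fin_bigcap_measurable.
Qed.

Lemma measurable_imp (P : Prop) (A : set pl) : measurable A -> measurable [set x | P -> A x].
Proof.
move=> mA; have [HP|HP] := pselect P.
  by rewrite (_ : [set x | _] = A)//; apply/seteqP; split => x /=; [apply|move=> ?].
by rewrite (_ : [set x | _] = setT)//; apply/seteqP; split => x //= _ /HP.
Qed.

Lemma bigsetU_null (J : Type) (s : seq J) (L : J -> set pl) :
  (forall j, measurable (L j)) -> (forall j, mu (L j) = 0%E) ->
  measurable (\big[setU/set0]_(j <- s) L j) /\ mu (\big[setU/set0]_(j <- s) L j) = 0%E.
Proof.
move=> mL L0; elim: s => [|j s [ms es]]; first by rewrite big_nil measure0.
rewrite big_cons; split; first exact: measurableU.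
by rewrite [LHS]measureU0.
Qed.

Lemma integral_bigsetU (J : choiceType) (s : seq J) (B : J -> set pl) (g : pl -> R) :
  mu.-integrable setT (EFin \o g) -> uniq s -> (forall j, measurable (B j)) ->
  (forall i j x, B i x -> B j x -> i = j) ->
  measurable (\big[setU/set0]_(j <- s) B j) /\
  \int[mu]_(x in \big[setU/set0]_(j <- s) B j) g x = \sum_(j <- s) \int[mu]_(x in B j) g x.
Proof.
move=> ig us mB dB; elim: s us => [|j s IH] /=; first by rewrite !big_nil Rintegral_set0.
move=> /andP[js us]; have [ms es] := IH us.
rewrite !big_cons -es; split; first exact: measurableU.
rewrite Rintegral_setU//; first by apply: integrableT => //; exact: measurableU.
apply/disj_setPS => x [Bjx]; rewrite -bigcup_seq => -[k /= ks Bkx].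
by move: js; rewrite (dB _ _ _ Bjx Bkx) ks.
Qed.

Context (I : finType) (p : I -> pl).
Hypothesis p_inj : injective p.

(** The open Voronoi cell of site [i], translated so that the site is the origin. *)
Definition cell (i : I) : set pl := [set v | forall j, j != i ->
  2 * (v.1 * ((p j).1 - (p i).1) + v.2 * ((p j).2 - (p i).2)) < sqd (p j) (p i)].

Section one_cell.
Variable i : I.
Let d j : pl := ((p j).1 - (p i).1, (p j).2 - (p i).2).
Let D j : R := (d j).1 ^+ 2 + (d j).2 ^+ 2.
(* [rate j] is the linear form equal to 1 on the bisector of the sites [i] and [j]. *)
Let rate j (v : pl) : R := 2 * (v.1 * (d j).1 + v.2 * (d j).2) / D j.

Let D_gt0 j : j != i -> 0 < D j.
Proof.
move=> ji; rewrite lt_neqAle addr_ge0 ?sqr_ge0// andbT eq_sym paddr_eq0 ?sqr_ge0// !sqrf_eq0.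
apply: contra ji => /andP[/eqP e1 /eqP e2]; apply/eqP/p_inj.
by rewrite (surjective_pairing (p i)) (surjective_pairing (p j)) (subr0_eq e1) (subr0_eq e2).
Qed.

Let cellE : cell i = [set v | forall j, j != i -> rate j v < 1].
Proof.
apply/seteqP; split => v vc j ji; have := vc j ji; rewrite /rate /sqd -/(D j).
  by rewrite ltr_pdivrMr ?D_gt0// mul1r.
by rewrite ltr_pdivrMr ?D_gt0// mul1r.
Qed.

Let rate_lin j v : rate j v = (2 * (d j).1 / D j) * v.1 + (2 * (d j).2 / D j) * v.2.
Proof. by rewrite /rate; ring. Qed.

Let mrate_lt j c : measurable [set v | rate j v < c].
Proof.
have := measurable_halfplane_lt (2 * (d j).1 / D j) (2 * (d j).2 / D j) c.
by congr measurable; apply/seteqP; split => v /=; rewrite rate_lin.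
Qed.

Lemma measurable_cell : measurable (cell i).
Proof.
rewrite cellE; apply: (@measurable_forall _ (fun j => [set v | j != i -> rate j v < 1])) => j.
by apply: (@measurable_imp (j != i) [set v | rate j v < 1]); exact: mrate_lt.
Qed.

(* The directions in which the cell is left through the bisector of [j]. *)
Let K j : set pl := [set v | 0 < rate j v /\ forall l, l != i -> l != j -> rate l v < rate j v].

Let rateZ j c v : rate j (c * v.1, c * v.2) = c * rate j v.
Proof. by rewrite /rate /=; ring. Qed.

Let cone_K j : cone (K j).
Proof.
move=> c v c0 [v0 vl]; split; first by rewrite rateZ mulr_gt0.
by move=> l li lj; rewrite !rateZ ltr_pM2l//; exact: vl.
Qed.

Let measurable_K j : measurable (K j).
Proof.
have -> : K j = ~` [set v | rate j v <= 0] `&`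
    [set v | forall l, l != i -> l != j -> rate l v < rate j v].
  apply/seteqP; split => v [v0 vl]; split => //; first by apply/negP; rewrite -ltNge.
  by rewrite ltNge; exact/negP.
apply: measurableI.
  apply: measurableC.
  have := measurable_halfplane (2 * (d j).1 / D j) (2 * (d j).2 / D j) 0.
  by congr measurable; apply/seteqP; split => v /=; rewrite rate_lin.
apply: (@measurable_forall _ (fun l => [set v | l != i -> l != j -> rate l v < rate j v])) => l.
apply: (@measurable_imp (l != i) [set v | l != j -> rate l v < rate j v]).
apply: (@measurable_imp (l != j) [set v | rate l v < rate j v]).
have := measurable_halfplane_lt (2 * (d l).1 / D l - 2 * (d j).1 / D j)
   (2 * (d l).2 / D l - 2 * (d j).2 / D j) 0.
have e v : rate l v - rate j v = (2 * (d l).1 / D l - 2 * (d j).1 / D j) * v.1 +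
   (2 * (d l).2 / D l - 2 * (d j).2 / D j) * v.2 by rewrite !rate_lin; ring.
by congr measurable; apply/seteqP; split => v /=; rewrite -e subr_lt0.
Qed.

(* The part of the complement of the cell that is seen through neighbour [j]. *)
Let B j : set pl := if j == i then set0 else K j `&` [set v | 1 <= rate j v].

Let measurable_B j : measurable (B j).
Proof.
rewrite /B; case: ifP => // ji; apply: measurableI => //.
rewrite (_ : [set v | _] = ~` [set v | rate j v < 1]); first exact: measurableC.
by apply/seteqP; split => v /=; rewrite leNgt => /negP.
Qed.

Let B_disjoint j l v : B j v -> B l v -> j = l.
Proof.
rewrite /B; case: eqVneq => // ji; case: eqVneq => // li [[_ vj] _] [[_ vl] _].
apply/eqP; apply: contraT => jl; have := vj l li; rewrite eq_sym jl => /(_ isT).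
by move=> /lt_trans /(_ (vl j ji jl)); rewrite ltxx.
Qed.

Let line j l : set pl := if [|| j == i, l == i | j == l] then set0
  else [set v | (2 * (d j).1 / D j - 2 * (d l).1 / D l) * v.1 +
                (2 * (d j).2 / D j - 2 * (d l).2 / D l) * v.2 = 0].

Let line_mu j l : measurable (line j l) /\ mu (line j l) = 0%E.
Proof.
rewrite /line; case: ifPn => [_|]; first by split => //; exact: measure0.
rewrite !negb_or => /and3P[ji li jl]; split; first exact: measurable_line.
apply: line_null; apply: contraT; rewrite negb_or !negbK => /andP[/eqP e1 /eqP e2].
have Dj := D_gt0 ji; have Dl := D_gt0 li.
have Djn : D j != 0 by rewrite gt_eqF.
have Dln : D l != 0 by rewrite gt_eqF.
have f1 : 2 * (d j).1 / D j = 2 * (d l).1 / D l by exact: subr0_eq.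
have f2 : 2 * (d j).2 / D j = 2 * (d l).2 / D l by exact: subr0_eq.
have sq k : D k != 0 -> (2 * (d k).1 / D k) ^+ 2 + (2 * (d k).2 / D k) ^+ 2 = 4 / D k.
  move=> Dk; transitivity (4 * D k / (D k) ^+ 2); last by field.
  by rewrite {3}/D; field.
have eD : D j = D l.
  have : 4 / D j = 4 / D l by rewrite -(sq j)// -(sq l)// f1 f2.
  by move=> /(mulfI (ltac:(by rewrite pnatr_eq0) : (4 : R) != 0)) /invr_inj.
move: jl; apply: contra_neqT => _; apply: p_inj.
have two : (2 : R) != 0 by rewrite pnatr_eq0.
move: f1 f2; rewrite eD => /(mulIf (invr_neq0 Dln)) /(mulfI two) g1.
move=> /(mulIf (invr_neq0 Dln)) /(mulfI two) g2.
rewrite (surjective_pairing (p j)) (surjective_pairing (p l)).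
by rewrite (addIr _ g1) (addIr _ g2).
Qed.

(** The ray through [v] leaves the cell at the point where [rate j] is 1: this point is
equidistant from the sites [i] and [j] and farther from all others. *)
Let B_adjacent j : ~ adjacent p i j -> B j = set0.
Proof.
move=> nadj; rewrite /B; case: eqVneq => // ji.
rewrite -subset0 => v [[v0 vl] _]; apply: nadj; split; first by rewrite eq_sym.
exists ((p i).1 + v.1 / rate j v, (p i).2 + v.2 / rate j v).
pose u : pl := ((rate j v)^-1 * v.1, (rate j v)^-1 * v.2).
have rn : rate j v != 0 by rewrite gt_eqF.
have ru l : rate l u = rate l v / rate j v by rewrite rateZ mulrC.
have key l : l != i -> sqd ((p i).1 + v.1 / rate j v, (p i).2 + v.2 / rate j v) (p l) -
    sqd ((p i).1 + v.1 / rate j v, (p i).2 + v.2 / rate j v) (p i) = D l * (1 - rate l u).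
  move=> li; have Dl : D l != 0 by rewrite gt_eqF ?D_gt0.
  transitivity (D l - 2 * (u.1 * (d l).1 + u.2 * (d l).2)); last by rewrite /rate; field.
  by rewrite /sqd /D /u /=; ring.
split.
  apply/eqP; rewrite eq_sym -subr_eq0 key//; apply/eqP.
  by rewrite ru divff// subrr mulr0.
move=> l li lj; rewrite -subr_gt0 key// mulr_gt0 ?D_gt0// subr_gt0 ru.
by rewrite ltr_pdivrMr// mul1r; exact: vl.
Qed.

Let B_le j : \int[mu]_(v in B j) weight v <= capmass C.
Proof.
rewrite /B; case: eqVneq => [_|ji]; first by rewrite Rintegral_set0 capmass_ge0.
have D0 := D_gt0 ji.
have dn : enorm (d j) ^+ 2 = D j by rewrite sqr_sqrtr// ltW.
have := @cone_halfplane_le R kappa C (K j) (d j) (measurable_K j) (@cone_K j).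
have -> : K j `&` [set v | 1 <= rate j v] =
  K j `&` [set v | enorm (d j) ^+ 2 <= 2 * (v.1 * (d j).1 + v.2 * (d j).2)].
  congr (_ `&` _); rewrite dn; apply/seteqP; split => v /=; rewrite /rate.
    by rewrite ler_pdivlMr// mul1r.
  by rewrite ler_pdivlMr// mul1r.
by apply; rewrite sqrtr_gt0.
Qed.

(** Up to a null set the complement of the cell is the disjoint union of the pieces
[B j]. Only the neighbours in the Delaunay graph contribute, each at most [capmass]. *)
Lemma cell_ge : \int[mu]_v weight v - capmass C * (#|[set j | `[< adjacent p i j >]]%SET|)%:R <=
  \int[mu]_(v in cell i) weight v.
Proof.
have iw := weight_integrable C.
have mc := measurable_cell.
rewrite (integral_splitI iw measurableT mc) setTI setTD.
rewrite lerBlDr lerD2l.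
have [mB eB] := integral_bigsetU iw (enum_uniq I) measurable_B B_disjoint.
have [mL L0] := bigsetU_null (enum ({: I * I})) (fun q => (line_mu q.1 q.2).1) (fun q => (line_mu q.1 q.2).2).
have -> : \int[mu]_(v in ~` cell i) weight v = \sum_(j <- enum I) \int[mu]_(v in B j) weight v.
  rewrite -eB; apply: (integral_ae iw) => //; first exact: measurableC.
    apply/eqP; rewrite -measure_le0 -L0; apply: le_measure; rewrite ?inE//.
      by apply: measurableD => //; exact: measurableC.
    move=> v [vc vB]; rewrite -bigcup_seq.
    have [j0 j0i j01] : exists2 j, j != i & 1 <= rate j v.
      apply: contrapT => H; apply: vc; rewrite cellE => j ji.
      by rewrite ltNge; apply/negP => H1; apply: H; exists j.
    case: (Order.TotalTheory.arg_maxP (fun j => rate j v) (P := fun j => j != i) j0i) => j ji jmax.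
    have j1 : 1 <= rate j v by apply: le_trans j01 (jmax _ j0i).
    have nB : ~ K j v.
      move=> Kj; apply: vB; rewrite -bigcup_seq; exists j; rewrite /= ?mem_enum//.
      by rewrite /B (negbTE ji); split.
    have [l [li lj ll]] : exists l, [/\ l != i, l != j & rate j v <= rate l v].
      apply: contrapT => H; apply: nB; split; first exact: lt_le_trans ltr01 j1.
      by move=> l li lj; rewrite ltNge; apply/negP => ?; apply: H; exists l.
    exists (j, l); rewrite /= ?mem_enum// /line (negbTE ji) (negbTE li) eq_sym (negbTE lj) /=.
    have : rate j v = rate l v by apply/eqP; rewrite eq_le ll; exact: jmax.
    by rewrite !rate_lin => H; rewrite !mulrBl addrACA -opprD H subrr.
  rewrite (_ : _ `\` _ = set0) ?measure0//.
  rewrite -subset0 => v []; rewrite -bigcup_seq => -[j _ /=]; rewrite /B.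
  case: eqVneq => // ji [_ /= j1] nc; apply: nc; rewrite cellE => /(_ j ji).
  by rewrite ltNge j1.
rewrite big_enum /= (bigID (fun j => `[< adjacent p i j >])) /= [X in _ + X]big1 ?addr0; last first.
  by move=> j /asboolPn /B_adjacent ->; rewrite Rintegral_set0.
rewrite mulr_natr -sumr_const.
rewrite [leRHS](eq_bigl (fun j => `[< adjacent p i j >])); last by move=> j; rewrite inE.
by apply: ler_sum => j _; exact: B_le.
Qed.

End one_cell.

(** A cell has on average at most six neighbours, and six caps weigh exactly as much as
the plane and one set-up cost together, by [weight_balance]. *)
Theorem finite_voronoi : 0 <= (#|I|)%:R + \sum_i \int[mu]_(v in cell i) weight v.
Proof.
pose E : {set I * I} := [set e | `[< adjacent p e.1 e.2 >]]%SET.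
have cE : (#|E| = \sum_i #|[set j | `[< adjacent p i j >]]%SET|)%N.
  rewrite -sum1_card (eq_bigl (fun e => `[< adjacent p e.1 e.2 >])); last by move=> e; rewrite inE.
  rewrite -(pair_big_dep xpredT (fun i j => `[< adjacent p i j >]) (fun i j => 1%N)) /=.
  by apply: eq_bigr => i _; rewrite -sum1_card; apply: eq_bigl => j; rewrite inE.
have Eb : (#|E| <= 6 * #|I|)%N.
  by apply: (adjacent_bound p_inj) => e; rewrite inE => /asboolP.
have E0 : (0 : R) = (#|I|)%:R + \sum_(i : I) (\int[mu]_v weight v - 6 * capmass C).
  rewrite sumr_const -[X in X + _]mulr1 -[X in _ + X]mulr_natl -mulrDr addrA.
  by rewrite weight_balance subrr mulr0.
rewrite [leLHS]E0 lerD2l; apply: (@le_trans _ _ (\sum_i (\int[mu]_v weight v - capmass C * (#|[set j | `[< adjacent p i j >]]%SET|)%:R))).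
  rewrite !sumrB lerD2l lerN2 -mulr_sumr -natr_sum -cE sumr_const.
  rewrite -[leRHS]mulr_natr [X in _ <= _ * X](_ : _ = (#|I|)%:R) //.
  have -> : 6 * capmass C * (#|I|)%:R = capmass C * (6 * #|I|)%N%:R by rewrite natrM; ring.
  by apply: ler_wpM2l; [exact: capmass_ge0|rewrite ler_nat].
by apply: ler_sum => i _; exact: cell_ge.
Qed.

End finite_voronoi.

(** * Sites listed in a sequence *)

Section partial_cost.
Context {R : realType} (kappa : R) (C : calibration kappa).
Notation pl := (measurableTypeR R * measurableTypeR R)%type.
Notation mu := (borel_lebesgue2 R).
Notation enorm := (@enorm R).
Notation weight := (@weight R kappa C).

Definition vor (s : seq (R * R)) (q : R * R) : set pl :=
  [set x : pl | forall q', q' \in s -> q' != q -> sqd x q < sqd x q'].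

(** The difference [x - q] written in coordinates, the form in which translations are
known to preserve area. *)
Definition shift_by (q x : R * R) : R * R := (x.1 + (- q).1, x.2 + (- q).2).

Lemma shift_byE q x : shift_by q x = x - q.
Proof. by []. Qed.

Lemma enorm_sqd (x q : R * R) : enorm (x - q) = Num.sqrt (sqd x q).
Proof. by []. Qed.

Lemma sqd_ge0 (x q : R * R) : 0 <= sqd x q.
Proof. by rewrite addr_ge0 ?sqr_ge0. Qed.

Lemma enorm_le_sqd (x q q' : R * R) : (enorm (x - q) <= enorm (x - q')) = (sqd x q <= sqd x q').
Proof. by rewrite !enorm_sqd ler_sqrt ?sqd_ge0. Qed.

Let ptn (s : seq (R * R)) (i : 'I_(size s)) : pl := nth 0 s i.

Let ptn_inj s : uniq s -> injective (@ptn s).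
Proof.
move=> us i j /eqP; rewrite nth_uniq ?ltn_ord// => /eqP ij; exact/val_inj.
Qed.

Lemma vor_cell (s : seq (R * R)) (i : 'I_(size s)) : uniq s ->
  vor s (ptn i) = shift_by (ptn i) @^-1` (cell (@ptn s) i).
Proof.
move=> us.
have key (x q q' : R * R) : sqd x q' - sqd x q = sqd q' q -
    2 * ((shift_by q x).1 * (q'.1 - q.1) + (shift_by q x).2 * (q'.2 - q.2)).
  by rewrite /sqd /shift_by /=; ring.
apply/seteqP; split => x /= vx.
  move=> j ji; rewrite -subr_gt0 -key subr_gt0; apply: vx; first exact: mem_nth.
  by rewrite nth_uniq.
move=> q' q's q'q; rewrite -subr_gt0 key subr_gt0.
have jlt : (index q' s < size s)%N by rewrite index_mem.
have qE : q' = ptn (Ordinal jlt) by rewrite /ptn nth_index.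
rewrite qE; apply: vx; apply: contra q'q => /eqP e.
by rewrite qE e.
Qed.

Lemma preserves_shift q : preserves_area (shift_by q : pl -> pl).
Proof. exact: preserves_area_translation. Qed.

Lemma vor_measurable s q : uniq s -> q \in s -> measurable (vor s q).
Proof.
move=> us qs; have ilt : (index q s < size s)%N by rewrite index_mem.
have qE : q = ptn (Ordinal ilt) by rewrite /ptn nth_index.
rewrite qE vor_cell//; apply: measurable_preimageT; last by apply: measurable_cell; exact: (ptn_inj us).
by have [] := preserves_shift (ptn (Ordinal ilt)).
Qed.

Lemma voronoi_seq s : uniq s ->
  0 <= (size s)%:R + \sum_(q <- s) \int[mu]_(x in vor s q) weight (shift_by q x).
Proof.
move=> us; have := finite_voronoi C (ptn_inj us); rewrite card_ord => H.
apply: le_trans H _; rewrite lerD2l (big_nth 0) big_mkord.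
apply: ler_sum => i _; rewrite -/(ptn i) vor_cell// preserves_Rintegral//.
- exact: preserves_shift.
- exact: weight_integrable.
- by apply: measurable_cell; exact: (ptn_inj us).
Qed.

Lemma vor_disjoint s q q' x : q \in s -> q' \in s -> vor s q x -> vor s q' x -> q = q'.
Proof.
move=> qs qs' vq vq'; apply/eqP; apply: contraT => qq'.
have := vq _ qs'; rewrite eq_sym qq' => /(_ isT) H.
by have := lt_trans H (vq' _ qs qq'); rewrite ltxx.
Qed.

Lemma bisector_null (q q' : R * R) : q != q' ->
  measurable ([set x | sqd x q = sqd x q'] : set pl) /\
  mu ([set x | sqd x q = sqd x q'] : set pl) = 0%E.
Proof.
move=> qq'.
have -> : ([set x | sqd x q = sqd x q'] : set pl) =
  [set x | (q'.1 - q.1) * x.1 + (q'.2 - q.2) * x.2 = (q'.1 ^+ 2 + q'.2 ^+ 2 - q.1 ^+ 2 - q.2 ^+ 2) / 2].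
  by apply/seteqP; split => x /=; rewrite /sqd => H; [apply/eqP; rewrite -subr_eq0; apply/eqP|]; lra.
split; first exact: measurable_line.
apply: line_null; rewrite -negb_and; apply: contra qq' => /andP[].
rewrite !subr_eq0 => /eqP e1 /eqP e2.
by rewrite (surjective_pairing q) (surjective_pairing q') e1 e2.
Qed.

Lemma vor_cover s : uniq s -> s != [::] -> exists2 N : set pl, measurable N /\ mu N = 0%E &
  ~` (\big[setU/set0]_(q <- s) vor s q) `<=` N.
Proof.
move=> us sn.
pose L (e : (R * R) * (R * R)) : set pl := if e.1 == e.2 then set0 else [set x | sqd x e.1 = sqd x e.2].
have LP e : measurable (L e) /\ mu (L e) = 0%E.
  by rewrite /L; case: eqVneq => [_|]; [split => //; exact: measure0|exact: bisector_null].
exists (\big[setU/set0]_(e <- [seq (q, q') | q <- s, q' <- s]) L e).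
  exact: bigsetU_null (fun e => (LP e).1) (fun e => (LP e).2).
move=> x xN; rewrite -bigcup_seq.
have s0 : (0 < size s)%N by rewrite lt0n size_eq0.
case: (Order.TotalTheory.arg_minP (P := xpredT) (fun i : 'I_(size s) => sqd x (nth 0 s i)) (i0 := Ordinal s0) isT) => i _ imin.
set q := nth 0 s i in imin; have qs : q \in s by exact: mem_nth.
have [q' [q's q'q eq]] : exists q', [/\ q' \in s, q' != q & sqd x q' <= sqd x q].
  apply: contrapT => H; apply: xN; rewrite -bigcup_seq; exists q => //= q' q's q'q.
  by rewrite ltNge; apply/negP => ?; apply: H; exists q'.
exists (q, q'); first by rewrite /=; apply/allpairsP; exists (q, q').
rewrite /L /= eq_sym (negbTE q'q) /=; apply/eqP; rewrite eq_le eq andbT.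
have jlt : (index q' s < size s)%N by rewrite index_mem.
by have := imin (Ordinal jlt) isT; rewrite /= nth_index.
Qed.

End partial_cost.

(** * Delivery cost inside a disc *)

(** By the Cauchy-Schwarz inequality, itself the positivity of a squared determinant. *)
Lemma enormD (R : realType) (x y : R * R) : enorm (x + y) <= enorm x + enorm y.
Proof.
have e0 (z : R * R) : 0 <= enorm z by exact: sqrtr_ge0.
have e2 (z : R * R) : enorm z ^+ 2 = z.1 ^+ 2 + z.2 ^+ 2.
  by rewrite sqr_sqrtr ?addr_ge0 ?sqr_ge0.
rewrite -(@ler_sqr R) ?nnegrE ?addr_ge0// sqrrD !e2 /=.
suff H : x.1 * y.1 + x.2 * y.2 <= enorm x * enorm y by move: H; nra.
have := mulr_ge0 (e0 x) (e0 y); set z := enorm x * enorm y => z0.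
have [|n0] := leP (x.1 * y.1 + x.2 * y.2) 0; first by move/le_trans; apply.
rewrite -(@ler_sqr R) ?nnegrE// ?(ltW n0)// /z exprMn !e2.
by have := sqr_ge0 (x.1 * y.2 - x.2 * y.1); nra.
Qed.

Lemma enormN (R : realType) (x : R * R) : enorm (- x) = enorm x.
Proof. by rewrite /enorm /= !sqrrN. Qed.

Lemma integrable_restrictI (R : realType) (f : measurableTypeR R * measurableTypeR R -> R)
  (V B : set (measurableTypeR R * measurableTypeR R)) : measurable V -> measurable B ->
  (borel_lebesgue2 R).-integrable setT (EFin \o (f \_ B)) ->
  (borel_lebesgue2 R).-integrable (V `&` B) (EFin \o f).
Proof.
move=> mV mB /(restrict_integrable mV) H.
apply/(integrable_mkcond _ (measurableI _ _ mV mB)).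
apply: eq_integrable H => // x _; rewrite /= !patchE in_setI.
by case: (x \in V) => //=; case: (x \in B).
Qed.

Section partial_cost.
Context {R : realType} (kappa : R) (C : calibration kappa).
Notation pl := (measurableTypeR R * measurableTypeR R)%type.
Notation mu := (borel_lebesgue2 R).
Notation enorm := (@enorm R).
Notation weight := (@weight R kappa C).
Let r := circ C.
Let m := mid C.
Let k0 : 0 < kappa := kappa_gt0 C.
Let r0 : 0 < r := circ_gt0 C.
Let m0 : 0 < m := lt_le_trans (inrad_gt0 C) (inrad_le_mid C).
Let mr : m < r := mid_lt_circ C.

Definition discarea (t : R) : R := fine (mu (disc t)).

Lemma sum_vor_le (s : seq (R * R)) (f : pl -> R) : uniq s ->
  mu.-integrable setT (EFin \o f) -> (forall x, 0 <= f x) ->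
  \sum_(q <- s) \int[mu]_(x in vor s q) f x <= \int[mu]_x f x /\
  (s != [::] -> \sum_(q <- s) \int[mu]_(x in vor s q) f x = \int[mu]_x f x).
Proof.
move=> us iu f0.
pose W q := if q \in s then vor s q else set0.
have mW q : measurable (W q).
  by rewrite /W; case: ifPn => // qs; exact: vor_measurable.
have dW q q' x : W q x -> W q' x -> q = q'.
  by rewrite /W; case: ifPn => // qs; case: ifPn => // qs'; exact: vor_disjoint.
have eW : \sum_(q <- s) \int[mu]_(x in vor s q) f x = \sum_(q <- s) \int[mu]_(x in W q) f x.
  by apply: eq_big_seq => q qs; rewrite /W qs.
have UW : \big[setU/set0]_(q <- s) W q = \big[setU/set0]_(q <- s) vor s q.
  by apply: eq_big_seq => q qs; rewrite /W qs.
have [mU eU] := integral_bigsetU iu us mW dW.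
rewrite eW -eU; split => [|sn].
  rewrite (integral_splitI iu measurableT mU) setTI lerDl.
  exact: Rintegral_ge0.
have [N [mN N0] cN] := vor_cover us sn.
apply: (integral_ae iu) => //; first by rewrite setDT measure0.
apply/eqP; rewrite -measure_le0 -N0; apply: le_measure; rewrite ?inE//.
  exact: measurableD.
by rewrite setTD UW.
Qed.

Let g q (x : pl) : R := weight (shift_by q x).
Let u q (x : pl) : R := kappa * enorm (shift_by q x).

Let ig q : mu.-integrable setT (EFin \o g q).
Proof. exact: preserves_integrable (preserves_shift q) (weight_integrable C). Qed.

Let one_integrable t : mu.-integrable setT (EFin \o ((cst 1 : pl -> R) \_ (disc t))).
Proof.
apply: (@bounded_integrable _ _ _ t 1); [exact: measurable_disc| |exact: measurable_cst|].
  by move=> x /ltW.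
by move=> x _; rewrite normr1.
Qed.

Lemma shifted_enorm_integrable (q : R * R) (t : R) :
  mu.-integrable setT (EFin \o ((fun x : pl => kappa * enorm (shift_by q x)) \_ (disc t))).
Proof.
apply: (@bounded_integrable _ _ _ t (kappa * (t + enorm q))).
- exact: measurable_disc.
- by move=> x /ltW.
- apply: measurable_funM; first exact: measurable_cst.
  by apply: measurableT_comp; [exact: measurable_enorm|case: (preserves_shift q)].
- move=> x /ltW xt; rewrite normrM gtr0_norm// ger0_norm ?sqrtr_ge0//.
  apply: ler_wpM2l; first exact: ltW.
  by rewrite shift_byE; apply: le_trans (enormD _ _) _; rewrite enormN lerD2r.
Qed.

Let weight_le q x : g q x + kappa * m <= u q x.
Proof.
rewrite /g /u /weight; case: ifPn => [_|]; first by rewrite mulrBr subrK.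
by rewrite -ltNge add0r => H; rewrite ler_pM2l//; exact: ltW (lt_trans mr H).
Qed.

Lemma integral_one t : \int[mu]_x ((cst 1 : pl -> R) \_ (disc t)) x = discarea t.
Proof. by rewrite -Rintegral_mkcond Rintegral_cst ?mul1r//; exact: measurable_disc. Qed.

(** Inside the disc the delivery cost exceeds the weight by at least [kappa * mid] per
unit area. The weight restricted to the disc is compared with the full weight of the
cells, which [voronoi_seq] bounds below. Sites farther than [rho + circ] from the
origin carry no weight in the disc and are dropped; the weight of the others outside
the disc is supported in a ring of bounded width and at most [kappa * circ]. *)
Lemma partial_cost (s : seq (R * R)) (rho : R) : uniq s -> s != [::] ->
  kappa * m * discarea rho - kappa * r * (discarea (rho + 2 * r + 1) - discarea rho) <=
  (size s)%:R + \sum_(q <- s) \int[mu]_(x in vor s q `&` disc rho) (kappa * enorm (x - q)).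
Proof.
move=> us sn.
pose B : set pl := disc rho; pose D : set pl := disc (rho + 2 * r + 1).
have mB : measurable B by exact: measurable_disc.
have mD : measurable D by exact: measurable_disc.
pose s' := [seq q <- s | enorm q <= rho + r].
have us' : uniq s' by exact: filter_uniq.
have s's q : q \in s' -> q \in s by rewrite mem_filter => /andP[].
have BD : B `<=` D by move=> x; rewrite /B /D /disc /= => /lt_le_trans; apply; have := r0; lra.
have step1 q : q \in s -> \int[mu]_(x in vor s q `&` B) g q x +
    kappa * m * \int[mu]_(x in vor s q) ((cst 1 : pl -> R) \_ B) x <=
    \int[mu]_(x in vor s q `&` B) u q x.
  move=> qs; have mV := vor_measurable us qs.
  have mVB : measurable (vor s q `&` B) by exact: measurableI.
  rewrite -Rintegral_mkcondr.
  have i1 : mu.-integrable (vor s q `&` B) (EFin \o (cst 1 : pl -> R)).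
    exact: integrable_restrictI (one_integrable rho).
  have ik : mu.-integrable (vor s q `&` B) (EFin \o (fun x : pl => kappa * m * 1)).
    by have := integrableZl mVB (kappa * m) i1; apply: eq_integrable.
  have iu : mu.-integrable (vor s q `&` B) (EFin \o u q).
    exact: integrable_restrictI (shifted_enorm_integrable q rho).
  have igB := integrableT (ig q) mVB.
  rewrite -(RintegralZl _ mVB i1) -RintegralD//.
  apply: le_Rintegral => //.
    by have := integrableD mVB igB ik; apply: eq_integrable.
  by move=> x _; rewrite mulr1; exact: weight_le.
have far x q : B x -> q \in s -> q \notin s' -> r < enorm (x - q).
  rewrite /B /disc /= => xB qs; rewrite mem_filter qs andbT -ltNge => H.
  have : enorm q <= enorm (x - q) + enorm x.
    have -> : enorm q = enorm ((x - q) + (- x)) by rewrite addrAC subrr add0r enormN.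
    by apply: le_trans (enormD _ _) _; rewrite enormN.
  by move: H xB; lra.
have outside x q : B x -> q \in s -> q \notin s' -> g q x = 0.
  move=> xB qs qs'; rewrite /g /weight shift_byE.
  by have := far x q xB qs qs'; rewrite /r ltNge => /negbTE ->.
(* without the far sites the cells grow, but only by points where the weight vanishes *)
have step3 q : q \in s' -> \int[mu]_(x in vor s q `&` B) g q x =
    \int[mu]_(x in vor s' q `&` B) g q x.
  move=> qs'; rewrite Rintegral_mkcond [RHS]Rintegral_mkcond.
  apply: eq_Rintegral => x _; rewrite !patchE.
  case: ifPn => [/set_mem [vx Bx]|/negP nv].
    by rewrite mem_set//; split => // q' /s's; exact: vx.
  case: ifPn => [/set_mem [vx Bx]|//]; apply/esym.
  rewrite /g /weight shift_byE; case: ifPn => // xr; exfalso.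
  apply: nv; apply/mem_set; split => // q' q's q'q.
  have [q's'|q's'] := boolP (q' \in s'); first exact: vx.
  rewrite ltNge -enorm_le_sqd -ltNge; apply: le_lt_trans xr _; exact: far.
have step3' : \sum_(q <- s) \int[mu]_(x in vor s q `&` B) g q x =
    \sum_(q <- s') \int[mu]_(x in vor s' q `&` B) g q x.
  rewrite [RHS]big_filter [RHS]big_mkcond; apply: eq_big_seq => q qs.
  case: ifPn => H; first by rewrite step3// mem_filter H.
  rewrite -[RHS](mul0r (fine (mu (vor s q `&` B)))) -Rintegral_cst; last first.
    by apply: measurableI => //; exact: vor_measurable.
  apply: eq_Rintegral => x /set_mem [_ Bx]; apply: outside => //.
  by rewrite mem_filter negb_and H.
(* outside the disc the weight is at most [kappa * r], and vanishes outside [D] *)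
have step5 q : q \in s' -> \int[mu]_(x in vor s' q) g q x -
    kappa * r * (\int[mu]_(x in vor s' q) ((cst 1 : pl -> R) \_ D) x -
       \int[mu]_(x in vor s' q) ((cst 1 : pl -> R) \_ B) x) <=
    \int[mu]_(x in vor s' q `&` B) g q x.
  move=> qs'; have mV := vor_measurable us' qs'.
  have i1D := integrableT (one_integrable (rho + 2 * r + 1)) mV.
  have i1B := integrableT (one_integrable rho) mV.
  have iDB : mu.-integrable (vor s' q) (EFin \o (fun x => ((cst 1 : pl -> R) \_ D) x - ((cst 1 : pl -> R) \_ B) x)).
    by have := integrableB mV i1D i1B; apply: eq_integrable.
  have ikDB : mu.-integrable (vor s' q) (EFin \o (fun x => kappa * r * (((cst 1 : pl -> R) \_ D) x - ((cst 1 : pl -> R) \_ B) x))).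
    by have := integrableZl mV (kappa * r) iDB; apply: eq_integrable.
  have igV := integrableT (ig q) mV.
  have igB := integrableT (restrict_integrable mB (ig q)) mV.
  rewrite -RintegralB// -(RintegralZl _ mV iDB) -RintegralB// [leRHS]Rintegral_mkcondr.
  apply: le_Rintegral => //.
    by have := integrableB mV igV ikDB; apply: eq_integrable.
  move=> x _; rewrite !patchE.
  have [xB|xB] := boolP (x \in B).
    by rewrite (mem_set (BD _ (set_mem xB))) subrr mulr0 subr0.
  rewrite subr0 subr_le0 /g /weight shift_byE.
  have kr0 : 0 <= kappa * r by rewrite mulr_ge0// ltW.
  case: ifPn => [xr|_]; last by case: ifP => _; rewrite ?mulr1 ?mulr0.
  have -> : x \in D.
    apply/mem_set; rewrite /D /disc /=.
    have : enorm x <= enorm (x - q) + enorm q.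
      by rewrite -[X in enorm X](subrK q); exact: enormD.
    have : enorm q <= rho + r by move: qs'; rewrite mem_filter => /andP[].
    by move: xr; rewrite -/r; lra.
  rewrite mulr1 ler_pM2l// lerBlDr (le_trans xr)// lerDl ltW//.
pose f (x : pl) : R := ((cst 1 : pl -> R) \_ D) x - ((cst 1 : pl -> R) \_ B) x.
have iD := one_integrable (rho + 2 * r + 1); have iB := one_integrable rho.
have iF : mu.-integrable setT (EFin \o f).
  by have := integrableB measurableT iD iB; apply: eq_integrable.
have f0 x : 0 <= f x.
  rewrite /f !patchE; have [xB|_] := boolP (x \in B).
    by rewrite (mem_set (BD _ (set_mem xB))) subrr.
  by case: ifP => _; rewrite subr0.
have [S2 _] := sum_vor_le us' iF f0.
have eF : \int[mu]_x f x = discarea (rho + 2 * r + 1) - discarea rho.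
  by rewrite RintegralB// !integral_one.
have S2' : \sum_(q <- s') (\int[mu]_(x in vor s' q) ((cst 1 : pl -> R) \_ D) x -
       \int[mu]_(x in vor s' q) ((cst 1 : pl -> R) \_ B) x) <=
    discarea (rho + 2 * r + 1) - discarea rho.
  rewrite -eF; apply: le_trans S2; rewrite le_eqVlt; apply/orP; left; apply/eqP.
  apply: eq_big_seq => q qs'; have mV := vor_measurable us' qs'.
  by rewrite RintegralB//; exact: integrableT.
have [_ /(_ sn) S1] := sum_vor_le us iB (fun x => ltac:(by rewrite patchE; case: ifP)).
rewrite integral_one in S1.
have V := voronoi_seq C us'.
have sz : ((size s')%:R : R) <= (size s)%:R by rewrite ler_nat size_filter count_size.
have T1 : \sum_(q <- s) \int[mu]_(x in vor s q `&` B) g q x + kappa * m * discarea rho <=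
    \sum_(q <- s) \int[mu]_(x in vor s q `&` B) u q x.
  rewrite -S1 mulr_sumr -big_split /= big_seq [leRHS]big_seq.
  by apply: ler_sum => q; exact: step1.
have T5 : \sum_(q <- s') \int[mu]_(x in vor s' q) g q x - kappa * r *
    \sum_(q <- s') (\int[mu]_(x in vor s' q) ((cst 1 : pl -> R) \_ D) x -
       \int[mu]_(x in vor s' q) ((cst 1 : pl -> R) \_ B) x) <=
   \sum_(q <- s') \int[mu]_(x in vor s' q `&` B) g q x.
  rewrite mulr_sumr -sumrB big_seq [leRHS]big_seq.
  by apply: ler_sum => q; exact: step5.
have kr : kappa * r * \sum_(q <- s') (\int[mu]_(x in vor s' q) ((cst 1 : pl -> R) \_ D) x -
       \int[mu]_(x in vor s' q) ((cst 1 : pl -> R) \_ B) x) <=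
    kappa * r * (discarea (rho + 2 * r + 1) - discarea rho).
  by apply: ler_wpM2l => //; rewrite mulr_ge0// ltW.
rewrite step3' in T1.
have -> : \sum_(q <- s) \int[mu]_(x in vor s q `&` disc rho) (kappa * enorm (x - q)) =
   \sum_(q <- s) \int[mu]_(x in vor s q `&` B) u q x by [].
by move: V T1 T5 kr sz; rewrite -/g; lra.
Qed.

Lemma discarea_fin (t : R) : mu (disc t) \is a fin_num.
Proof. by rewrite ge0_fin_numE ?area_disc_lty. Qed.

Lemma discarea_ge0 (t : R) : 0 <= discarea t.
Proof. exact: fine_ge0. Qed.

Lemma discareaE (t : R) : 0 < t -> discarea t = t ^+ 2 * discarea 1.
Proof.
move=> t0; rewrite /discarea -(area_scale t0 (@measurable_disc R t)).
have -> : (fun x : pl => (t * x.1, t * x.2)%R) @^-1` (disc t) = disc 1.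
  apply/seteqP; split => x; rewrite /disc /= (enorm_scale _ (ltW t0)).
    by rewrite -{2}[t]mulr1 ltr_pM2l.
  by rewrite -{2}[t]mulr1 ltr_pM2l.
by rewrite fineM// discarea_fin.
Qed.

Lemma discarea1_gt0 : 0 < discarea 1.
Proof.
have mI : measurable (`[0, 2^-1]%classic : set (measurableTypeR R)) by [].
have sub : `[0, 2^-1]%classic `*` `[0, 2^-1]%classic `<=` (disc 1 : set pl).
  move=> x [] /=; rewrite !in_itv /= => /andP[a0 a1] /andP[b0 b1].
  rewrite /disc /= /Defs.enorm -[ltRHS]sqrtr1 ltr_sqrt//.
  have ha : x.1 ^+ 2 <= 2^-1 ^+ 2 by rewrite ler_sqr ?nnegrE.
  have hb : x.2 ^+ 2 <= 2^-1 ^+ 2 by rewrite ler_sqr ?nnegrE.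
  by apply: le_lt_trans (lerD ha hb) _; lra.
apply: (@lt_le_trans _ _ (fine (mu (`[0, 2^-1]%classic `*` `[0, 2^-1]%classic)))).
  rewrite [X in fine X](@product_measure1E _ _ _ _ R (@lebesgue_measure R) (@lebesgue_measure R))//=.
  by rewrite lebesgue_measure_itv/= lte_fin invr_gt0 ltr0n /= subr0 mulr_gt0.
apply: fine_le.
- rewrite ge0_fin_numE ?measure_ge0//; apply: le_lt_trans (area_disc_lty 1).
  by apply: le_measure; rewrite ?inE//; [exact: measurableX|exact: measurable_disc].
- exact: discarea_fin.
- by apply: le_measure; rewrite ?inE//; [exact: measurableX|exact: measurable_disc].
Qed.

End partial_cost.

(** * The lower bound for every design *)

Lemma le_limn_einf_near (R : realType) (u : (\bar R)^nat) (c : \bar R) :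
  (\forall n \near \oo, (c <= u n)%E) -> (c <= limn_einf u)%E.
Proof.
move=> [N _ uN]; rewrite limn_einf_lim (cvg_lim _ (@cvg_einfs_sup _ u))//.
apply: (@le_trans _ _ (einfs u N)); last by apply: ereal_sup_ubound; exists N.
by apply/ereal_infP => _ [k /= Nk <-]; exact: uN.
Qed.

Section lower_bound.
Context {R : realType} (kappa : R) (C : calibration kappa).
Notation pl := (measurableTypeR R * measurableTypeR R)%type.
Notation mu := (borel_lebesgue2 R).
Notation enorm := (@enorm R).
Let r := circ C.
Let m := mid C.
Let k0 : 0 < kappa := kappa_gt0 C.

Lemma batch_seq (D : design R) (N : nat) : (0 < N)%N ->
  exists s : seq (R * R), [/\ uniq s, batch D N = [set` s] & size s = N].
Proof.
move=> N0; have c := batch_card D N0.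
have fin : finite_set (batch D N) by apply/finite_setP; exists N.
exists (finmap.enum_fset (fset_set (batch D N))); split.
- exact: finmap.fset_uniq.
- by rewrite -{1}(fset_setK fin).
- exact: card_fset_set.
Qed.

(** Almost every point of the disc lies in a region of the batch, and a point of the
open cell of [q] can only lie in the region of [q]. *)
Lemma region_integral_ge (D : design R) (N : nat) (s : seq (R * R)) (rho : R) (q : R * R) :
  (0 < N)%N -> uniq s -> batch D N = [set` s] -> q \in s ->
  area (disc rho `\` \bigcup_(p in batch D N) region D p) = 0%E ->
  (\int[mu]_(x in vor s q `&` disc rho) (enorm (x - q)%R)%:E <=
   \int[lebesgue2]_(x in region D q) (enorm (x - q))%:E)%E.
Proof.
move=> N0 us bE qs a0.
have Xs p : p \in s -> facilities D p.
  by move=> ps; apply: (batch_sub N0); rewrite bE.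
pose V : set pl := vor s q `&` disc rho.
have mV : measurable V by apply: measurableI; [exact: vor_measurable|exact: measurable_disc].
pose e (x : pl) : \bar R := (enorm (shift_by q x))%:E.
have me : measurable_fun setT e.
  apply/measurable_EFinP; apply: measurableT_comp; first exact: measurable_enorm.
  by case: (preserves_shift q).
have me' : measurable_fun setT (e : lebesgue_plane R -> \bar R).
  exact: (measurableT_comp me (@measurable_completion R)).
have e0 x : (0 <= e x)%E by rewrite lee_fin sqrtr_ge0.
rewrite -[leLHS](ge0_integral_completion mV me e0).
pose Z : set (lebesgue_plane R) := disc rho `\` \bigcup_(p in batch D N) region D p.
have mreg p : p \in s -> measurable (region D p : set (lebesgue_plane R)).
  by move=> ps; exact/region_measurable/Xs.
have mVl : measurable (V : set (lebesgue_plane R)) by exact: borel_lebesgue_measurable.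
have mZ : measurable Z.
  apply: measurableD; first by apply: borel_lebesgue_measurable; exact: measurable_disc.
  by rewrite bE; apply: fin_bigcup_measurable => // p /= ps; exact: mreg.
rewrite (@ge0_negligible_integral _ _ _ (@lebesgue2 R) _ Z)//; last exact: measurable_funTS.
apply: ge0_subset_integral => //.
- exact: measurableD.
- exact: mreg.
- exact: measurable_funTS.
move=> x [[vx Bx] nZ].
have : (\bigcup_(p in batch D N) region D p) x by apply: contrapT => H; apply: nZ.
rewrite bE => -[p /= ps rx]; have [->//|pq] := eqVneq q p.
have := region_nearest (Xs _ ps) (Xs _ qs) rx.
by rewrite enorm_le_sqd leNgt vx// eq_sym.
Qed.

Lemma batch_cost_ge (D : design R) (N : nat) (rho : R) : (0 < N)%N ->
  area (disc rho `\` \bigcup_(p in batch D N) region D p) = 0%E ->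
  ((kappa * m * discarea rho - kappa * r * (discarea (rho + 2 * r + 1) - discarea rho))%:E <=
   \sum_(p \in batch D N)
      (1 + kappa%:E * \int[lebesgue2]_(x in region D p) (enorm (x - p))%:E))%E.
Proof.
move=> N0 a0; have [s [us bE sz]] := batch_seq D N0.
have sn : s != [::] by rewrite -size_eq0 sz -lt0n.
apply: le_trans (_ : _ <= ((size s)%:R + \sum_(q <- s) \int[mu]_(x in vor s q `&` disc rho) (kappa * enorm (x - q)))%:E)%E _.
  by rewrite lee_fin; exact: partial_cost.
rewrite bE -fsbig_seq// big_split /= EFinD.
have -> : (\sum_(q <- s) 1 = ((size s)%:R)%:E :> \bar R)%E.
  by rewrite sumEFin big_const_seq count_predT iter_addr_0.
rewrite leeD2l// -sumEFin big_seq [leRHS]big_seq; apply: lee_sum => q qs.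
have mV : measurable (vor s q `&` disc rho).
  by apply: measurableI; [exact: vor_measurable|exact: measurable_disc].
apply: le_trans (_ : _ <= kappa%:E * \int[mu]_(x in vor s q `&` disc rho) (enorm (x - q)%R)%:E)%E _; last first.
  by apply: lee_wpmul2l; [rewrite lee_fin ltW|exact: (region_integral_ge N0)].
have mef : measurable_fun setT (fun x : pl => (enorm (x - q)%R)%:E).
  apply/measurable_EFinP; apply: (measurableT_comp measurable_enorm).
  by case: (preserves_shift q).
rewrite -ge0_integralZl//=; last 3 first.
- exact: measurable_funTS.
- by move=> x _; rewrite lee_fin sqrtr_ge0.
- by rewrite lee_fin ltW.
have iu : mu.-integrable (vor s q `&` disc rho) (EFin \o (fun x : pl => kappa * enorm (x - q))).
  apply: integrable_restrictI; [exact: vor_measurable|exact: measurable_disc|].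
  exact: shifted_enorm_integrable.
by rewrite /Rintegral fineK//; exact: integrable_fin_num.
Qed.

Lemma area_bigsetU (D : design R) (s : seq (R * R)) : uniq s ->
  (forall p, p \in s -> facilities D p) ->
  measurable ((\big[setU/set0]_(p <- s) region D p) : set (lebesgue_plane R)) /\
  area (\big[setU/set0]_(p <- s) region D p) = (\sum_(p <- s) fine (area (region D p)))%:E.
Proof.
elim: s => [|p s IH] /=; first by move=> _ _; rewrite !big_nil; split => //; exact: measure0.
move=> /andP[ps us] Fs; have Fp : facilities D p by apply: Fs; rewrite mem_head.
have [|ms es] := IH us; first by move=> q qs; apply: Fs; rewrite in_cons qs orbT.
have mp : measurable (region D p : set (lebesgue_plane R)) by exact: region_measurable.
rewrite !big_cons; split; first exact: measurableU.
set S : set (lebesgue_plane R) := \big[setU/set0]_(q <- s) region D q in ms es *.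
have I0 : lebesgue2 (region D p `&` S) = 0%E.
  rewrite /S -bigcup_seq setI_bigcupr.
  have mI q : q \in s -> measurable (region D p `&` region D q : set (lebesgue_plane R)).
    move=> qs; apply: measurableI => //; apply: region_measurable; apply: Fs.
    by rewrite in_cons qs orbT.
  have : measurable (\bigcup_(q in [set` s]) (region D p `&` region D q) : set (lebesgue_plane R)) /\
     lebesgue2 (\bigcup_(q in [set` s]) (region D p `&` region D q)) = 0%E.
    move: ps Fs mI; clear -Fp; elim: s => [|q s IH] ps Fs mI.
      by rewrite bigcup_seq big_nil; split => //; exact: measure0.
    rewrite bigcup_seq big_cons -bigcup_seq.
    have [|||mJ eJ] := IH.
    - by move: ps; rewrite in_cons negb_or => /andP[].
    - by move=> x; rewrite in_cons => /orP[xp|xs]; apply: Fs; rewrite !in_cons ?xp ?xs ?orbT.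
    - by move=> x xs; apply: mI; rewrite in_cons xs orbT.
    split; first by apply: measurableU => //; apply: mI; rewrite mem_head.
    rewrite measureU0//; last by apply: mI; rewrite mem_head.
    apply: region_overlap => //; first by apply: Fs; rewrite !in_cons eqxx orbT.
    by move=> pq; move: ps; rewrite pq mem_head.
  by move=> [_ H]; exact: H.
rewrite EFinD -es fineK; last by rewrite ge0_fin_numE ?measure_ge0// region_area_lty.
rewrite -[LHS]/(lebesgue2 (region D p `|` S)) [LHS]measureUfinl ?region_area_lty//.
by rewrite [X in (_ - X)%E](_ : _ = 0%E) ?sube0.
Qed.

Lemma batch_area (D : design R) (N : nat) : (0 < N)%N ->
  let U := \bigcup_(p in batch D N) region D p in
  let a := \sum_(p \in batch D N) fine (area (region D p)) in
  [/\ measurable (U : set (lebesgue_plane R)), area U = a%:E & 0 < a].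
Proof.
move=> N0 U a; have [s [us bE sz]] := batch_seq D N0.
have Fs p : p \in s -> facilities D p by move=> ps; apply: (batch_sub N0); rewrite bE.
have [mU eU] := area_bigsetU us Fs.
rewrite /U /a bE bigcup_seq -fsbig_seq//; split => //.
case: s us {bE} sz Fs {mU eU} => [_ sz|p s us sz Fs]; first by move: N0; rewrite -sz.
have pos q : q \in p :: s -> 0 < fine (area (region D q)).
  by move=> qs; apply: fine_gt0; rewrite region_area_gt0 ?region_area_lty//; exact: Fs.
rewrite big_cons ltr_pwDl//; first by apply: pos; rewrite mem_head.
by rewrite big_seq sumr_ge0// => q qs; apply/ltW/pos; rewrite in_cons qs orbT.
Qed.

(** In [batch_cost_ge] the ring has relative area O(1 / rho), and by exhaustion the
batch covers only a vanishing proportion beyond the disc. *)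
Lemma cost_ge (f : R) (D : design R) : 0 < f -> ((f * (kappa * m))%:E <= cost f kappa D)%E.
Proof.
move=> f0; have [rho [rhoy B0 ratio]] := batch_exhaust D.
have r0 : 0 < r := circ_gt0 C.
have m0 : 0 < m by exact: lt_le_trans (inrad_gt0 C) (inrad_le_mid C).
apply/lee_addgt0Pr => eps0 eps0_gt0.
(* the cap on [eps] keeps the factor [X] below nonnegative; half of [eps] pays for the
   ring and half for the area of the batch beyond the disc *)
pose eps : R := Num.min eps0 (2 * (f * kappa * m)).
have e0 : 0 < eps by rewrite /eps lt_min eps0_gt0 !mulr_gt0.
have eps_small : eps <= 2 * (f * kappa * m) by rewrite /eps ge_min lexx orbT.
apply: (@le_trans _ _ (cost f kappa D + eps%:E)%E); last first.
  by rewrite leeD2l// lee_fin /eps ge_min lexx.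
rewrite -leeBlDr// -EFinB; apply: le_limn_einf_near.
pose c := 2 * r + 1; have c0 : 0 < c by rewrite /c; lra.
pose d1 := eps / (2 * f * kappa * m).
have d10 : 0 < d1 by rewrite divr_gt0// !mulr_gt0.
pose K := Num.max 1 ((2 * c + c ^+ 2) * (2 * f * kappa * r) / eps).
have near_rho : \forall N \near \oo, K <= rho N.
  by move/cvgryPge : rhoy; apply.
have near_ratio : \forall N \near \oo, fine (area (\bigcup_(p in batch D N) region D p `\` disc (rho N)))
                  / fine (area (\bigcup_(p in batch D N) region D p)) <= d1.
  move/cvgr0Pnorm_le : ratio => /(_ d1 d10); apply: filterS => N; exact: le_trans (ler_norm _).
have near_pos : \forall N \near \oo, (0 < N)%N by exists 1%N.
near=> N.
have N0 : (0 < N)%N by near: N.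
have a0N : area (disc (rho N) `\` \bigcup_(p in batch D N) region D p) = 0%E by near: N.
have rhoK : K <= rho N by near: N.
have eN : fine (area (\bigcup_(p in batch D N) region D p `\` disc (rho N)))
                  / fine (area (\bigcup_(p in batch D N) region D p)) <= d1 by near: N.
pose U := \bigcup_(p in batch D N) region D p.
pose a := \sum_(p \in batch D N) fine (area (region D p)).
have [mU aU a0] : [/\ measurable (U : set (lebesgue_plane R)), area U = a%:E & 0 < a]
  by exact: batch_area.
rewrite -/U in a0N eN; rewrite -/a.
have rho1 : 1 <= rho N by apply: le_trans rhoK; rewrite /K le_max lexx.
have rhoK2 : (2 * c + c ^+ 2) * (2 * f * kappa * r) / eps <= rho N.
  by apply: le_trans rhoK; rewrite /K le_max lexx orbT.
have rho0 : 0 < rho N by exact: lt_le_trans rho1.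
rewrite aU /= ler_pdivrMr// in eN.
apply: le_trans (_ : _ <= (f / a)%:E * (kappa * m * discarea (rho N) - kappa * r * (discarea (rho N + 2 * r + 1) - discarea (rho N)))%:E)%E _; last first.
  by apply: lee_wpmul2l; [rewrite lee_fin divr_ge0// ltW|exact: batch_cost_ge].
rewrite -EFinM lee_fin.
have mB : measurable (disc (rho N) : set (lebesgue_plane R)).
  by apply: borel_lebesgue_measurable; exact: measurable_disc.
have aB : a <= discarea (rho N) + d1 * a.
  apply: le_trans (_ : _ <= discarea (rho N) + fine (area (U `\` disc (rho N)))) _; last by rewrite lerD2l.
  have fD : area (U `\` disc (rho N)) \is a fin_num.
    rewrite ge0_fin_numE ?measure_ge0//; apply: (@le_lt_trans _ _ (area U)); last by rewrite aU ltry.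
    by apply: le_measure; rewrite ?inE//; exact: measurableD.
  rewrite -lee_fin EFinD [X in (_ <= _ + X)%E]fineK// -aU /discarea fineK ?discarea_fin//.
  rewrite -(area_borel (@measurable_disc R (rho N))).
  apply: (@le_trans _ _ (lebesgue2 ((disc (rho N) : set (lebesgue_plane R)) `|` (U `\` disc (rho N))))).
    apply: le_measure; rewrite ?inE//; first by apply: measurableU => //; exact: measurableD.
    by move=> x Ux; have [xB|xB] := pselect (disc (rho N) x); [left|right].
  by apply: measureU2 => //; exact: measurableD.
pose q : R := discarea (1 : R); have q0 : 0 < q by exact: discarea1_gt0.
have eA : discarea (rho N) = (rho N) ^+ 2 * q by exact: discareaE.
have eA2 : discarea (rho N + 2 * r + 1) = (rho N + c) ^+ 2 * q.
  by rewrite -addrA -/c; apply: discareaE; exact: addr_gt0.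
set A := discarea (rho N) in aB eA *; set rN := rho N in eA eA2 rho1 rho0 rhoK2 *.
have A0 : 0 <= A by exact: discarea_ge0.
(* the relative area of the annulus is at most [(2 c + c^2) / rho] *)
have annulus : discarea (rN + 2 * r + 1) - A <= (2 * c + c ^+ 2) / rN * A.
  rewrite eA2 eA; have -> : (2 * c + c ^+ 2) / rN * (rN ^+ 2 * q) = (2 * c * rN + c ^+ 2 * rN) * q.
    by field; rewrite gt_eqF.
  rewrite -mulrBl; apply: ler_wpM2r; first exact: ltW.
  have : c ^+ 2 <= c ^+ 2 * rN by rewrite -[leLHS]mulr1 ler_pM2l// exprn_gt0.
  by rewrite (_ : (rN + c) ^+ 2 - rN ^+ 2 = 2 * c * rN + c ^+ 2) ?lerD2l; [exact|ring].
have fkr : 0 < 2 * f * kappa * r by rewrite !mulr_gt0.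
have annulus2 : kappa * r * (discarea (rN + 2 * r + 1) - A) <= eps / (2 * f) * A.
  apply: (@le_trans _ _ (kappa * r * ((2 * c + c ^+ 2) / rN * A))).
    by apply: ler_wpM2l => //; rewrite mulr_ge0// ltW.
  rewrite mulrA; apply: ler_wpM2r => //.
  have H : (2 * c + c ^+ 2) * (2 * f * kappa * r) <= eps * rN by move: rhoK2; rewrite ler_pdivrMr// [rN * eps]mulrC.
  rewrite ler_pdivlMr ?mulr_gt0//.
  have -> : kappa * r * ((2 * c + c ^+ 2) / rN) * (2 * f) = (2 * c + c ^+ 2) * (2 * f * kappa * r) / rN.
    by field; rewrite gt_eqF.
  by rewrite ler_pdivrMr.
have aA : (1 - d1) * a <= A by move: aB; lra.
pose X := kappa * m - eps / (2 * f).
have X0 : 0 <= X.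
  rewrite subr_ge0 ler_pdivrMr ?mulr_gt0//; move: eps_small; lra.
have Xle : X <= kappa * m by rewrite /X lerBlDr lerDl divr_ge0 ?mulr_ge0// ltW.
apply: (@le_trans _ _ (f / a * (X * A))); last first.
  apply: ler_wpM2l; first by rewrite divr_ge0// ltW.
  by rewrite /X mulrBl; move: annulus2; lra.
apply: (@le_trans _ _ (f / a * (X * ((1 - d1) * a)))); last first.
  apply: ler_wpM2l; first by rewrite divr_ge0// ltW.
  exact: ler_wpM2l.
have -> : f / a * (X * ((1 - d1) * a)) = f * X - f * (d1 * X).
  by field; rewrite gt_eqF.
have -> : f * X = f * (kappa * m) - eps / 2 by rewrite /X; field; rewrite gt_eqF.
have : f * (d1 * X) <= eps / 2.
  apply: (@le_trans _ _ (f * (d1 * (kappa * m)))).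
    by apply: ler_wpM2l; [exact: ltW|apply: ler_wpM2l => //; exact: ltW].
  rewrite /d1 le_eqVlt; apply/orP; left; apply/eqP; field.
  by rewrite !gt_eqF.
lra.
Unshelve. all: by end_near.
Qed.

End lower_bound.

(** * The hexagon and its lattice *)

Section honeycomb.
Context {R : realType} (kappa : R) (C : calibration kappa).
Notation pl := (measurableTypeR R * measurableTypeR R)%type.
Notation mu := (borel_lebesgue2 R).
Notation enorm := (@enorm R).
Let r := circ C.
Let h := inrad C.
Let m := mid C.
Let w : R := Num.sqrt 3.
Let k0 : 0 < kappa := kappa_gt0 C.
Let h0 : 0 < h := inrad_gt0 C.
Let r0 : 0 < r := circ_gt0 C.
Let r2 : r ^+ 2 = 4 / 3 * h ^+ 2 := circ_sqr C.
Let w0 : 0 < w. Proof. by rewrite sqrtr_gt0. Qed.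
Let w2 : w * w = 3. Proof. by rewrite -expr2 sqr_sqrtr. Qed.

Definition hexagon : set pl :=
  [set x | [/\ `|x.1| <= h, `|x.1 + w * x.2| <= 2 * h & `|x.1 - w * x.2| <= 2 * h]].

Lemma hexagonP (x : R * R) : hexagon x <->
  [/\ - h <= x.1, x.1 <= h, - (2 * h) <= x.1 + w * x.2, x.1 + w * x.2 <= 2 * h &
   (- (2 * h) <= x.1 - w * x.2) && (x.1 - w * x.2 <= 2 * h)].
Proof.
split; rewrite /hexagon /= !ler_norml.
  by move=> [/andP[A B] /andP[D E] F].
by move=> [A B D E F]; rewrite A B D E F.
Qed.

Lemma measurable_hexagon : measurable hexagon.
Proof.
rewrite (_ : hexagon = [set x | 1 * x.1 + 0 * x.2 <= h] `&` [set x | (- 1) * x.1 + 0 * x.2 <= h]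
  `&` [set x | 1 * x.1 + w * x.2 <= 2 * h] `&` [set x | (- 1) * x.1 + (- w) * x.2 <= 2 * h]
  `&` [set x | 1 * x.1 + (- w) * x.2 <= 2 * h] `&` [set x | (- 1) * x.1 + w * x.2 <= 2 * h]).
  by do ! apply: measurableI; exact: measurable_halfplane.
apply/seteqP; split => x.
  by move/hexagonP => [A B D E /andP[F G]]; do ! split => /=; lra.
move=> [[[[[/= A B] D] E] F] G]; apply/hexagonP; split; rewrite /=; try lra.
Qed.

Lemma hexagon_sixth (x : pl) : hexagon (sixth x) <-> hexagon x.
Proof.
have e1 : (sixth x).1 = (x.1 - w * x.2) / 2 by rewrite /sixth /rot /= -/w; field.
have e2 : w * (sixth x).2 = (3 * x.1 + w * x.2) / 2.
  by rewrite /sixth /rot /= -/w mulrDr !mulrA w2; field.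
split => /hexagonP.
  rewrite e1 e2 => -[A B D E /andP[F G]]; apply/hexagonP.
  by split; try lra; apply/andP; split; lra.
move=> [A B D E /andP[F G]]; apply/hexagonP.
by rewrite e1 e2; split; try lra; apply/andP; split; lra.
Qed.

Lemma hexagon_sextant : hexagon `&` sextant = triangle C.
Proof.
apply/seteqP; split => x.
  by move=> [/hexagonP[A B D E /andP[F G]] s]; split.
move=> [s /= xh]; split => //; move: s => /= /andP[A B]; rewrite -/w in A B.
by apply/hexagonP; split; rewrite -/h in xh *; try lra; apply/andP; split; lra.
Qed.

Lemma hexagon_bounded (x : R * R) : hexagon x -> enorm x <= r.
Proof.
move/hexagonP => [A B D E /andP[F G]].
rewrite -(@ler_sqr R) ?nnegrE ?sqrtr_ge0 ?(ltW r0)//.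
rewrite sqr_sqrtr ?addr_ge0 ?sqr_ge0// r2.
have : (w * x.2) ^+ 2 = 3 * x.2 ^+ 2 by rewrite exprMn expr2 w2.
move: (w * x.2) D E F G => b D E F G Hb.
suff : 3 * x.1 ^+ 2 + b ^+ 2 <= 4 * h ^+ 2 by lra.
have [a0|a0] := leP 0 x.1; have [b0|b0] := leP 0 b.
- have : 0 <= (2 * h - x.1 - b) by lra.
  nra.
- have : 0 <= (2 * h - x.1 + b) by lra.
  nra.
- have : 0 <= (2 * h + x.1 - b) by lra.
  nra.
have : 0 <= (2 * h + x.1 + b) by lra.
nra.
Qed.

Lemma integral_hexagon (f : pl -> R) (M : R) : measurable_fun setT f ->
  (forall x, f (sixth x) = f x) -> (forall x, hexagon x -> `|f x| <= M) ->
  mu.-integrable hexagon (EFin \o f) /\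
  \int[mu]_(x in hexagon) f x = 6 * \int[mu]_(x in triangle C) f x.
Proof.
move=> mf fs fM.
have iH : mu.-integrable setT (EFin \o (f \_ hexagon)).
  exact: bounded_integrable measurable_hexagon hexagon_bounded mf fM.
split.
  have := integrable_restrictI measurableT measurable_hexagon iH.
  by rewrite setTI.
rewrite Rintegral_mkcond integral_sextants//.
  by rewrite -Rintegral_mkcondr setIC hexagon_sextant.
move=> x; rewrite !patchE fs; congr (if _ then _ else _).
by apply/idP/idP => /set_mem/hexagon_sixth H; exact/mem_set.
Qed.

Lemma hexagon_enorm : kappa * \int[mu]_(x in hexagon) enorm x = 2.
Proof.
have [|||_ ->] := @integral_hexagon enorm r.
- exact: measurable_enorm.
- by move=> x; rewrite enorm_rot// sixth_unit.
- by move=> x /hexagon_bounded; rewrite ger0_norm ?sqrtr_ge0.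
by rewrite mulrCA triangle_enorm; field.
Qed.

Lemma hexagon_area : kappa * m * fine (mu hexagon) = 3.
Proof.
have := @integral_hexagon (cst 1) 1 (measurable_cst _) (fun=> erefl) (fun _ _ => ltac:(by rewrite normr1)).
move=> [_]; rewrite Rintegral_cst; last exact: measurable_hexagon.
by rewrite mul1r => ->; rewrite mulrCA triangle_area; field.
Qed.

Lemma hexagon_area_fin : mu hexagon \is a fin_num.
Proof.
rewrite ge0_fin_numE ?measure_ge0//; apply: le_lt_trans (area_disc_lty (r + 1)).
apply: le_measure; rewrite ?inE//; [exact: measurable_hexagon|exact: measurable_disc|].
by move=> x /hexagon_bounded xr; rewrite /disc /= (le_lt_trans xr)// ltrDl.
Qed.

(** The lattice generated by (2 h, 0) and (h, sqrt 3 h), the centres of the tiling by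
copies of the hexagon. *)
Definition lattice (z : int * int) : R * R :=
  (h * (2 * z.1%:~R + z.2%:~R), h * w * z.2%:~R).

Let int_sqr (i : int) : `|i%:~R| <= i%:~R ^+ 2 :> R.
Proof.
have [->|i0] := eqVneq i 0; first by rewrite normr0 expr0n.
rewrite -real_normK ?num_real// -[leLHS]mulr1 expr2 ler_wpM2l//.
by rewrite -intr_norm ler1z -gtz0_ge1 normr_gt0.
Qed.

(** The hexagon is contained in the Voronoi cell of the origin. Its constraints bound
2 v.1, v.1 + sqrt 3 v.2 and v.1 - sqrt 3 v.2 by 2 h in absolute value, so the scalar
product of [v] with the lattice point of coordinates [i], [j] is at most a multiple of
|i| + |j| + |i + j|, and |n| <= n^2 for integers. *)
Lemma hexagon_lattice (v : R * R) (z : int * int) : hexagon v ->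
  2 * (v.1 * (lattice z).1 + v.2 * (lattice z).2) <= (lattice z).1 ^+ 2 + (lattice z).2 ^+ 2.
Proof.
move/hexagonP => [A B D E /andP[F G]]; rewrite /lattice /=.
have Hi := int_sqr z.1; have Hj := int_sqr z.2; have Hk := int_sqr (z.1 + z.2).
rewrite intrD in Hk; move: (z.1%:~R : R) (z.2%:~R : R) Hi Hj Hk => i j Hi Hj Hk.
have -> : v.1 * (h * (2 * i + j)) + v.2 * (h * w * j) = h * (v.1 * (2 * i + j) + (w * v.2) * j) by ring.
have -> : (h * (2 * i + j)) ^+ 2 + (h * w * j) ^+ 2 = h * (2 * (h * (i ^+ 2 + j ^+ 2 + (i + j) ^+ 2))).
  by rewrite [(h * w * j) ^+ 2](_ : _ = h ^+ 2 * (w * w) * j ^+ 2); [rewrite w2|]; ring.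
rewrite mulrCA; apply: ler_wpM2l; first exact: ltW.
rewrite ler_pM2l//; apply: (@le_trans _ _ (h * (`|i| + `|j| + `|i + j|))); last first.
  by apply: ler_wpM2l; [exact: ltW|lra].
move: (w * v.2) D E F G => b D E F G; move: (v.1) A B D E F G => a A B D E F G.
have -> : a * (2 * i + j) + b * j = i * (2 * a) + j * (a + b) by ring.
have [i0|i0] := leP 0 i; have [j0|j0] := leP 0 j.
- rewrite (ger0_norm i0) (ger0_norm j0) ger0_norm ?addr_ge0//; nra.
- rewrite (ger0_norm i0) (ltr0_norm j0); have [ij|ij] := leP 0 (i + j).
    rewrite ger0_norm//.
    have -> : i * (2 * a) + j * (a + b) = (i + j) * (2 * a) + (- j) * (a - b) by ring.
    nra.
  rewrite ltr0_norm//.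
  have -> : i * (2 * a) + j * (a + b) = i * (a - b) + (- (i + j)) * (- (a + b)) by ring.
  nra.
- rewrite (ltr0_norm i0) (ger0_norm j0); have [ij|ij] := leP 0 (i + j).
    rewrite ger0_norm//.
    have -> : i * (2 * a) + j * (a + b) = (- i) * (b - a) + (i + j) * (a + b) by ring.
    nra.
  rewrite ltr0_norm//.
  have -> : i * (2 * a) + j * (a + b) = (- (i + j)) * (- (2 * a)) + j * (b - a) by ring.
  nra.
- rewrite (ltr0_norm i0) (ltr0_norm j0) ltr0_norm; last lra.
  nra.
Qed.

End honeycomb.

(** * The regions of the honeycomb *)

Section lattice_regions.
Context {R : realType} (kappa : R) (C : calibration kappa).
Notation pl := (measurableTypeR R * measurableTypeR R)%type.
Notation mu := (borel_lebesgue2 R).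
Notation enorm := (@enorm R).
Notation hexagon := (hexagon C).
Notation lattice := (lattice C).
Let r := circ C.
Let h := inrad C.
Let w : R := Num.sqrt 3.
Let k0 : 0 < kappa := kappa_gt0 C.
Let h0 : 0 < h := inrad_gt0 C.
Let r0 : 0 < r := circ_gt0 C.
Let w0 : 0 < w. Proof. by rewrite sqrtr_gt0. Qed.
Let w2 : w * w = 3. Proof. by rewrite -expr2 sqr_sqrtr. Qed.

Definition sites : set (R * R) := range lattice.

(** Ties go to every nearest site, so that the regions are closed hexagons and share
their sides. *)
Definition site_region (p : R * R) : set (R * R) :=
  [set x | forall q, sites q -> enorm (x - p) <= enorm (x - q)].

Lemma sqd_sub (x p q : R * R) : sqd x q - sqd x p =
  (q.1 - p.1) ^+ 2 + (q.2 - p.2) ^+ 2 -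
  2 * ((shift_by p x).1 * (q.1 - p.1) + (shift_by p x).2 * (q.2 - p.2)).
Proof. by rewrite /sqd /shift_by /=; ring. Qed.

Lemma latticeB (z z' : int * int) :
  ((lattice z').1 - (lattice z).1 = (lattice (z'.1 - z.1, z'.2 - z.2)).1) *
  ((lattice z').2 - (lattice z).2 = (lattice (z'.1 - z.1, z'.2 - z.2)).2).
Proof. by rewrite /lattice /= !rmorphB /=; split; ring. Qed.

(** The six nearest sites already cut out the hexagon; [hexagon_lattice] shows that the
other sites cut off nothing. *)
Lemma site_regionE p : sites p -> site_region p = shift_by p @^-1` hexagon.
Proof.
move=> [z _ zp]; apply/seteqP; split => x.
  move=> xp; set v := shift_by p x.
  have near (a b : int) : 2 * (v.1 * (lattice (a, b)).1 + v.2 * (lattice (a, b)).2) <=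
      (lattice (a, b)).1 ^+ 2 + (lattice (a, b)).2 ^+ 2.
    have := xp (lattice (z.1 + a, z.2 + b)) (ex_intro2 _ _ _ I erefl).
    rewrite enorm_le_sqd -subr_ge0 sqd_sub -zp !latticeB.
    have -> : ((z.1 + a, z.2 + b).1 - z.1, (z.1 + a, z.2 + b).2 - z.2) = (a, b).
      by rewrite /=; congr pair; rewrite addrAC subrr add0r.
    by rewrite subr_ge0 zp.
  have n1 := near 1 0; have n2 := near (- 1) 0; have n3 := near 0 1; have n4 := near 0 (- 1).
  have n5 := near (- 1) 1; have n6 := near 1 (- 1).
  have red (s t : R) : 2 * (v.1 * (h * s) + v.2 * (h * w * t)) <= (h * s) ^+ 2 + (h * w * t) ^+ 2 ->
      2 * (v.1 * s + w * v.2 * t) <= h * (s ^+ 2 + 3 * t ^+ 2).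
    have -> : 2 * (v.1 * (h * s) + v.2 * (h * w * t)) = h * (2 * (v.1 * s + w * v.2 * t)) by ring.
    have -> : (h * s) ^+ 2 + (h * w * t) ^+ 2 = h * (h * (s ^+ 2 + (w * w) * t ^+ 2)) by ring.
    by rewrite w2 ler_pM2l.
  move: n1 n2 n3 n4 n5 n6; rewrite /lattice /= -/h -/w !mulr1z ?mulr0z ?rmorphN ?mulr1z.
  move=> /red n1 /red n2 /red n3 /red n4 /red n5 /red n6.
  by apply/hexagonP; rewrite -/h -/w -/v; split; try lra; apply/andP; split; lra.
move=> xh q [z' _ z'q]; rewrite enorm_le_sqd -subr_ge0 sqd_sub -zp -z'q !latticeB.
by rewrite subr_ge0; apply: hexagon_lattice; rewrite zp.
Qed.

Lemma measurable_shift_hexagon p : measurable (shift_by p @^-1` hexagon : set pl).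
Proof.
apply: measurable_preimageT; last exact: measurable_hexagon.
by case: (preserves_shift p).
Qed.

Lemma site_region_measurable p : sites p -> measurable (site_region p : set pl).
Proof. by move=> sp; rewrite site_regionE//; exact: measurable_shift_hexagon. Qed.

Lemma site_region_area p : sites p -> area (site_region p) = mu hexagon.
Proof.
move=> sp; rewrite site_regionE// area_borel; last exact: measurable_shift_hexagon.
by have [_ ->] := preserves_shift p => //; exact: measurable_hexagon.
Qed.

Lemma hexagon_area_gt0 : 0 < fine (mu hexagon).
Proof.
have H := hexagon_area C.
have m0 : 0 < mid C by exact: lt_le_trans (inrad_gt0 C) (inrad_le_mid C).
have km : 0 < kappa * mid C by rewrite mulr_gt0.
by rewrite -(pmulr_rgt0 _ km) H.
Qed.

Lemma site_region_integral p : sites p ->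
  (kappa%:E * \int[lebesgue2]_(x in site_region p) (enorm (x - p))%:E = 2%:E)%E.
Proof.
move=> sp.
have me : measurable_fun setT (fun x : pl => (enorm (shift_by p x))%:E).
  apply/measurable_EFinP; apply: (measurableT_comp measurable_enorm).
  by case: (preserves_shift p).
have mre : measurable_fun setT (fun x : pl => (enorm x)%:E).
  by apply/measurable_EFinP; exact: measurable_enorm.
transitivity (kappa%:E * \int[mu]_(x in shift_by p @^-1` hexagon) (enorm (shift_by p x))%:E)%E.
  congr (_ * _)%E; rewrite site_regionE//.
  apply: (ge0_integral_completion (measurable_shift_hexagon p) me) => x.
  by rewrite lee_fin sqrtr_ge0.
have -> : (\int[mu]_(x in shift_by p @^-1` hexagon) (enorm (shift_by p x))%:E =
    \int[mu]_(x in hexagon) (enorm x)%:E)%E.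
  rewrite integral_mkcond [RHS]integral_mkcond.
  rewrite -[RHS](preserves_ge0_integral (preserves_shift p)).
  - by apply: eq_integral => x _; rewrite !patchE.
  - apply: (measurable_restrictT _ (measurable_hexagon C)).1; apply: measurable_funTS; exact: mre.
  - by move=> x; rewrite patchE; case: ifP => // _; rewrite lee_fin sqrtr_ge0.
have [|||iH _] := @integral_hexagon R kappa C enorm r.
- exact: measurable_enorm.
- by move=> x; rewrite enorm_rot// sixth_unit.
- by move=> x /hexagon_bounded; rewrite ger0_norm ?sqrtr_ge0.
rewrite -[X in (_ * X)%E]fineK; last first.
  by apply: integrable_fin_num => //; exact: measurable_hexagon.
by rewrite -EFinM hexagon_enorm.
Qed.

Lemma site_region_near p x : sites p -> site_region p x -> enorm (x - p) <= r.
Proof. by move=> sp; rewrite site_regionE// => /hexagon_bounded. Qed.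

Lemma site_region_overlap p q : sites p -> sites q -> p <> q ->
  area (site_region p `&` site_region q) = 0%E.
Proof.
move=> sp sq /eqP pq; have [mb b0] := bisector_null pq.
have mI : measurable (site_region p `&` site_region q : set pl).
  by apply: measurableI; exact: site_region_measurable.
rewrite area_borel//; apply/eqP; rewrite -measure_le0 -b0.
apply: le_measure; rewrite ?inE//.
move=> x [xp xq] /=; apply/eqP; rewrite eq_le -!enorm_le_sqd.
by rewrite (xp _ sq) (xq _ sp).
Qed.

Let bounded_int (M : R) : exists n : nat, forall i : int, `|i%:~R : R| <= M -> (`|i| <= n)%N.
Proof.
have [n nM] : exists n : nat, M <= n%:R.
  by exists (Num.trunc M).+1; apply/ltW/truncnS_gt.
exists n => i iM; rewrite -(ler_nat R); apply: le_trans nM.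
by rewrite natr_absz intr_norm.
Qed.

Lemma sites_locally_finite (t : R) : finite_set (sites `&` disc t).
Proof.
have [n1 H1] := bounded_int (t / (h * w)); have [n2 H2] := bounded_int ((t / h + t / (h * w)) / 2).
pose g (k : nat * nat) : R * R := lattice (k.1%:Z - n2%:Z, k.2%:Z - n1%:Z).
apply: (@sub_finite_set _ _ (g @` (`I_(2 * n2).+1 `*` `I_(2 * n1).+1))); last first.
  by apply: finite_image; apply: finite_setX; exact: finite_II.
move=> p [[z _ zp]]; rewrite /disc /= => pt.
have hw : 0 < h * w by rewrite mulr_gt0.
have b2 : (`|z.2| <= n1)%N.
  apply: H1; rewrite ler_pdivlMr// mulrC -[h * w]gtr0_norm// -normrM.
  by apply/ltW; apply: le_lt_trans pt; rewrite -zp; exact: (normr_snd_enorm (lattice z)).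
have b1 : (`|z.1| <= n2)%N.
  apply: H2.
  have e2 : `|z.2%:~R : R| <= t / (h * w).
    rewrite ler_pdivlMr// mulrC -[h * w]gtr0_norm// -normrM.
    by apply/ltW; apply: le_lt_trans pt; rewrite -zp; exact: (normr_snd_enorm (lattice z)).
  have e1 : `|2 * z.1%:~R + z.2%:~R : R| <= t / h.
    rewrite ler_pdivlMr// mulrC -[h in X in X * _]gtr0_norm// -normrM.
    by apply/ltW; apply: le_lt_trans pt; rewrite -zp; exact: (normr_fst_enorm (lattice z)).
  by move: e1 e2; rewrite !ler_norml => /andP[A B] /andP[D E]; apply/andP; split; lra.
exists (absz (z.1 + n2%:Z)%R, absz (z.2 + n1%:Z)%R); last first.
  by rewrite -zp /g /=; congr lattice; case: z b1 b2 {zp} => i j /= b1 b2; congr pair; lia.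
by case: z b1 b2 {zp} => i j /= b1 b2; split => /=; lia.
Qed.

End lattice_regions.

(** * Batches of the honeycomb *)

Lemma card_seq (T : choiceType) (s : seq T) : uniq s -> ([set` s] #= `I_(size s))%card.
Proof.
move=> us; have fin : finite_set [set` s] by apply/finite_seqP; exists s.
have /finite_setP[n sn] := fin; rewrite (_ : size s = n)//.
rewrite -(card_fset_set sn); apply: perm_size; apply: uniq_perm => //.
move=> x; rewrite -[RHS]/(x \in fset_set [set` s]) in_fset_set//.
by apply/idP/idP => [H|/set_mem//]; exact/mem_set.
Qed.

Lemma between_finite (T : choiceType) (sA sB : seq T) (N : nat) : uniq sA -> uniq sB ->
  {subset sA <= sB} -> (size sA <= N)%N -> (N <= size sB)%N ->
  exists s, [/\ uniq s, size s = N, {subset sA <= s} & {subset s <= sB}].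
Proof.
move=> uA uB AB AN NB.
pose F := [seq x <- sB | x \notin sA].
have sF : (N - size sA <= size F)%N.
  rewrite leq_subLR; apply: leq_trans NB _.
  rewrite -(count_predC (mem sA) sB) -!size_filter leq_add//.
  apply: uniq_leq_size; first exact: filter_uniq.
  by move=> x; rewrite mem_filter => /andP[].
exists (sA ++ take (N - size sA) F); split.
- rewrite cat_uniq uA take_uniq ?filter_uniq// andbT /=.
  by apply/hasPn => x /mem_take; rewrite mem_filter => /andP[].
- by rewrite size_cat size_takel// subnKC.
- by move=> x xA; rewrite mem_cat xA.
- by move=> x; rewrite mem_cat => /orP[/AB//|/mem_take]; rewrite mem_filter => /andP[].
Qed.

Section honeycomb_design.
Context {R : realType} (kappa : R) (C : calibration kappa).
Notation pl := (measurableTypeR R * measurableTypeR R)%type.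
Notation mu := (borel_lebesgue2 R).
Notation enorm := (@enorm R).
Notation lattice := (lattice C).
Notation sites := (sites C).
Notation site_region := (site_region C).
Let r := circ C.
Let h := inrad C.
Let h0 : 0 < h := inrad_gt0 C.
Let r0 : 0 < r := circ_gt0 C.

Let row (n : nat) : R * R := lattice (n%:Z, 0).

Let row_inj : injective row.
Proof.
move=> i j /(congr1 fst); rewrite /row /lattice /= !addr0 -!pmulrn => E.
have hn : inrad C != 0 by rewrite gt_eqF.
have : (i%:R : R) = j%:R.
  by apply: (mulfI (ltac:(by rewrite pnatr_eq0) : (2 : R) != 0)); exact: (mulfI hn).
by move/eqP; rewrite eqr_nat => /eqP.
Qed.

Let row_sites n : sites (row n).
Proof. by exists (n%:Z, 0). Qed.

Lemma sites_infinite : infinite_set sites.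
Proof.
move=> fs; apply: infinite_nat.
have : finite_set (row @^-1` sites).
  by apply: finite_preimage fs => i j _ _; exact: row_inj.
by apply: sub_finite_set => n _; exact: row_sites.
Qed.

Lemma site_regions_cover : \bigcup_(p in sites) site_region p = setT.
Proof.
rewrite -subTset => x _.
pose q0 := row 0; pose t := enorm x + enorm (x - q0) + 1.
have fin := sites_locally_finite C t; have /finite_seqP[s sE] := fin.
have q0t : q0 \in s.
  suff : [set` s] q0 by [].
  rewrite -sE; split; first exact: row_sites.
  rewrite /disc /= /t; have -> : enorm q0 = enorm (x + - (x - q0)) by rewrite opprB addrC subrK.
  by apply: le_lt_trans (enormD _ _) _; rewrite enormN ltrDl.
have jlt : (index q0 s < size s)%N by rewrite index_mem.
case: (Order.TotalTheory.arg_minP (P := xpredT) (fun i : 'I_(size s) => enorm (x - nth 0 s i)) (i0 := Ordinal jlt) isT) => i _ imin.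
set p := nth 0 s i in imin; have ps : [set` s] p by exact: mem_nth.
rewrite -sE in ps; exists p; first by case: ps.
move=> q sq; have [qs|qs] := boolP (q \in s).
  have qlt : (index q s < size s)%N by rewrite index_mem.
  by have := imin (Ordinal qlt) isT; rewrite /= nth_index.
have pq0 : enorm (x - p) <= enorm (x - q0).
  by have := imin (Ordinal jlt) isT; rewrite /= nth_index.
apply: le_trans pq0 _; rewrite leNgt; apply/negP => xq.
move/negP: qs; apply; suff : [set` s] q by [].
rewrite -sE; split => //; rewrite /disc /= /t.
have -> : enorm q = enorm (x + - (x - q)) by rewrite opprB addrC subrK.
apply: le_lt_trans (enormD _ _) _; rewrite enormN.
by move: xq; lra.
Qed.

Let near_sites (k : nat) : seq (R * R) :=
  finmap.enum_fset (fset_set (sites `&` disc k%:R)).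

Let near_sites_uniq k : uniq (near_sites k).
Proof. exact: finmap.fset_uniq. Qed.

Let mem_near_sites k p : p \in near_sites k <-> (sites `&` disc k%:R) p.
Proof.
have fin := sites_locally_finite C k%:R.
by rewrite -[in X in _ <-> X](fset_setK fin).
Qed.

Let near_sites_sub k l : (k <= l)%N -> {subset near_sites k <= near_sites l}.
Proof.
move=> kl p /mem_near_sites[sp pk]; apply/mem_near_sites; split => //.
by apply: lt_le_trans pk _; rewrite ler_nat.
Qed.

Let near_sites_mono k l : (k <= l)%N -> (size (near_sites k) <= size (near_sites l))%N.
Proof. by move=> kl; apply: uniq_leq_size => //; exact: near_sites_sub. Qed.

Let near_sites_unbounded N : exists k, (N < size (near_sites k))%N.
Proof.
have [k Hk] : exists k : nat, 2 * h * N%:R < k%:R.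
  by exists (Num.trunc (2 * h * N%:R)).+1; exact: truncnS_gt.
exists k; have -> : N.+1 = size [seq row n | n <- iota 0 N.+1] by rewrite size_map size_iota.
apply: uniq_leq_size; first by rewrite map_inj_uniq ?iota_uniq.
move=> p /mapP[n]; rewrite mem_iota add0n ltnS => /andP[_ nN] ->.
apply/mem_near_sites; split; first exact: row_sites.
rewrite /disc /= /row /lattice /Defs.enorm /= mulr0 addr0 expr0n addr0 sqrtr_sqr.
rewrite ger0_norm ?mulr_ge0 ?ler0n ?(ltW h0)//; apply: le_lt_trans Hk.
rewrite -/h mulrA [h * 2]mulrC; apply: ler_wpM2l; first by rewrite mulr_ge0 ?(ltW h0).
by rewrite ler_nat.
Qed.

(** A batch takes all the sites in the largest disc of integer radius that holds at most
[N] of them, and completes the number [N] with sites of the next disc. *)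
Let batch_at N : exists ks : nat * seq (R * R), [/\ uniq ks.2, size ks.2 = N,
  {subset near_sites ks.1 <= ks.2}, {subset ks.2 <= near_sites ks.1.+1} &
  forall l, (size (near_sites l) <= N)%N -> (l <= ks.1)%N].
Proof.
have ex : exists k, (size (near_sites k) <= N)%N.
  exists 0%N; rewrite (_ : near_sites 0 = [::])//.
  apply/eqP; rewrite -size_eq0 -leqn0 leqNgt; apply/negP => H.
  have := mem_nth 0 H => /mem_near_sites [_]; rewrite /disc /= ltNge => /negP; apply.
  exact: sqrtr_ge0.
have [K NK] := near_sites_unbounded N.
have ub k : (size (near_sites k) <= N)%N -> (k <= K)%N.
  move=> kN; rewrite leqNgt; apply/negP => /ltnW /near_sites_mono.
  by rewrite leqNgt (leq_ltn_trans kN).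
have [k kN kmax] := ex_maxnP ex ub.
have Nk : (N <= size (near_sites k.+1))%N.
  by rewrite leqNgt; apply/negP => /ltnW /kmax; rewrite ltnn.
have [s [us sz As sB]] := between_finite (near_sites_uniq k) (near_sites_uniq k.+1)
  (near_sites_sub (leqnSn k)) kN Nk.
by exists (k, s); split.
Qed.

Let level N : nat := (projT1 (cid (batch_at N))).1.
Definition honeycomb_batch N : set (R * R) := [set` (projT1 (cid (batch_at N))).2].

Let honeycomb_batch_card N : (honeycomb_batch N #= `I_N)%card.
Proof.
rewrite /honeycomb_batch; case: cid => -[k s] /= [us sz _ _ _].
by rewrite -[in `I_N]sz; exact: card_seq.
Qed.

Let honeycomb_batch_sub N : honeycomb_batch N `<=` sites `&` disc (level N).+1%:R.
Proof.
rewrite /honeycomb_batch /level; case: cid => -[k s] /= [_ _ _ sB _] p /= ps.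
exact/mem_near_sites/sB.
Qed.

Let honeycomb_batch_sup N : sites `&` disc (level N)%:R `<=` honeycomb_batch N.
Proof.
rewrite /honeycomb_batch /level; case: cid => -[k s] /= [_ _ sA _ _] p /mem_near_sites pk.
exact: sA.
Qed.

Let level_cvg K : \forall N \near \oo, (K <= level N)%N.
Proof.
exists (size (near_sites K)) => // N /= NK.
by rewrite /level; case: cid => -[k s] /= [_ _ _ _]; apply.
Qed.

Let batch_regions N := \bigcup_(p in honeycomb_batch N) site_region p.

Let batch_regions_sup N : disc ((level N)%:R - r) `<=` batch_regions N.
Proof.
move=> x; rewrite /disc /= => xk.
have [p sp xp] : (\bigcup_(p in sites) site_region p) x by rewrite site_regions_cover.
exists p => //; apply: honeycomb_batch_sup; split => //.
have := site_region_near sp xp; rewrite -/r => xpr.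
rewrite /disc /=; have -> : enorm p = enorm (x + - (x - p)) by rewrite opprB addrC subrK.
by apply: le_lt_trans (enormD _ _) _; rewrite enormN; move: xk xpr; lra.
Qed.

Let batch_regions_sub N : batch_regions N `<=` disc ((level N)%:R + 1 + r).
Proof.
move=> x [p /honeycomb_batch_sub[sp pk] xp].
have := site_region_near sp xp; rewrite -/r => xpr.
move: pk; rewrite /disc /= -natr1 => pk.
rewrite -[x in enorm x](subrK p); apply: le_lt_trans (enormD _ _) _.
by move: pk xpr; lra.
Qed.

Let batch_regions_measurable N : measurable (batch_regions N : set pl).
Proof.
apply: fin_bigcup_measurable; first by apply/finite_setP; exists N; exact: honeycomb_batch_card.
by move=> p /honeycomb_batch_sub[sp _]; exact: site_region_measurable.
Qed.

(** The regions of a batch lie between discs whose radii differ by a constant, so the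
excess area is linear in the radius and the total area quadratic. *)
Let honeycomb_exhaust : exists rho : nat -> R,
    [/\ rho @ \oo --> +oo,
        \forall N \near \oo, area (disc (rho N) `\` batch_regions N) = 0%E &
        (fun N => fine (area (batch_regions N `\` disc (rho N)))
                  / fine (area (batch_regions N))) @ \oo --> 0].
Proof.
exists (fun N => (level N)%:R - r); split.
- apply/cvgryPge => A.
  have [K HK] : exists K : nat, A + r <= K%:R.
    by exists (Num.trunc (A + r)).+1; apply/ltW/truncnS_gt.
  apply: filterS (level_cvg K) => N; rewrite -(ler_nat R) => KN.
  by rewrite lerBrDr; exact: le_trans HK KN.
- apply: nearW => N; rewrite (_ : _ `\` _ = set0); first exact: measure0.
  by rewrite setD_eq0; exact: batch_regions_sup.
apply/cvgr0Pnorm_le => eps e0.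
pose q : R := discarea (1 : R); have q0 : 0 < q by exact: discarea1_gt0.
pose c := 1 + 2 * r; have c0 : 0 < c by rewrite /c addr_gt0// mulr_gt0.
have [K HK] : exists K : nat, 2 * r + 1 + 12 * c / eps <= K%:R.
  by exists (Num.trunc (2 * r + 1 + 12 * c / eps)).+1; apply/ltW/truncnS_gt.
apply: filterS (level_cvg K) => N; rewrite -(ler_nat R) => KN.
set k : R := (level N)%:R in KN *.
have ce0 : 0 < 12 * c / eps by rewrite divr_gt0// mulr_gt0.
have k2r : 2 * r <= k by move: HK KN ce0; lra.
have k1 : 1 <= k by move: HK KN ce0 r0; lra.
have kc : 12 * c / eps <= k by move: HK KN r0; lra.
have kr0 : 0 < k - r by move: k2r r0; lra.
have kr1 : 0 < k + 1 + r by move: k1 r0; lra.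
have mU := @batch_regions_measurable N.
have mD t : measurable (disc t : set pl) := @measurable_disc R t.
have mUD : measurable (batch_regions N `\` disc (k - r) : set pl) by exact: measurableD.
have mDD : measurable (disc (k + 1 + r) `\` disc (k - r) : set pl) by exact: measurableD.
rewrite !area_borel//.
have lty (A : set pl) t : measurable A -> A `<=` disc t -> mu A \is a fin_num.
  move=> mA At; rewrite ge0_fin_numE ?measure_ge0//; apply: le_lt_trans (area_disc_lty t).
  by apply: le_measure => //; apply/mem_set => //; exact: mD.
have num : fine (mu (batch_regions N `\` disc (k - r))) <= ((k + 1 + r) ^+ 2 - (k - r) ^+ 2) * q.
  rewrite mulrBl -!discareaE// /discarea -fineB ?discarea_fin//.
  have sub : (disc (k - r) : set pl) `<=` disc (k + 1 + r).
    by move=> x; rewrite /disc /= => /lt_le_trans; apply; move: r0; lra.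
  have E : mu (disc (k + 1 + r) `\` disc (k - r)) = (mu (disc (k + 1 + r)) - mu (disc (k - r)))%E.
    rewrite measureD//; last exact: area_disc_lty.
    by have /setIidPr -> := sub.
  rewrite -E; apply: fine_le.
  - by apply: (lty _ (k + 1 + r)) => //; move=> x [/batch_regions_sub].
  - by apply: (lty _ (k + 1 + r)) => //; move=> x [].
  by apply: le_measure; [exact/mem_set|exact/mem_set|apply: setSD; exact: batch_regions_sub].
have den : (k - r) ^+ 2 * q <= fine (mu (batch_regions N)).
  rewrite -discareaE// /discarea; apply: fine_le.
  - exact: (lty _ (k - r)).
  - by apply: (lty _ (k + 1 + r)) => //; exact: batch_regions_sub.
  by apply: le_measure; [exact/mem_set|exact/mem_set|exact: batch_regions_sup].
have dpos : 0 < (k - r) ^+ 2 * q by rewrite mulr_gt0// exprn_gt0.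
have upos := lt_le_trans dpos den.
rewrite ger0_norm; last by rewrite divr_ge0// fine_ge0// measure_ge0.
rewrite ler_pdivrMr//; apply: le_trans num _.
apply: le_trans (ler_wpM2l (ltW e0) den).
rewrite mulrA; apply: ler_wpM2r; first exact: ltW.
have -> : (k + 1 + r) ^+ 2 - (k - r) ^+ 2 = c * (2 * k + 1) by rewrite /c; ring.
have ek : 12 * c <= eps * k by move: kc; rewrite ler_pdivrMr// [k * _]mulrC.
have lo : (k / 2) ^+ 2 <= (k - r) ^+ 2 by rewrite ler_sqr ?nnegrE; move: k2r k1; lra.
apply: le_trans (ler_wpM2l (ltW e0) lo).
have -> : eps * (k / 2) ^+ 2 = (eps * k) * (k / 4) by field.
apply: (@le_trans _ _ (12 * c * (k / 4))).
  have -> : 12 * c * (k / 4) = c * (3 * k) by field.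
  by apply: ler_wpM2l; [exact: ltW|move: k1; lra].
by apply: ler_wpM2r => //; move: k1; lra.
Qed.

Definition honeycomb : design R.
Proof.
refine (@Design R sites site_region honeycomb_batch (@sites_locally_finite _ _ C) sites_infinite
  _ _ _ site_regions_cover (@site_region_overlap _ _ C) _ _ _ honeycomb_exhaust).
- by move=> p sp; apply: borel_lebesgue_measurable; exact: site_region_measurable.
- by move=> p sp; rewrite site_region_area// -(fineK (hexagon_area_fin C)) lte_fin; exact: hexagon_area_gt0.
- by move=> p sp; rewrite site_region_area//; rewrite -ge0_fin_numE ?measure_ge0//; exact: hexagon_area_fin.
- by move=> p q x sp sq; apply.
- by move=> N _ p /honeycomb_batch_sub[].
- by move=> N _; exact: honeycomb_batch_card.
Defined.
End honeycomb_design.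

(** * The cost of the honeycomb *)

(** All regions have the same area and the same cost 1 + 2, so the sequence is constant
from N = 1 on, with value 3 f / |hexagon|; this is [f * (kappa * mid C)] by
[hexagon_area]. *)
Lemma honeycomb_cost_le (R : realType) (f kappa : R) (C : calibration kappa) :
  (cost f kappa (honeycomb C) <= (f * (kappa * mid C))%:E)%E.
Proof.
pose a := fine (borel_lebesgue2 R (hexagon C)).
have a0 : 0 < a := hexagon_area_gt0 C.
rewrite /cost /=.
suff H : (fun N => ((f / \sum_(p \in honeycomb_batch C N) fine (area (site_region C p)))%:E *
    \sum_(p \in honeycomb_batch C N)
      (1 + kappa%:E *
           \int[lebesgue2]_(x in site_region C p) (enorm (x - p))%:E))%E) @ \oo --> (f * (kappa * mid C))%:E.
  by have [-> _] := cvg_limn_einf_sup H.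
apply: cvg_near_cst; exists 1%N => // N /= N0.
have sub := @batch_sub _ (honeycomb C) N N0.
have [s [us sz sE]] : exists s : seq (R * R), [/\ uniq s, size s = N & honeycomb_batch C N = [set` s]].
  by rewrite /honeycomb_batch; case: cid => -[k s] /= [us sz _ _ _]; exists s.
have ss p : p \in s -> sites C p by move=> ps; apply: sub; rewrite /= sE.
rewrite sE -!fsbig_seq//.
rewrite (eq_big_seq (fun=> a)); last by move=> p /ss sp; rewrite site_region_area.
rewrite (eq_big_seq (fun=> 3%:E)); last first.
  by move=> p /ss sp; rewrite site_region_integral// -EFinD; congr (_%:E); ring.
rewrite sumEFin !big_const_seq !count_predT !iter_addr_0 sz -EFinM; congr (_%:E).
have E : kappa * mid C * a = 3 := hexagon_area C.
rewrite -E -[a *+ N]mulr_natr -mulrnAr -mulr_natr.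
have N0' : N%:R != 0 :> R by rewrite pnatr_eq0 -lt0n.
by field; rewrite N0' gt_eqF.
Qed.

(** * Regions as convex hulls *)

(** Because cos (3 x) = 4 cos^3 x - 3 cos x vanishes at x = pi/6. *)
Lemma cos_sin_pi6 (R : realType) :
  (cos (pi / 6 : R) = Num.sqrt 3 / 2) * (sin (pi / 6 : R) = 1 / 2).
Proof.
have p0 : 0 < pi :> R := pi_gt0 R.
have c0 : 0 < cos (pi / 6 : R) by apply: cos_gt0_pihalf; apply/andP; split; lra.
have s0 : 0 < sin (pi / 6 : R) by apply: sin_gt0_pihalf; apply/andP; split; lra.
have w0 : 0 < Num.sqrt 3 :> R by rewrite sqrtr_gt0.
have w2 : Num.sqrt 3 * Num.sqrt 3 = 3 :> R by rewrite -expr2 sqr_sqrtr.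
have cs := cos2Dsin2 (pi / 6 : R).
have := cos_pihalf R.
have -> : pi / 2 = pi / 6 + (pi / 6 + pi / 6) :> R by field.
rewrite !(cosD, sinD).
move: c0 s0 cs; set c := cos _; set s := sin _ => c0 s0 cs E.
have c2 : c * c = 3 / 4.
  have : c * (4 * (c * c) - 3) = 0.
    rewrite -E; have -> : 3 = 3 * (c ^+ 2 + s ^+ 2) by rewrite cs mulr1.
    ring.
  by move/eqP; rewrite mulf_eq0 gt_eqF//= => /eqP; lra.
split.
  have : (c - Num.sqrt 3 / 2) * (c + Num.sqrt 3 / 2) = 0.
    have -> : (c - Num.sqrt 3 / 2) * (c + Num.sqrt 3 / 2) = c * c - (Num.sqrt 3 * Num.sqrt 3) / 4 by field.
    by rewrite c2 w2 subrr.
  by move/eqP; rewrite mulf_eq0 => /orP[|] /eqP; lra.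
have : (s - 1 / 2) * (s + 1 / 2) = 0.
  have -> : (s - 1 / 2) * (s + 1 / 2) = (c ^+ 2 + s ^+ 2) - c * c - 1 / 4 by field.
  by rewrite cs c2; lra.
by move/eqP; rewrite mulf_eq0 => /orP[|] /eqP; lra.
Qed.

Lemma cos_sin_pi3 (R : realType) :
  (cos (pi / 3 : R) = 1 / 2) * (sin (pi / 3 : R) = Num.sqrt 3 / 2).
Proof.
have w2 : Num.sqrt 3 * Num.sqrt 3 = 3 :> R by rewrite -expr2 sqr_sqrtr.
have -> : pi / 3 = pi / 6 + pi / 6 :> R by field.
rewrite cosD sinD !cos_sin_pi6; split; last by field.
have -> : Num.sqrt 3 / 2 * (Num.sqrt 3 / 2) = (Num.sqrt 3 * Num.sqrt 3) / 4 :> R by field.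
by rewrite w2; field.
Qed.

Section unit_hexagon.
Context {R : realType}.

(** Coordinates of the vertices, the abscissa in units of the inradius h and the ordinate
in units of h / sqrt 3. *)
Definition vertex_abscissa (i : 'I_6) : R := nth 0 [:: 1; 0; -1; -1; 0; 1] i.
Definition vertex_ordinate (i : 'I_6) : R := nth 0 [:: 1; 2; 1; -1; -2; -1] i.

Lemma hull_bounds (t : 'I_6 -> R) : (forall i, 0 <= t i) -> \sum_i t i = 1 ->
  forall u v M : R, (forall i, u * vertex_abscissa i + v * vertex_ordinate i <= M) ->
  u * (\sum_i t i * vertex_abscissa i) + v * (\sum_i t i * vertex_ordinate i) <= M.
Proof.
move=> t0 t1 u v M uvM; rewrite !mulr_sumr -big_split /= -[M]mul1r -t1 mulr_suml.
apply: ler_sum => i _; rewrite [u * _]mulrCA [v * _]mulrCA -mulrDr.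
exact: ler_wpM2l.
Qed.

(** The hexagon is a rectangle, [-1 <= B <= 1], on whose four corners bilinear weights
do, and two triangles with barycentric weights. *)
Lemma hull_weights (A B : R) : - 1 <= A -> A <= 1 -> - 2 <= A + B -> A + B <= 2 ->
  - 2 <= A - B -> A - B <= 2 ->
  exists s : 'I_6 -> R, [/\ forall i, 0 <= s i, \sum_i s i = 1,
    \sum_i s i * vertex_abscissa i = A & \sum_i s i * vertex_ordinate i = B].
Proof.
move=> A1 A2 AB1 AB2 AB3 AB4.
have build (a0 a1 a2 a3 a4 a5 : R) : 0 <= a0 -> 0 <= a1 -> 0 <= a2 -> 0 <= a3 ->
    0 <= a4 -> 0 <= a5 -> a0 + a1 + a2 + a3 + a4 + a5 = 1 -> a0 - a2 - a3 + a5 = A ->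
    a0 + 2 * a1 + a2 - a3 - 2 * a4 - a5 = B ->
    exists s : 'I_6 -> R, [/\ forall i, 0 <= s i, \sum_i s i = 1,
    \sum_i s i * vertex_abscissa i = A & \sum_i s i * vertex_ordinate i = B].
  move=> ? ? ? ? ? ? s1 sA sB; exists (fun i => nth 0 [:: a0; a1; a2; a3; a4; a5] i).
  rewrite /vertex_abscissa /vertex_ordinate !big_ord_recl !big_ord0 /=; split.
  - by case=> [[|[|[|[|[|[|n]]]]]]].
  - by rewrite -s1; ring.
  - by rewrite -sA; ring.
  - by rewrite -sB; ring.
have [B1|B1] := leP 1 B.
  by apply: (build (((2 - B) + A) / 2) (B - 1) (((2 - B) - A) / 2) 0 0 0); lra.
have [B2|B2] := leP B (-1).
  by apply: (build 0 0 0 (((2 + B) - A) / 2) (- B - 1) (((2 + B) + A) / 2)); lra.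
have [pA nA pB nB] : [/\ 0 <= 1 + A, 0 <= 1 - A, 0 <= 1 + B & 0 <= 1 - B] by split; lra.
apply: (build ((1 + A) * (1 + B) / 4) 0 ((1 - A) * (1 + B) / 4) ((1 - A) * (1 - B) / 4) 0
  ((1 + A) * (1 - B) / 4)) => //; (try by field); by rewrite divr_ge0// mulr_ge0.
Qed.
End unit_hexagon.

Section regular_hexagons.
Context {R : realType} (kappa : R) (C : calibration kappa).
Let r := circ C.
Let h := inrad C.
Let w : R := Num.sqrt 3.
Let h0 : 0 < h := inrad_gt0 C.
Let r0 : 0 < r := circ_gt0 C.
Let r2 : r ^+ 2 = 4 / 3 * h ^+ 2 := circ_sqr C.
Let w0 : 0 < w. Proof. by rewrite sqrtr_gt0. Qed.
Let w2 : w * w = 3. Proof. by rewrite -expr2 sqr_sqrtr. Qed.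

Let rE : r = 2 * h * w / 3.
Proof.
have : (r - 2 * h * w / 3) * (r + 2 * h * w / 3) = 0.
  have -> : (r - 2 * h * w / 3) * (r + 2 * h * w / 3) = r ^+ 2 - 4 / 9 * h ^+ 2 * (w * w) by field.
  by rewrite w2 r2; field.
have : 0 < 2 * h * w / 3 by rewrite !mulr_gt0.
move: r0; move: (2 * h * w / 3) r => X r' r'0 X0 /eqP.
by rewrite mulf_eq0 => /orP[|] /eqP; lra.
Qed.

(** By the addition formulas, a rotation by pi/3 maps the coordinates (a, b) of a vertex to
((a - b) / 2, (3 a + b) / 2). *)
Let vertexE c (i : 'I_6) : hexagon_vertex c r (pi / 6) i =
  (c.1 + h * vertex_abscissa i,
   c.2 + h * w / 3 * vertex_ordinate i).
Proof.
pose P (n : nat) (a b : R) := cos (pi / 6 + n%:R * (pi / 3)) = w / 2 * a /\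
  sin (pi / 6 + n%:R * (pi / 3)) = b / 2.
have next n a b : P n a b -> P n.+1 ((a - b) / 2) ((b + 3 * a) / 2).
  rewrite /P => -[ca sb].
  have -> : pi / 6 + n.+1%:R * (pi / 3) = pi / 6 + n%:R * (pi / 3) + pi / 3 :> R.
    by rewrite -natr1; ring.
  rewrite (cosD _ (pi / 3)) (sinD _ (pi / 3)) ca sb !cos_sin_pi3 -/w; split; first by field.
  by rewrite -[in RHS]w2; field.
have P0 : P 0%N 1 1.
  by rewrite /P mul0r addr0 !cos_sin_pi6 mulr1.
have P1 : P 1%N 0 2 by have := next _ _ _ P0; congr P; field.
have P2 : P 2%N (- 1) 1 by have := next _ _ _ P1; congr P; field.
have P3 : P 3%N (- 1) (- 1) by have := next _ _ _ P2; congr P; field.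
have P4 : P 4%N 0 (- 2) by have := next _ _ _ P3; congr P; field.
have P5 : P 5%N 1 (- 1) by have := next _ _ _ P4; congr P; field.
have H a b : P i a b -> hexagon_vertex c r (pi / 6) i = (c.1 + h * a, c.2 + h * w / 3 * b).
  rewrite /P /hexagon_vertex => -[-> ->]; rewrite rE; congr (_ + _, _ + _); last by field.
  have -> : 2 * h * w / 3 * (w / 2 * a) = (w * w) / 3 * h * a by field.
  by rewrite w2; field.
by apply: H; case: i => [[|[|[|[|[|[|n]]]]]]].
Qed.

Lemma hexagon_hull c : shift_by c @^-1` hexagon C = convex_hull_of (hexagon_vertex c r (pi / 6)).
Proof.
apply/seteqP; split => x.
  rewrite /preimage /= => /hexagonP; rewrite -/h -/w /shift_by /=.
  pose A := (x.1 + - c.1) / h; pose B := w * (x.2 + - c.2) / h.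
  have hn : h != 0 by rewrite gt_eqF.
  have x1E : x.1 = c.1 + h * A by rewrite /A; field.
  have x2E : x.2 = c.2 + h * w / 3 * B.
    rewrite /B; have -> : h * w / 3 * (w * (x.2 + - c.2) / h) = (w * w) / 3 * (x.2 - c.2) by field.
    by rewrite w2; field.
  have -> : x.1 + - c.1 = h * A by rewrite x1E; ring.
  have -> : w * (x.2 + - c.2) = h * B by rewrite /B; field.
  move: A B x1E x2E => A B x1E x2E [A1 A2 AB1 AB2 /andP[AB3 AB4]].
  have cancel u v : h * u <= h * v -> u <= v by rewrite ler_pM2l.
  have {}A1 : - 1 <= A by apply: cancel; move: A1; lra.
  have {}A2 : A <= 1 by apply: cancel; move: A2; lra.
  have {}AB1 : - 2 <= A + B by apply: cancel; move: AB1; lra.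
  have {}AB2 : A + B <= 2 by apply: cancel; move: AB2; lra.
  have {}AB3 : - 2 <= A - B by apply: cancel; move: AB3; lra.
  have {}AB4 : A - B <= 2 by apply: cancel; move: AB4; lra.
  have [s [s0 s1 sA sB]] := hull_weights A1 A2 AB1 AB2 AB3 AB4.
  exists s; split => //; under eq_bigr do rewrite vertexE /= mulrDr mulrCA.
    by rewrite big_split /= -mulr_suml s1 mul1r -mulr_sumr sA.
  by rewrite big_split /= -mulr_suml s1 mul1r -mulr_sumr sB.
move=> [t [t0 t1 x1 x2]]; apply/hexagonP; rewrite -/h -/w /=.
move: t1 x1 x2.
under [in X in _ -> X -> _]eq_bigr do rewrite vertexE /= mulrDr mulrCA.
under [in X in _ -> _ -> X -> _]eq_bigr do rewrite vertexE /= mulrDr mulrCA.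
rewrite !big_split /= -!mulr_suml => t1; rewrite t1 !mul1r -!mulr_sumr => -> ->.
set A := \sum_i _; set B := \sum_i _.
have -> : c.1 + h * A + - c.1 = h * A by ring.
have -> : w * (c.2 + h * w / 3 * B + - c.2) = h * B.
  have -> : w * (c.2 + h * w / 3 * B + - c.2) = h * B * (w * w) / 3 by ring.
  by rewrite w2; field.
have bnd u v M : (forall i, u * vertex_abscissa i + v * vertex_ordinate i <= M) ->
    h * (u * A + v * B) <= h * M.
  by move=> /(hull_bounds t0 t1) uvM; rewrite ler_pM2l.
have b1 : h * (1 * A + 0 * B) <= h * 1.
  by apply: bnd => -[[|[|[|[|[|[|n]]]]]]] // ?; rewrite /vertex_abscissa /vertex_ordinate /=; lra.
have b2 : h * ((- 1) * A + 0 * B) <= h * 1.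
  by apply: bnd => -[[|[|[|[|[|[|n]]]]]]] // ?; rewrite /vertex_abscissa /vertex_ordinate /=; lra.
have b3 : h * (1 * A + 1 * B) <= h * 2.
  by apply: bnd => -[[|[|[|[|[|[|n]]]]]]] // ?; rewrite /vertex_abscissa /vertex_ordinate /=; lra.
have b4 : h * ((- 1) * A + (- 1) * B) <= h * 2.
  by apply: bnd => -[[|[|[|[|[|[|n]]]]]]] // ?; rewrite /vertex_abscissa /vertex_ordinate /=; lra.
have b5 : h * (1 * A + (- 1) * B) <= h * 2.
  by apply: bnd => -[[|[|[|[|[|[|n]]]]]]] // ?; rewrite /vertex_abscissa /vertex_ordinate /=; lra.
have b6 : h * ((- 1) * A + 1 * B) <= h * 2.
  by apply: bnd => -[[|[|[|[|[|[|n]]]]]]] // ?; rewrite /vertex_abscissa /vertex_ordinate /=; lra.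
move: b1 b2 b3 b4 b5 b6; move: (A) (B) => a b *.
by split; [lra|lra|lra|lra|apply/andP; split; lra].
Qed.

Lemma site_region_regular p : sites C p -> regular_hexagon (site_region C p).
Proof.
move=> sp; exists p, r, (pi / 6); split => //.
by rewrite site_regionE// hexagon_hull.
Qed.

Lemma site_region_congruent p q : sites C p -> sites C q ->
  congruent (site_region C p) (site_region C q).
Proof.
move=> sp sq; exists (fun x => x + (q - p)); split.
  by move=> x y; rewrite opprD addrACA subrr addr0.
rewrite !site_regionE//; apply/seteqP; split => x.
  move=> [y yp <-]; move: yp; rewrite /preimage /= !shift_byE.
  by rewrite (_ : y + (q - p) - q = y - p)// addrCA [q + _]addrC addrK.
move=> xq; exists (x - (q - p)); last by rewrite subrK.
move: xq; rewrite /preimage /= !shift_byE.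
by rewrite (_ : x - (q - p) - p = x - q)// -addrA -opprD subrK.
Qed.
End regular_hexagons.

Unset Implicit Arguments.

Theorem proposition1 (R : realType) (f kappa : R)
    (f_gt0 : 0 < f) (kappa_gt0 : 0 < kappa) :
  exists D : design R,
    [/\ forall p, facilities D p -> regular_hexagon (region D p),
        forall p q, facilities D p -> facilities D q ->
          congruent (region D p) (region D q) &
        forall D' : design R, (cost f kappa D <= cost f kappa D')%E].
Proof.
have [C] := exists_calibration kappa_gt0.
exists (honeycomb C); split.
- exact: site_region_regular.
- exact: site_region_congruent.
by move=> D'; apply: le_trans (honeycomb_cost_le f C) (cost_ge C D' f_gt0).
Qed.
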